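(* Let $X$ be a complex analytic manifold of dimension $n$, let $p_1,\dots,p_m$ be positive integers, let $r$ be a non-negative integer, and let $q$ be an integer with $0\le q\le n$. Let $\mathbb{C}\{u_1,v_1,\dots,u_m,v_m\}$ be the anti-commutative algebra of polynomials in the variables $u_1,v_1,\dots,u_m,v_m$, of degrees $\deg u_i=p_i$ and $\deg v_i=p_i+1$. If $$P\colon \Lambda^{p_1}T^*X\oplus\cdots\oplus\Lambda^{p_m}T^*X\rightsquigarrow\Lambda^qT^*X$$ is a natural holomorphic differential operator of order $\le r$, then there exists a unique homogeneous polynomial $\mathbf{P}(u_1,v_1,\dots,u_m,v_m)\in\mathbb{C}\{u_1,v_1,\dots,u_m,v_m\}$ of degree $q$ such that $$P(j^r_x\omega_1,\dots,j^r_x\omega_m)=\mathbf{P}(\omega_1,\mathrm{d}\omega_1,\dots,\omega_m,\mathrm{d}\omega_m)_x$$ for every point $x\in X$ and all germs $\omega_i$ at $x$ of holomorphic $p_i$-forms, $i=1,\dots,m$.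
   Context: $T^*X$ is the holomorphic cotangent bundle of $X$, and $\Lambda^pT^*X$ its $p$-th exterior power. Write $F=\Lambda^{p_1}T^*X\oplus\cdots\oplus\Lambda^{p_m}T^*X$; $J^rF\to X$ is the bundle of $r$-jets of local holomorphic sections $(\omega_1,\dots,\omega_m)$ of $F$. Lifts: every biholomorphism $\tau\colon U\to V$ between open sets of $X$ lifts to $\Lambda^pT^*X$ (and componentwise to $F$) by $\tau_*=(\tau^{-1})^*$ (transport of forms along $\tau$), and to the jet bundle by $\tau_*(j^r_xs)=j^r_{\tau(x)}(\tau_*s)$. A natural holomorphic differential operator $P\colon F\rightsquigarrow\Lambda^qT^*X$ of order $\le r$ is a holomorphic morphism of fibre bundles $P\colon J^rF\to\Lambda^qT^*X$ over $X$ (not assumed linear on fibres) such that $P\circ\tau_*=\tau_*\circ P$ over $U$ for every biholomorphism $\tau\colon U\to V$ between open sets of $X$. Anti-commutative algebra: given variables $w_1,\dots,w_N$ with assigned positive degrees $d_1,\dots,d_N$, $\mathbb{C}\{w_1,\dots,w_N\}$ denotes the associative unital $\mathbb{C}$-algebra of polynomials in these variables subject to the relations $w_iw_j=(-1)^{d_id_j}w_jw_i$ (including $i=j$, so $w_i^2=0$ if $d_i$ is odd). The degree of a monomial $w_1^{a_1}\cdots w_N^{a_N}$ is $\sum a_id_i$, and a polynomial is homogeneous of degree $q$ if it is a linear combination of monomials of degree $q$. Evaluating a homogeneous polynomial of degree $q$ on differential forms of degrees $d_1,\dots,d_N$ means substituting the forms for the variables and replacing products by exterior products, giving a $q$-form.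 *)

(* Defs.v *)
From HB Require Import structures.
From mathcomp Require Import all_boot all_order all_algebra.
From mathcomp Require Import all_classical all_reals all_analysis.
From mathcomp Require Import complex.

Set Implicit Arguments.
Unset Strict Implicit.
Unset Printing Implicit Defensive.
Import Order.TTheory GRing.Theory Num.Theory.
Import numFieldNormedType.Exports.
Local Open Scope classical_set_scope.
Local Open Scope ring_scope.

(* [R[i]] seen as a numeric field, so that it carries the topology of the
   modulus and ['rV[cplx R]_n] is a complex normed module. *)
Definition cplx (R : realType) : numClosedFieldType := R[i].

Section Holomorphic.
Variable R : realType.
Local Notation C := (cplx R).

(* [f] is holomorphic at [a]: on some polydisc around [a] it is the sum of an
   absolutely convergent power series. The radius [rho] and the bound [M] are
   complex numbers, but [0 < rho] and [_ <= M] force them to be real. *)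
Definition holo_at k (f : 'rV[C]_k -> C) (a : 'rV[C]_k) : Prop :=
  exists (c : {ffun 'I_k -> nat} -> C) (rho : C),
    [/\ 0 < rho,
        exists M : C, forall N : nat,
          \sum_(al : {ffun 'I_k -> 'I_N})
            `|c [ffun i => al i : nat]| * rho ^+ (\sum_i al i)%N <= M
      & forall z : 'rV[C]_k, (forall i, `|z 0 i - a 0 i| < rho) ->
          (fun N : nat => \sum_(al : {ffun 'I_k -> 'I_N})
             c [ffun i => al i : nat] * \prod_i (z 0 i - a 0 i) ^+ al i)
          @ \oo --> f z].

Definition holo_vec_at k l (f : 'rV[C]_k -> 'rV[C]_l) (a : 'rV[C]_k) : Prop :=
  forall i, holo_at (fun z => f z 0 i) a.

Definition partial k (j : 'I_k) (f : 'rV[C]_k -> C) : 'rV[C]_k -> C :=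
  fun z => 'D_(delta_mx 0 j) f z.

(* The order of the partial derivatives is fixed; for holomorphic [f] it is
   irrelevant. *)
Definition multi_partial k (al : 'I_k -> nat) (f : 'rV[C]_k -> C) :
    'rV[C]_k -> C :=
  foldr (fun j g => iter (al j) (partial j) g) f (enum 'I_k).

End Holomorphic.

Section ExteriorAlgebra.
Variables (R : realType) (n : nat).
Local Notation C := (cplx R).

(* The exterior algebra of the dual of C^n, in its standard basis:
   [a I] is the coefficient of dz_I = dz_i1 /\ ... /\ dz_ik, where
   I = {i1 < ... < ik}. *)
Definition ext := {ffun {set 'I_n} -> C}.

Definition ext_homog (p : nat) (a : ext) : Prop :=
  forall I : {set 'I_n}, #|I| != p -> a I = 0.

Definition ext_scale (c : C) (a : ext) : ext := [ffun I => c * a I].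

Definition ext_one : ext := [ffun I : {set 'I_n} => (I == finset.set0)%:R].

Definition dz (j : 'I_n) : ext := [ffun I : {set 'I_n} => (I == [set j]%SET)%:R].

(* dz_I /\ dz_J = shuffle_sign I J * dz_(I :|: J) for disjoint I and J. *)
Definition shuffle_sign (I J : {set 'I_n}) : C :=
  (-1) ^+ #|[set ij : 'I_n * 'I_n |
              [&& ij.1 \in I, ij.2 \in J & (ij.2 < ij.1)%N]]%SET|.

Definition ext_mul (a b : ext) : ext :=
  [ffun K : {set 'I_n} => \sum_(I : {set 'I_n} | I \subset K)
     shuffle_sign I (K :\: I)%SET * a I * b (K :\: I)%SET].

(* Pull-back along a linear map C^n -> C^n. As in [jacobian], matrices act on
   row vectors, so that for [J] the Jacobian matrix of [f] the pull-back of
   dz_i is the sum of the [J j i] dz_j, with [J j i] the j-th partial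
   derivative of the i-th component of [f]. *)
Definition ext_pull (J : 'M[C]_n) (a : ext) : ext :=
  \sum_(I : {set 'I_n})
    ext_scale (a I) (\big[ext_mul/ext_one]_(i <- enum I)
                       \sum_(j < n) ext_scale (J j i) (dz j)).

(* The exterior derivative of a form on (an open subset of) C^n. *)
Definition ext_deriv (w : 'rV[C]_n -> ext) (z : 'rV[C]_n) : ext :=
  \sum_(j < n) ext_mul (dz j) [ffun I => partial j (fun z => w z I) z].

End ExteriorAlgebra.

Section Manifold.
Variables (R : realType) (n : nat).
Local Notation C := (cplx R).

Record chart (X : topologicalType) := Chart {
  cdom : set X;
  cmap : X -> 'rV[C]_n;
  cinv : 'rV[C]_n -> X;
  cdom_open : open cdom;
  cimg_open : open (cmap @` cdom);
  cmapK : forall x, cdom x -> cinv (cmap x) = x;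
  cmap_cont : forall x, cdom x -> {for x, continuous cmap};
  cinv_cont : forall x, cdom x -> {for cmap x, continuous cinv}
}.

Record cmanifold := CManifold {
  carrier :> topologicalType;
  atlas : set (chart carrier);
  atlas_cover : forall x, exists c, atlas c /\ cdom c x;
  atlas_compat : forall c1 c2, atlas c1 -> atlas c2 ->
    forall x, cdom c1 x -> cdom c2 x ->
      holo_vec_at (cmap c2 \o cinv c1) (cmap c1 x);
  carrier_hausdorff : hausdorff_space carrier;
  carrier_countable : @second_countable carrier
}.

Variable X : cmanifold.

(* A preferred chart around each point. The tangent space of X at x is C^n,
   through the preferred chart at x; hence the exterior algebra of the
   cotangent space of X at x is [ext R n], and its degree p part consists of
   the [a] such that [ext_homog p a]. All the values at x of forms below are
   expressed in the preferred chart at x. *)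
Definition chart_at (x : X) : chart X := projT1 (cid (atlas_cover x)).

(* The expression in the chart [c] of the element [a] of the exterior algebra
   of the cotangent space at y. *)
Definition covector_expr (c : chart X) (y : X) (a : ext R n) : ext R n :=
  ext_pull ('J (cmap (chart_at y) \o cinv c) (cmap c y)) a.

Definition form_expr (c : chart X) (w : X -> ext R n) (z : 'rV[C]_n) :
    ext R n :=
  covector_expr c (cinv c z) (w (cinv c z)).

Definition holo_form_near (p : nat) (w : X -> ext R n) (x : X) : Prop :=
  \forall y \near x, ext_homog p (w y) /\
    forall I : {set 'I_n},
      holo_at (fun z => form_expr (chart_at x) w z I) (cmap (chart_at x) y).

Definition form_deriv (w : X -> ext R n) (x : X) : ext R n :=
  ext_deriv (form_expr (chart_at x) w) (cmap (chart_at x) x).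

Definition holo_map_at (f : X -> X) (x : X) : Prop :=
  {for x, continuous f} /\
  exists c1 c2, [/\ atlas c1, cdom c1 x, atlas c2, cdom c2 (f x)
    & holo_vec_at (cmap c2 \o f \o cinv c1) (cmap c1 x)].

Definition map_jacobian (f : X -> X) (x : X) : 'M[C]_n :=
  'J (cmap (chart_at (f x)) \o f \o cinv (chart_at x)) (cmap (chart_at x) x).

(* The values of [bih] outside [bdom] and of [bihV] outside [bcod] are
   irrelevant. *)
Record biholo := Biholo {
  bdom : set X;
  bcod : set X;
  bih :> X -> X;
  bihV : X -> X;
  bdom_open : open bdom;
  bcod_open : open bcod;
  bih_cod : forall x, bdom x -> bcod (bih x);
  bihV_dom : forall y, bcod y -> bdom (bihV y);
  bihK : forall x, bdom x -> bihV (bih x) = x;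
  bihVK : forall y, bcod y -> bih (bihV y) = y;
  bih_holo : forall x, bdom x -> holo_map_at bih x;
  bihV_holo : forall y, bcod y -> holo_map_at bihV y
}.

(* The lift of [tau] to the exterior algebra of the cotangent space at x, with
   values in the one at [tau x], for [x] in [bdom tau]. *)
Definition covector_push (tau : biholo) (x : X) (a : ext R n) : ext R n :=
  ext_pull (map_jacobian (bihV tau) (tau x)) a.

Definition form_push (tau : biholo) (w : X -> ext R n) (y : X) : ext R n :=
  covector_push tau (bihV tau y) (w (bihV tau y)).

End Manifold.

Section Jets.
Variables (R : realType) (n : nat) (X : cmanifold R n).
Variables (m : nat) (p : 'I_m -> nat) (r : nat).
Local Notation C := (cplx R).

(* Holomorphic sections, on some neighbourhood of [x], of the direct sum of the
   bundles of [p i]-forms; the values far from [x] are irrelevant. *)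
Record local_section (x : X) := LocalSection {
  section_val :> 'I_m -> X -> ext R n;
  section_holo : forall i, holo_form_near (p i) (section_val i) x
}.

(* (i, K, al) indexes the derivative of multi-index al, with |al| <= r, of
   the coefficient of dz_K in the i-th component. *)
Definition jet_index :=
  {k : 'I_m * {set 'I_n} * {ffun 'I_n -> 'I_r.+1} |
    (#|k.1.2| == p k.1.1) && (\sum_j k.2 j <= r)%N}.

(* The fibre coordinates on the r-jet bundle induced by the chart [c]. *)
Definition jet_coord (c : chart R n X) (s : 'I_m -> X -> ext R n) (x : X) :
    'rV[C]_(#|{: jet_index}|) :=
  \row_k let: (i, K, al) := val (enum_val k : jet_index) in
    multi_partial (fun j => al j : nat) (fun z => form_expr c (s i) z K)
                  (cmap c x).

Definition same_jet (x : X) (s t : local_section x) : Prop :=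
  jet_coord (chart_at x) s x = jet_coord (chart_at x) t x.

(* The fibre at [x] of the r-jet bundle, as a set of equivalence classes. *)
Record jet (x : X) := Jet {
  jet_class : set (local_section x);
  jet_classP : exists s, jet_class = same_jet s
}.

Definition jet_of (x : X) (s : local_section x) : jet x :=
  @Jet x (same_jet s) (ex_intro _ s erefl).

(* In [nat_op_holo], the left-hand side is the fibre coordinate of the value of
   the operator, and [row_mx _ _] runs through the coordinates of the jets over
   the domain of [c]. In [nat_op_natural], [t] is any section with the same
   germ at [tau x] as the lift of [s], so that [jet_of t] is the lift of
   [jet_of s]. *)
Record natural_operator (q : nat) := NaturalOperator {
  nat_op :> forall x : X, jet x -> ext R n;
  nat_op_deg : forall x (j : jet x), ext_homog q (nat_op j);
  nat_op_holo : forall c, atlas c ->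
    exists2 G : 'rV[C]_(n + #|{: jet_index}|) -> ext R n,
      forall x a, cdom c x ->
        forall I : {set 'I_n}, holo_at (fun w => G w I) (row_mx (cmap c x) a)
    & forall x (s : local_section x), cdom c x ->
        covector_expr c x (nat_op (jet_of s)) =
        G (row_mx (cmap c x) (jet_coord c s x));
  nat_op_natural : forall (tau : biholo X) x, bdom tau x ->
    forall (s : local_section x) (t : local_section (tau x)),
      (forall i, \forall y \near tau x, t i y = form_push tau (s i) y) ->
      nat_op (jet_of t) = covector_push tau x (nat_op (jet_of s))
}.

End Jets.

Section AntiCommutative.
Variables (R : realType) (V : finType) (d : V -> nat).
Local Notation C := (cplx R).

Inductive ac_term :=
| ACvar of V
| ACconst of C
| ACadd of ac_term & ac_term
| ACmul of ac_term & ac_term.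

(* The least congruence containing the axioms of associative unital C-algebras
   and the relations of anti-commutativity. *)
Inductive ac_eq : ac_term -> ac_term -> Prop :=
| ac_refl t : ac_eq t t
| ac_sym s t : ac_eq s t -> ac_eq t s
| ac_trans s t u : ac_eq s t -> ac_eq t u -> ac_eq s u
| ac_congD s s' t t' :
    ac_eq s s' -> ac_eq t t' -> ac_eq (ACadd s t) (ACadd s' t')
| ac_congM s s' t t' :
    ac_eq s s' -> ac_eq t t' -> ac_eq (ACmul s t) (ACmul s' t')
| ac_addA s t u : ac_eq (ACadd s (ACadd t u)) (ACadd (ACadd s t) u)
| ac_addC s t : ac_eq (ACadd s t) (ACadd t s)
| ac_add0 t : ac_eq (ACadd (ACconst 0) t) t
| ac_mulA s t u : ac_eq (ACmul s (ACmul t u)) (ACmul (ACmul s t) u)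
| ac_mul1l t : ac_eq (ACmul (ACconst 1) t) t
| ac_mul1r t : ac_eq (ACmul t (ACconst 1)) t
| ac_mul0l t : ac_eq (ACmul (ACconst 0) t) (ACconst 0)
| ac_mulDl s t u :
    ac_eq (ACmul (ACadd s t) u) (ACadd (ACmul s u) (ACmul t u))
| ac_mulDr s t u :
    ac_eq (ACmul s (ACadd t u)) (ACadd (ACmul s t) (ACmul s u))
| ac_constD a b : ac_eq (ACadd (ACconst a) (ACconst b)) (ACconst (a + b))
| ac_constM a b : ac_eq (ACmul (ACconst a) (ACconst b)) (ACconst (a * b))
| ac_constC a t : ac_eq (ACmul (ACconst a) t) (ACmul t (ACconst a))
| ac_anti i j :
    ac_eq (ACmul (ACvar i) (ACvar j))
          (ACmul (ACconst ((-1) ^+ (d i * d j)))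
                 (ACmul (ACvar j) (ACvar i))).

(* The anti-commutative algebra on the variables [V] of degrees [d]: the terms
   modulo [ac_eq]. *)
Record ac_alg := ACAlg {
  ac_class : set ac_term;
  ac_classP : exists t, ac_class = ac_eq t
}.

Definition ac_of (t : ac_term) : ac_alg :=
  @ACAlg (ac_eq t) (ex_intro _ t erefl).

Definition ac_monomial (a : {ffun V -> nat}) : ac_term :=
  \big[ACmul/ACconst 1]_(i <- enum V) iter (a i) (ACmul (ACvar i)) (ACconst 1).

Definition ac_homog (q : nat) (A : ac_alg) : Prop :=
  exists l : seq (C * {ffun V -> nat}),
    all (fun ca : C * {ffun V -> nat} => \sum_i ca.2 i * d i == q)%N l /\
    A = ac_of (\big[ACadd/ACconst 0]_(ca <- l)
                 ACmul (ACconst ca.1) (ac_monomial ca.2)).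

Fixpoint ac_eval_term n (e : V -> ext R n) (t : ac_term) : ext R n :=
  match t with
  | ACvar i => e i
  | ACconst c => ext_scale c (ext_one R n)
  | ACadd s t => ac_eval_term e s + ac_eval_term e t
  | ACmul s t => ext_mul (ac_eval_term e s) (ac_eval_term e t)
  end.

(* When [e i] has degree [d i] for all i, the value does not depend on the
   chosen representative of [A]. *)
Definition ac_eval n (e : V -> ext R n) (A : ac_alg) : ext R n :=
  ac_eval_term e (projT1 (cid (ac_classP A))).

End AntiCommutative.

(* The variables u_i and v_i are the pairs [(i, 0)] and [(i, 1)]. *)
Definition uv_deg m (p : 'I_m -> nat) (k : 'I_m * 'I_2) : nat :=
  (p k.1 + k.2)%N.

Definition uv_value (R : realType) n (X : cmanifold R n) m
    (w : 'I_m -> X -> ext R n) (x : X) (k : 'I_m * 'I_2) : ext R n :=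
  if k.2 == ord0 then w k.1 x else form_deriv (w k.1) x.

(* Main.v *)
(* Maps that are affine in charts suffice. They relate any two points, so the
   operator amounts to a function [jet_op] of the Taylor coefficients
   a_(i, K, alpha) of the forms which is covariant under diagonal and
   permutation matrices. Covariance under homotheties makes its power series a
   polynomial; covariance under diagonal matrices leaves, in the coefficient of
   dz_I, only the square-free monomials whose factors have multisets of indices
   K + alpha that partition I. Exchanging two indices of the same alpha changes
   the sign of the form but not the monomial, so that |alpha| <= 1 for each
   factor; and since permutations act transitively on the monomials whose
   factors have given types (i, |alpha|), the contribution of a monomial is a
   constant depending only on these types, times the exterior product of the
   dz_alpha /\ dz_K. The sum of the a_(i, K, alpha) dz_alpha /\ dz_K is omega_i
   when restricted to |alpha| = 0 and d omega_i when restricted to |alpha| = 1.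
   For uniqueness, a monomial is detected on forms that are sums of exterior
   products of disjoint sets of coordinates. *)
Require Import Defs.
From HB Require Import structures.
From mathcomp Require Import all_boot all_order all_algebra.
From mathcomp Require Import all_classical all_reals all_analysis.
From mathcomp Require Import fingroup perm zify ring.

Set Implicit Arguments.
Unset Strict Implicit.
Unset Printing Implicit Defensive.
Import Order.TTheory GRing.Theory Num.Theory.
Import numFieldNormedType.Exports.
Local Open Scope ring_scope.

(* Otherwise unification unfolds [cplx R] to [R[i]], where canonical
   structures are found along other paths. *)
Local Opaque cplx.

(** * The exterior algebra *)

(** The series converges only near the zero jet, so homogeneity under homotheties is used twice: to
    truncate the series there, then to carry the resulting polynomial identity to all jets. Both
    uses require every jet coefficient to have positive weight, which is where [p_gt0] enters. The
    coordinates of the base point are variables of the same series and are kept at zero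
    displacement. A monomial is a set of jet indices, whereas an exterior product has ordered
    factors. The expansion therefore runs over words of length l, divided by l!, and the sum over
    all words of given types factors into a product of one form per letter. For r = 0 no jet
    coefficient has type v_i, so words containing v_i are left out of the polynomial: there v_i
    would take the value d omega_i, which the 0-jet does not determine. Uniqueness goes through
    1-jets whatever r is: at one point the values of omega_i and d omega_i are independent and
    arbitrary in their degrees, and q <= n leaves room for the q coordinates that detect a
    monomial. *)

Lemma prod_mem_eq0 (A : pzSemiRingType) (I : eqType) (s : seq I) (F : I -> A) i :
  i \in s -> F i = 0 -> \prod_(j <- s) F j = 0.
Proof.
move=> + Fi; elim: s => // j s IHs; rewrite inE big_cons => /orP[/eqP <-|/IHs ->].
  by rewrite Fi mul0r.
exact: mulr0.
Qed.

Section ShuffleSign.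
Variables (R : realType) (n : nat).
Implicit Types I J K : {set 'I_n}.

Lemma shuffle_signE I J : shuffle_sign R I J =
  (-1) ^+ (\sum_(i in I) \sum_(j in J) (j < i)%N)%N.
Proof.
rewrite /shuffle_sign; congr (_ ^+ _).
rewrite pair_big_dep /= -sum1dep_card big_mkcond [RHS]big_mkcond /=.
apply: eq_bigr => -[i j] _ /=.
by case: (i \in I); case: (j \in J); case: (j < i)%N.
Qed.

Lemma shuffle_signUl I J K : [disjoint I & J] ->
  shuffle_sign R (I :|: J)%SET K = shuffle_sign R I K * shuffle_sign R J K.
Proof.
move=> dIJ; rewrite !shuffle_signE -exprD.
suff -> : (\sum_(i in I :|: J) \sum_(j in K) (j < i) =
  \sum_(i in I) \sum_(j in K) (j < i) + \sum_(i in J) \sum_(j in K) (j < i))%N by [].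
by rewrite -bigU //=; apply: eq_bigl => i; rewrite !inE.
Qed.

Lemma shuffle_signUr I J K : [disjoint J & K] ->
  shuffle_sign R I (J :|: K)%SET = shuffle_sign R I J * shuffle_sign R I K.
Proof.
move=> dJK; rewrite !shuffle_signE -exprD -big_split /=.
suff -> : (\sum_(i in I) \sum_(j in J :|: K) (j < i) =
  \sum_(i in I) (\sum_(j in J) (j < i) + \sum_(j in K) (j < i)))%N by [].
by apply: eq_bigr => i _; rewrite -bigU //=; apply: eq_bigl => j; rewrite !inE.
Qed.

(** For disjoint sets every pair in [I] times [J] is an inversion in exactly one of the two orders,
    so the two inversion counts add up to #|I| * #|J|. *)
Lemma shuffle_signC I J : [disjoint I & J] ->
  shuffle_sign R J I = (-1) ^+ (#|I| * #|J|) * shuffle_sign R I J.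
Proof.
move=> dIJ; rewrite !shuffle_signE.
have -> : (#|I| * #|J| = \sum_(i in I) \sum_(j in J) (j < i) +
                        \sum_(j in J) \sum_(i in I) (i < j))%N.
  rewrite [X in _ = (_ + X)%N]exchange_big -big_split /= -sum_nat_const.
  apply: eq_bigr => i iI; rewrite -big_split /= -sum1_card.
  apply: eq_bigr => j jJ; case: ltngtP => // /val_inj ij.
  by have := disjointFr dIJ iI; rewrite -ij jJ.
by rewrite exprD mulrAC -expr2 sqrr_sign mul1r.
Qed.

Lemma shuffle_sign0l J : shuffle_sign R finset.set0 J = 1.
Proof. by rewrite shuffle_signE big_set0. Qed.

Lemma shuffle_sign0r I : shuffle_sign R I finset.set0 = 1.
Proof. by rewrite shuffle_signE big1 // => i _; rewrite big_set0. Qed.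

End ShuffleSign.

(* A copy of [ext], on which canonical inference finds no pointwise product. *)
Definition extalg (R : realType) (n : nat) : Type := ext R n.

Section ExteriorRing.
Variables (R : realType) (n : nat).
Local Notation C := (cplx R).
Implicit Types I J K : {set 'I_n}.

HB.instance Definition _ := GRing.Zmodule.copy (extalg R n) (ext R n).

Implicit Types a b c : extalg R n.

Lemma ext_addE a b I : (a + b) I = a I + b I.
Proof. exact: ffunE. Qed.

Lemma ext_oppE a I : (- a) I = - a I.
Proof. exact: ffunE. Qed.

Lemma ext_sumE (T : Type) (r : seq T) (Q : pred T) (F : T -> extalg R n) I :
  (\sum_(i <- r | Q i) F i) I = \sum_(i <- r | Q i) F i I.
Proof. exact: sum_ffunE. Qed.

Fact ext_mulA : associative (@ext_mul R n).
Proof.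
move=> a b c; apply/ffunP => K; rewrite !ffunE.
under eq_bigr do rewrite ffunE mulr_sumr.
under [RHS]eq_bigr do rewrite ffunE mulr_sumr mulr_suml.
rewrite pair_big_dep [RHS]pair_big_dep /=.
(* Both sides are sums over ordered partitions of [K] into three blocks: disjoint I and J on the
   left correspond to I inside L = I :|: J on the right. *)
pose h (x : {set 'I_n} * {set 'I_n}) := (x.2, x.1 :\: x.2)%SET.
pose h' (x : {set 'I_n} * {set 'I_n}) := (x.1 :|: x.2, x.1)%SET.
rewrite (reindex_onto h h') /=; last first.
  move=> [I J] /= /andP[sIK]; rewrite subsetD => /andP[_ dJI].
  by congr pair; apply/setP => i; rewrite !inE; case: (boolP (i \in I)) => //=;
    move=> iI; apply/esym/negbTE; rewrite disjoint_sym in dJI;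
    rewrite (disjointFr dJI).
apply: eq_big => [[L I]|[L I]] /=.
  apply/idP/idP => [/andP[/andP[sIK]]|/andP[sLK sIL]].
    rewrite subsetD => /andP[sLK _] /eqP[<-].
    rewrite finset.subsetUl andbT; apply/fintype.subsetP => i; rewrite !inE.
    by case/orP => [/(fintype.subsetP sIK)//|iLI]; apply: (fintype.subsetP sLK); rewrite !inE.
  rewrite (fintype.subset_trans sIL sLK) /=; apply/andP; split.
    exact: finset.setSD.
  apply/eqP; congr pair; apply/setP => i; rewrite !inE.
  by case: (boolP (i \in I)) => // /(fintype.subsetP sIL) ->.
move=> /andP[/andP[sIK sLK']].
have {sLK'} sLIK : (L :\: I \subset K)%SET by move: sLK'; rewrite subsetD => /andP[].
move=> /eqP[eL].
have sIL : I \subset L by rewrite -eL finset.subsetUl.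
have sLK : L \subset K by rewrite -eL finset.subUset sIK.
have -> : (K :\: I = (L :\: I) :|: (K :\: L))%SET.
  apply/setP => i; rewrite !inE.
  case: (boolP (i \in L)) => iL; case: (boolP (i \in I)) => iI //=.
    by rewrite (fintype.subsetP sLK _ iL).
  by rewrite (fintype.subsetP sIL _ iI) in iL.
have d1 : [disjoint L :\: I & K :\: L].
  rewrite disjoint_subset; apply/fintype.subsetP => i; rewrite !inE.
  by case/andP => _ ->.
have -> : (((L :\: I) :|: (K :\: L)) :\: (L :\: I) = K :\: L)%SET.
  apply/setP => i; rewrite !inE.
  case: (boolP (i \in L)) => iL; case: (boolP (i \in I)) => iI //=.
rewrite shuffle_signUr //.
have e : shuffle_sign R L (K :\: L)%SET =
    shuffle_sign R I (K :\: L)%SET * shuffle_sign R (L :\: I)%SET (K :\: L)%SET.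
  rewrite -shuffle_signUl; last first.
    rewrite disjoint_subset; apply/fintype.subsetP => i; rewrite !inE => ->.
    by [].
  congr shuffle_sign; apply/setP => i; rewrite !inE.
  by case: (boolP (i \in I)) => // /(fintype.subsetP sIL) ->.
rewrite e; ring.
Qed.

Fact ext_mul1l : left_id (@ext_one R n) (@ext_mul R n).
Proof.
move=> a; apply/ffunP => K; rewrite ffunE (bigD1 finset.set0) ?finset.sub0set //=.
rewrite shuffle_sign0l finset.setD0 ffunE eqxx !mul1r big1 ?addr0 // => I /andP[_ /negbTE I0].
by rewrite ffunE I0 mulr0 mul0r.
Qed.

Fact ext_mul1r : right_id (@ext_one R n) (@ext_mul R n).
Proof.
move=> a; apply/ffunP => K; rewrite ffunE (bigD1 K) //=.
rewrite finset.setDv shuffle_sign0r ffunE eqxx !mulr1 mul1r big1 ?addr0 // => I.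
case/andP => sIK nIK; rewrite ffunE finset.setD_eq0.
case: (boolP (K \subset I)) => [sKI|]; last by rewrite mulr0.
by rewrite finset.eqEsubset sIK sKI in nIK.
Qed.

Fact ext_mulDl : left_distributive (@ext_mul R n) +%R.
Proof.
move=> a b c; apply/ffunP => K; rewrite !ffunE -big_split /=.
by apply: eq_bigr => I _; rewrite !ffunE mulrDr mulrDl.
Qed.

Fact ext_mulDr : right_distributive (@ext_mul R n) +%R.
Proof.
move=> a b c; apply/ffunP => K; rewrite !ffunE -big_split /=.
by apply: eq_bigr => I _; rewrite !ffunE mulrDr.
Qed.

Fact ext_one_neq0 : ext_one R n != 0.
Proof.
by apply/eqP => /ffunP/(_ finset.set0)/eqP; rewrite !ffunE eqxx oner_eq0.
Qed.

HB.instance Definition _ := GRing.Zmodule_isNzRing.Build (extalg R n)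
  ext_mulA ext_mul1l ext_mul1r ext_mulDl ext_mulDr ext_one_neq0.

Fact ext_scaleA (x y : C) (a : extalg R n) :
  ext_scale x (ext_scale y a) = ext_scale (x * y) a.
Proof. by apply/ffunP => I; rewrite !ffunE mulrA. Qed.

Fact ext_scale1 : left_id 1 (@ext_scale R n).
Proof. by move=> a; apply/ffunP => I; rewrite !ffunE mul1r. Qed.

Fact ext_scaleDr : right_distributive (@ext_scale R n) +%R.
Proof. by move=> x a b; apply/ffunP => I; rewrite !ffunE mulrDr. Qed.

Fact ext_scaleDl (a : extalg R n) : {morph (@ext_scale R n)^~ a : x y / x + y}.
Proof. by move=> x y; apply/ffunP => I; rewrite !ffunE mulrDl. Qed.

HB.instance Definition _ := GRing.Zmodule_isLmodule.Build C (extalg R n)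
  ext_scaleA ext_scale1 ext_scaleDr ext_scaleDl.

Lemma ext_scaleE (x : C) a I : (x *: a) I = x * a I.
Proof. exact: ffunE. Qed.

Lemma ext_mulE a b K : (a * b) K =
  \sum_(I : {set 'I_n} | I \subset K)
     shuffle_sign R I (K :\: I)%SET * a I * b (K :\: I)%SET.
Proof. exact: ffunE. Qed.

Fact ext_scaleAl (x : C) a b : x *: (a * b) = (x *: a) * b.
Proof.
apply/ffunP => K; rewrite ext_scaleE !ext_mulE mulr_sumr.
by apply: eq_bigr => I _; rewrite ext_scaleE !mulrA [x * _]mulrC.
Qed.

HB.instance Definition _ := GRing.Lmodule_isLalgebra.Build C (extalg R n)
  ext_scaleAl.

Fact ext_scaleAr (x : C) a b : x *: (a * b) = a * (x *: b).
Proof.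
apply/ffunP => K; rewrite ext_scaleE !ext_mulE mulr_sumr.
by apply: eq_bigr => I _; rewrite ext_scaleE mulrCA.
Qed.

HB.instance Definition _ := GRing.Lalgebra_isAlgebra.Build C (extalg R n)
  ext_scaleAr.

End ExteriorRing.

Section Homogeneous.
Variables (R : realType) (n : nat).
Local Notation C := (cplx R).
Local Notation A := (extalg R n).
Implicit Types (I J K : {set 'I_n}) (a b : A).

Lemma ext_homogD p a b : ext_homog p a -> ext_homog p b -> ext_homog p (a + b).
Proof. by move=> ha hb I pI; rewrite ext_addE ha ?hb ?addr0. Qed.

Lemma ext_homogZ p (x : C) a : ext_homog p a -> ext_homog p (x *: a).
Proof. by move=> ha I pI; rewrite ext_scaleE ha ?mulr0. Qed.

Lemma ext_homog0 p : ext_homog p (0 : A).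
Proof. by move=> I _; rewrite ffunE. Qed.

Lemma ext_homog_sum p (T : Type) (r : seq T) (Q : pred T) (F : T -> A) :
  (forall i, Q i -> ext_homog p (F i)) -> ext_homog p (\sum_(i <- r | Q i) F i).
Proof.
move=> hF; apply: big_ind; [exact: ext_homog0|move=> a b; exact: ext_homogD|exact: hF].
Qed.

Lemma ext_homog1 : ext_homog 0 (1 : A).
Proof. by move=> I; rewrite cards_eq0 ffunE => /negbTE ->. Qed.

Lemma ext_homogM p q a b :
  ext_homog p a -> ext_homog q b -> ext_homog (p + q) (a * b).
Proof.
move=> ha hb K pqK; rewrite ext_mulE big1 // => I sIK.
have [Ip|Ip] := eqVneq #|I| p; last by rewrite ha // mulr0 mul0r.
rewrite hb ?mulr0 //; apply: contraNneq pqK => <-.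
by rewrite -Ip cardsDS // subnKC // subset_leq_card.
Qed.

Lemma ext_mulC p q a b : ext_homog p a -> ext_homog q b ->
  a * b = (-1) ^+ (p * q) *: (b * a).
Proof.
move=> ha hb; apply/ffunP => K; rewrite ext_scaleE !ext_mulE mulr_sumr.
pose h (I : {set 'I_n}) := (K :\: I)%SET.
have hK I : I \subset K -> h (h I) = I.
  move=> sIK; apply/setP => i; rewrite !inE.
  by case: (boolP (i \in I)) => [/(fintype.subsetP sIK) ->|]//=; case: (i \in K).
rewrite (reindex_onto h h) => [|I sIK]; last exact: hK.
have e I : (h I \subset K) && (h (h I) == I) = (I \subset K).
  apply/andP/idP => [[_ /eqP <-]|sIK]; rewrite ?finset.subsetDl //.
  by rewrite hK.
rewrite (eq_bigl _ _ e); apply: eq_bigr => I sIK; rewrite -/(h (h I)) -/(h I) hK //.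
have [Iq|Iq] := eqVneq #|I| q; last by rewrite (hb I) // !(mulr0, mul0r).
have [Jp|Jp] := eqVneq #|h I| p; last by rewrite (ha (h I)) // !(mulr0, mul0r).
rewrite shuffle_signC; last by rewrite disjoint_subset; apply/fintype.subsetP => i iI; rewrite !inE iI.
by rewrite Iq Jp (mulnC q); ring.
Qed.

Lemma ext_self_opp_eq0 a : a = - a -> a = 0.
Proof.
move=> e; apply/ffunP => I; rewrite ffunE.
have /eqP := congr1 (fun b : A => b I) e; rewrite ext_oppE -addr_eq0 -mulr2n.
by rewrite mulrn_eq0 => /eqP.
Qed.

Lemma ext_sqr_odd p a : odd p -> ext_homog p a -> a * a = 0.
Proof.
move=> op ha; apply: ext_self_opp_eq0.
by rewrite [LHS](ext_mulC ha ha) -signr_odd oddM op expr1 scaleN1r.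
Qed.

Lemma dz_homog (j : 'I_n) : ext_homog 1 (dz R j).
Proof. by move=> I; rewrite ffunE; case: (I =P [set j]%SET) => [->|//]; rewrite cards1. Qed.

End Homogeneous.

Section LinearProducts.
Variables (R : realType) (n : nat).
Local Notation C := (cplx R).
Local Notation A := (extalg R n).
Variables (l : 'I_n -> A) (hl : forall j, ext_homog 1 (l j)).

Lemma lprod_homog s : ext_homog (size s) (\prod_(j <- s) l j).
Proof.
elim: s => [|j s IHs]; first by rewrite big_nil; exact: ext_homog1.
by rewrite big_cons; exact: (ext_homogM (hl j) IHs).
Qed.

(** Stated for any family of degree one, because [pull_dzM] needs the same sign for the [dz] and for
    their pull-backs. *)
Lemma lprod_insert s1 s2 j :
  l j * \prod_(i <- s1 ++ s2) l i =
  (-1) ^+ size s1 *: \prod_(i <- s1 ++ j :: s2) l i.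
Proof.
rewrite !big_cat big_cons /= !mulrA (ext_mulC (hl j) (@lprod_homog s1)) mul1n.
by rewrite -!scalerAl.
Qed.

Lemma lprod_mem s j : j \in s -> l j * \prod_(i <- s) l i = 0.
Proof.
case/splitPr => s1 s2; rewrite big_cat big_cons /= !mulrA.
rewrite (ext_mulC (hl j) (@lprod_homog s1)) -!scalerAl -(mulrA _ (l j) (l j)).
by rewrite (ext_sqr_odd _ (hl j)) // mulr0 mul0r scaler0.
Qed.

Lemma lprod_notuniq s : ~~ uniq s -> \prod_(i <- s) l i = 0.
Proof.
elim: s => //= j s IHs; rewrite negb_and negbK big_cons => /orP[|/IHs ->].
  exact: lprod_mem.
by rewrite mulr0.
Qed.

End LinearProducts.

Section Basis.
Variables (R : realType) (n : nat).
Local Notation C := (cplx R).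
Local Notation A := (extalg R n).
Implicit Types (I J K : {set 'I_n}) (a b : A) (s : seq 'I_n).

Definition dzs s : A := \prod_(j <- s) (dz R j : A).

Lemma dzs_cons j s : dzs (j :: s) = (dz R j : A) * dzs s.
Proof. exact: big_cons. Qed.

Lemma dzs_cat s1 s2 : dzs (s1 ++ s2) = dzs s1 * dzs s2.
Proof. exact: big_cat. Qed.

Lemma dzs_homog s : ext_homog (size s) (dzs s).
Proof. by apply: lprod_homog; exact: dz_homog. Qed.

Lemma dzs_notuniq s : ~~ uniq s -> dzs s = 0.
Proof. by apply: lprod_notuniq; exact: dz_homog. Qed.

Lemma dz_mul_lt (j : 'I_n) K (a : A) : a = [ffun I => (I == K)%:R] ->
  (forall k, k \in K -> (j < k)%N) ->
  (dz R j : A) * a = [ffun I => (I == (j |: K)%SET)%:R].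
Proof.
move=> -> jK; apply/ffunP => L; rewrite ext_mulE ffunE.
have jNK : j \notin K by apply/negP => /jK; rewrite ltnn.
transitivity (\sum_(I : {set 'I_n} | (I \subset L) && (I == [set j]%SET))
    (((L :\: I)%SET == K)%:R : C)).
  rewrite big_mkcondr; apply: eq_bigr => I _; rewrite !ffunE.
  case: eqVneq => [->|_]; last by rewrite mulr0 mul0r.
  case: eqVneq => [->|_]; last by rewrite mulr0.
  rewrite !mulr1 shuffle_signE big_set1 big1 // => k /jK.
  by rewrite ltnNge => /negbTE; rewrite leq_eqVlt orbC; case: (k < j)%N.
case: (boolP (j \in L)) => jL; last first.
  rewrite big_pred0 => [|I]; last first.
    by case: (I =P [set j]%SET) => [->|]; rewrite ?andbF ?andbT // finset.sub1set (negbTE jL).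
  by case: eqVneq => // eL; rewrite eL setU11 in jL.
rewrite (big_pred1 [set j]%SET) => [|I]; last first.
  by rewrite inE /=; case: (I =P [set j]%SET) => [->|]; rewrite ?andbF ?andbT // finset.sub1set jL.
congr (nat_of_bool _)%:R; apply/eqP/eqP => [<-|->].
  by rewrite finset.setD1K.
by rewrite setU1K.
Qed.

(** The enumeration of a set of ordinals is increasing, so each factor is put in front of larger
    ones only and no sign appears. *)
Lemma dzs_enum I : dzs (enum I) = [ffun K : {set 'I_n} => (K == I)%:R].
Proof.
have : sorted (fun i j : 'I_n => i < j)%N (enum I).
  rewrite {1}/enum_mem; apply: sorted_filter; first by move=> i j k; apply: ltn_trans.
  have : sorted (relpre val ltn) (Finite.enum 'I_n).
    by rewrite -sorted_map -enumT val_enum_ord iota_ltn_sorted.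
  by [].
suff H s : sorted (fun i j : 'I_n => i < j)%N s ->
    dzs s = [ffun K : {set 'I_n} => (K == [set i in s]%SET)%:R].
  by move/H ->; congr finfun; apply/funext => K; rewrite set_enum.
elim: s => [_|j s IHs /= pjs].
  apply/ffunP => K; rewrite /dzs big_nil !ffunE; congr (nat_of_bool (_ == _))%:R.
rewrite dzs_cons (@dz_mul_lt _ [set i in s]%SET) ?IHs //.
- by rewrite set_cons.
- exact: path_sorted pjs.
- move=> k; rewrite inE => ks; move: pjs; rewrite path_sortedE; last first.
    by move=> x y z; apply: ltn_trans.
  by case/andP => /allP/(_ _ ks).
Qed.

Lemma ext_expand a : a = \sum_(I : {set 'I_n}) a I *: dzs (enum I).
Proof.
apply/ffunP => K; rewrite ext_sumE (bigD1 K) //= ext_scaleE dzs_enum ffunE eqxx.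
rewrite mulr1 big1 ?addr0 // => I IK.
by rewrite ext_scaleE dzs_enum ffunE eq_sym (negbTE IK) mulr0.
Qed.

Lemma enum_setU1 (j : 'I_n) K : j \notin K -> exists s1 s2,
  enum (j |: K)%SET = s1 ++ j :: s2 /\ enum K = s1 ++ s2.
Proof.
move=> jK; have : j \in enum (j |: K)%SET by rewrite mem_enum setU11.
have u : uniq (enum (j |: K)%SET) by exact: enum_uniq.
have -> : enum K = [seq i <- enum (j |: K)%SET | i != j].
  rewrite /enum_mem -filter_predI; apply: eq_filter => i /=; rewrite !inE.
  by case: eqVneq => [->|//]; rewrite (negbTE jK).
move=> jI; case/splitPr: jI u => s1 s2; rewrite cat_uniq /= => /and3P[_].
rewrite negb_or => /andP[js1 _] /andP[js2 _]; exists s1, s2; split=> //.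
rewrite filter_cat /= eqxx /=.
congr (_ ++ _); apply/all_filterP/allP => i ii /=.
  by apply: contraNneq js1 => <-.
by apply: contraNneq js2 => <-.
Qed.

Section Pullback.
Variables J : 'M[C]_n.

Definition pull1 (i : 'I_n) : A := \sum_(j < n) J j i *: (dz R j : A).

Lemma pull1_homog i : ext_homog 1 (pull1 i).
Proof. by apply: ext_homog_sum => j _; apply: ext_homogZ; apply: dz_homog. Qed.

Definition pull (a : A) : A := ext_pull J a.

Lemma pullE a : pull a = \sum_(I : {set 'I_n}) a I *: \prod_(i <- enum I) pull1 i.
Proof. by []. Qed.

Fact pull_is_linear : linear pull.
Proof.
move=> x a b; rewrite !pullE scaler_sumr -big_split /=.
by apply: eq_bigr => I _; rewrite ext_addE ext_scaleE scalerDl scalerA.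
Qed.
HB.instance Definition _ := GRing.isLinear.Build C A A *:%R pull pull_is_linear.

Lemma pull_enum (I : {set 'I_n}) : pull (dzs (enum I)) = \prod_(i <- enum I) pull1 i.
Proof.
rewrite pullE (bigD1 I) //= dzs_enum ffunE eqxx scale1r [X in _ + X]big1 ?addr0 // => K KI.
by rewrite ffunE (negbTE KI) scale0r.
Qed.

(** [ext_pull] is defined on increasing products only. Inserting [j] at its place costs the same
    sign before and after pulling back, since the [pull1 i] also have degree one. Multiplicativity
    of [pull] follows by induction on products. *)
Lemma pull_dzM j a : pull ((dz R j : A) * a) = pull1 j * pull a.
Proof.
rewrite [a]ext_expand mulr_sumr !linear_sum mulr_sumr; apply: eq_bigr => K _.
rewrite -scalerAr !linearZ /= -scalerAr; congr (_ *: _).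
rewrite pull_enum; case: (boolP (j \in K)) => jK.
  rewrite (lprod_mem pull1_homog) ?mem_enum // -dzs_cons dzs_notuniq ?linear0 //.
  by rewrite /= mem_enum jK.
have [s1 [s2 [e1 e2]]] := enum_setU1 jK.
rewrite e2 (lprod_insert pull1_homog) -e1 -pull_enum -linearZ /= e1; congr pull.
exact: (lprod_insert (@dz_homog R n)).
Qed.

Lemma pull1r : pull 1 = 1.
Proof.
have -> : (1 : A) = dzs (enum (finset.set0 : {set 'I_n})) by rewrite enum_set0 /dzs big_nil.
by rewrite pull_enum enum_set0 /dzs !big_nil.
Qed.

Lemma pull_dz j : pull (dz R j) = pull1 j.
Proof. by rewrite -[X in pull X](mulr1 (dz R j : A)) pull_dzM pull1r mulr1. Qed.

Lemma pull_dzs s : pull (dzs s) = \prod_(i <- s) pull1 i.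
Proof.
elim: s => [|j s IHs]; first by rewrite /dzs !big_nil pull1r.
by rewrite dzs_cons pull_dzM IHs big_cons.
Qed.

Lemma pullM a b : pull (a * b) = pull a * pull b.
Proof.
rewrite [a]ext_expand mulr_suml !linear_sum mulr_suml; apply: eq_bigr => I _.
rewrite -scalerAl !linearZ /= -scalerAl; congr (_ *: _).
elim: (enum I) => [|j s IHs]; first by rewrite /dzs big_nil pull1r !mul1r.
by rewrite dzs_cons -mulrA !pull_dzM IHs mulrA.
Qed.

Lemma pull_homog p a : ext_homog p a -> ext_homog p (pull a).
Proof.
move=> ha; rewrite pullE; apply: ext_homog_sum => I _.
have [Ip|Ip] := eqVneq #|I| p; last by rewrite ha // scale0r; apply: ext_homog0.
by apply: ext_homogZ; rewrite -Ip cardE; apply: lprod_homog; apply: pull1_homog.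
Qed.

End Pullback.

Lemma ext_pullE (J : 'M[C]_n) (a : ext R n) : ext_pull J a = pull J a.
Proof. by []. Qed.

Local Opaque pull.

Lemma pull_comp (J1 J2 : 'M[C]_n) a : pull J1 (pull J2 a) = pull (J1 *m J2) a.
Proof.
rewrite [a]ext_expand (linear_sum (pull J2)) (linear_sum (pull J1)).
rewrite (linear_sum (pull (J1 *m J2))); apply: eq_bigr => I _.
rewrite !linearZ /=.
congr (_ *: _); elim: (enum I) => [|i s IHs]; first by rewrite /dzs big_nil !pull1r.
rewrite dzs_cons !pull_dzM pullM IHs; congr (_ * _).
rewrite /pull1 linear_sum /=.
under eq_bigr do rewrite linearZ /= pull_dz /pull1 scaler_sumr.
rewrite exchange_big /=; apply: eq_bigr => j _.
rewrite mxE scaler_suml; apply: eq_bigr => k _.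
by rewrite scalerA mulrC.
Qed.

Lemma pull_id a : pull 1%:M a = a.
Proof.
rewrite [a]ext_expand linear_sum; apply: eq_bigr => I _; rewrite linearZ /=.
congr (_ *: _); rewrite pull_dzs; apply: eq_bigr => i _.
rewrite /pull1 (bigD1 i) //= mxE eqxx scale1r big1 ?addr0 // => j /negbTE ji.
by rewrite mxE ji scale0r.
Qed.

End Basis.

Local Opaque pull.

(** * Power series and holomorphic functions *)

Section PowerSeries.
Variables (R : realType) (k : nat).
Local Notation C := (cplx R).
Implicit Types (W : 'I_k -> nat) (c : {ffun 'I_k -> nat} -> C) (u : 'I_k -> C).

Definition weight W (al : 'I_k -> nat) : nat := (\sum_i W i * al i)%N.

Definition psum c N u : C := \sum_(al : {ffun 'I_k -> 'I_N})
  c [ffun i => al i : nat] * \prod_i u i ^+ al i.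

Definition weight_part c W D u : C :=
  \sum_(al : {ffun 'I_k -> 'I_D} | (weight W (fun i => al i) < D)%N)
  c [ffun i => al i : nat] * \prod_i u i ^+ al i.

Lemma weight_ge W (al : 'I_k -> nat) i : (0 < W i)%N -> (al i <= weight W al)%N.
Proof.
by move=> Wi; rewrite /weight (bigD1 i) //= (leq_trans (leq_pmull _ Wi)) ?leq_addr.
Qed.

(** With positive weights, weight less than [D] forces every exponent below [D], so raising the
    cut-off from [D] to [N] adds no term. *)
Lemma sum_trunc (F : {ffun 'I_k -> nat} -> C) W D N : (forall i, 0 < W i)%N -> (D <= N)%N ->
  \sum_(al : {ffun 'I_k -> 'I_N} | (weight W (fun i => al i) < D)%N) F [ffun i => al i : nat] =
  \sum_(al : {ffun 'I_k -> 'I_D} | (weight W (fun i => al i) < D)%N) F [ffun i => al i : nat].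
Proof.
move=> W0; case: D => [|D] DN; first by rewrite !big_pred0.
case: N DN => // N DN.
pose h (al : {ffun 'I_k -> 'I_D.+1}) : {ffun 'I_k -> 'I_N.+1} :=
  [ffun i => inord (al i)].
pose h' (al : {ffun 'I_k -> 'I_N.+1}) : {ffun 'I_k -> 'I_D.+1} :=
  [ffun i => inord (al i)].
have hE al i : h al i = al i :> nat.
  by rewrite ffunE inordK // (leq_trans (ltn_ord _)).
rewrite (reindex_onto h h') /=; last first.
  move=> al ltD; apply/ffunP => i; apply/val_inj; rewrite /= hE ffunE inordK //.
  by rewrite (leq_ltn_trans (weight_ge (fun i => al i : nat) (W0 i))).
apply: eq_big => [al|al _].
  have -> : h' (h al) = al by apply/ffunP => i; apply/val_inj; rewrite ffunE hE inord_val.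
  by rewrite eqxx andbT; congr (_ < _)%N; apply: eq_bigr => i _; rewrite hE.
by apply: congr1; apply/ffunP => i; rewrite ffunE [RHS]ffunE hE.
Qed.

(** A term of weight at least [D] carries a factor bounded by [|s| ^+ D]; what remains is dominated
    by the absolutely convergent series at radius [rho]. *)
Lemma psum_tail c (rho M : C) W D N u (s : C) :
  (forall i, 0 < W i)%N -> (D <= N)%N ->
  \sum_(al : {ffun 'I_k -> 'I_N})
            `|c [ffun i => al i : nat]| * rho ^+ (\sum_i al i)%N <= M ->
  (forall i, `|u i| <= rho) -> `|s| <= 1 -> 0 <= rho ->
  `|psum c N (fun i => s ^+ W i * u i) - weight_part c W D (fun i => s ^+ W i * u i)|
   <= `|s| ^+ D * M.
Proof.
move=> W0 DN hM hu s1 rho0.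
pose F (al : {ffun 'I_k -> nat}) := c al * \prod_i (s ^+ W i * u i) ^+ al i.
have -> : weight_part c W D (fun i => s ^+ W i * u i) =
    \sum_(al : {ffun 'I_k -> 'I_N} | (weight W (fun i => al i) < D)%N) F [ffun i => al i : nat].
  rewrite (sum_trunc F W0 DN); apply: eq_bigr => al _; rewrite /F.
  by congr (_ * _); apply: eq_bigr => i _; rewrite ffunE.
have -> : psum c N (fun i => s ^+ W i * u i) =
    \sum_(al : {ffun 'I_k -> 'I_N}) F [ffun i => al i : nat].
  apply: eq_bigr => al _; rewrite /F.
  by congr (_ * _); apply: eq_bigr => i _; rewrite ffunE.
rewrite (bigID (fun al : {ffun 'I_k -> 'I_N} => (weight W (fun i => al i) < D)%N)) /=.
rewrite addrAC subrr add0r (le_trans (ler_norm_sum _ _ _)) //.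
apply: (@le_trans _ _ (`|s| ^+ D * \sum_(al : {ffun 'I_k -> 'I_N} | ~~ (weight W (fun i => al i) < D)%N) (`|c [ffun i => al i : nat]| * rho ^+ (\sum_i al i)%N))); last first.
  apply: ler_wpM2l; first by rewrite exprn_ge0.
  apply: le_trans hM; rewrite [leRHS](bigID (fun al : {ffun 'I_k -> 'I_N} => (weight W (fun i => al i) < D)%N)) /=.
  by rewrite lerDr sumr_ge0 // => al _; rewrite mulr_ge0 // exprn_ge0.
rewrite mulr_sumr; apply: ler_sum => al; rewrite -leqNgt => leD.
rewrite /F normrM mulrCA; apply: ler_wpM2l => //.
rewrite normr_prod.
under eq_bigr do rewrite ffunE normrX normrM normrX exprMn -exprM.
rewrite big_split /= -expr_sum -/(weight W (fun i => al i)); apply: ler_pM.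
- exact: exprn_ge0.
- by apply: prodr_ge0 => i _; rewrite exprn_ge0.
- exact: ler_wiXn2l.
rewrite expr_sum; apply: ler_prod => i _.
by rewrite exprn_ge0 //= lerXn2r // nnegrE.
Qed.

End PowerSeries.

Section HoloApprox.
Variables (R : realType).
Local Notation C := (cplx R).
Local Open Scope classical_set_scope.

(** A weighted Taylor formula, the limit of [psum_tail]. Unit weights with [D = 2] give
    differentiability; the weights of jet coefficients give polynomiality of the operator. *)
Lemma holo_approx k (f : 'rV[C]_k -> C) a : holo_at f a ->
  exists c (rho M : C), [/\ 0 < rho, 0 <= M &
  forall W D (u : 'I_k -> C) s, (forall i, 0 < W i)%N -> (forall i, `|u i| < rho) ->
    `|s| <= 1 ->
    `|f (a + \row_i (s ^+ W i * u i)) - weight_part c W D (fun i => s ^+ W i * u i)|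
      <= `|s| ^+ D * M].
Proof.
move=> [c [rho [rho0 [M hM] hf]]]; exists c, rho, M; split=> //.
  apply: le_trans (hM 0%N); apply: sumr_ge0 => al _.
  by rewrite mulr_ge0 // exprn_ge0 // ltW.
move=> W D u s W0 hu s1.
set z := a + _; set v := fun i => _.
have /hf : forall i, `|z 0 i - a 0 i| < rho.
  move=> i; rewrite !mxE addrAC subrr add0r normrM.
  apply: le_lt_trans (hu i); rewrite -[leRHS]mul1r ler_wpM2r // normrX.
  by rewrite exprn_ile1.
move=> /cvgrPdist_lt cvgf; apply/ler_addgt0Pr => e e0.
have [N _ /(_ (N + D)%N (leq_addr _ _)) /= hN] := cvgf e e0.
have psumE : \sum_(al : {ffun 'I_k -> 'I_(N + D)})
    c [ffun i => al i : nat] * \prod_i (z 0 i - a 0 i) ^+ al i = psum c (N + D) v.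
  apply: eq_bigr => al _; congr (_ * _); apply: eq_bigr => i _.
  by rewrite !mxE addrAC subrr add0r.
rewrite psumE in hN.
have -> : f z - weight_part c W D v =
    (f z - psum c (N + D) v) + (psum c (N + D) v - weight_part c W D v).
  by rewrite addrA subrK.
rewrite [leRHS]addrC (le_trans (ler_normD _ _)) // lerD //; first exact: ltW.
by apply: (psum_tail W0 (leq_addl _ _) (hM _) _ s1 (ltW rho0)) => i; exact: ltW.
Qed.

(** A nonzero constant term contradicts the bound for small [s]; once it vanishes, one factor [s]
    can be divided out of both sides. *)
Lemma small_poly_eq0 (p : {poly C}) (M : C) q : (size p <= q)%N -> 0 <= M ->
  (forall s : C, 0 < s -> s <= 1 -> `|p.[s]| <= s ^+ q * M) -> p = 0.
Proof.
elim: q p => [|q IHq] p sp M0 hp; first by apply/eqP; rewrite -size_poly_leq0.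
set p' := drop_poly 1 p; pose B := \sum_(i < size p') `|p'`_i|.
have pE : p = (p`_0)%:P + p' * 'X.
  rewrite -{1}(poly_take_drop 1 p) expr1; congr (_ + _).
  by apply/polyP => -[|i]; rewrite coef_take_poly coefC.
have B0 : 0 <= B by apply: sumr_ge0.
have hB s : 0 < s -> s <= 1 -> `|p'.[s]| <= B.
  move=> s0 s1; rewrite horner_coef (le_trans (ler_norm_sum _ _ _)) //.
  apply: ler_sum => i _; rewrite normrM -[leRHS]mulr1 ler_wpM2l // normrX.
  by rewrite exprn_ile1 // gtr0_norm.
have hc s : 0 < s -> s <= 1 -> `|p`_0| <= s * (M + B).
  move=> s0 s1; have -> : p`_0 = p.[s] - p'.[s] * s by rewrite {2}pE !hornerE addrK.
  rewrite (le_trans (ler_normB _ _)) // mulrDr lerD //.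
    rewrite (le_trans (hp s s0 s1)) // ler_wpM2r // exprS -[leRHS]mulr1.
    by rewrite ler_wpM2l ?exprn_ile1 ?(ltW s0).
  by rewrite normrM mulrC (gtr0_norm s0) ler_wpM2l ?(ltW s0) // hB.
have p0 : p`_0 = 0.
  apply: contraTeq isT => p0; have n0 : 0 < `|p`_0| by rewrite normr_gt0.
  have d0 : 0 < `|p`_0| + (M + B) by rewrite ltr_wpDr // addr_ge0.
  (* This [s] is at most 1 and makes [s * (M + B)] strictly smaller than the constant term. *)
  have := hc (`|p`_0| / (`|p`_0| + (M + B))).
  rewrite divr_gt0 // ler_pdivrMr // mul1r lerDl addr_ge0 // => /(_ isT isT).
  rewrite -mulrA -{1}[`|p`_0|]mulr1 ler_pM2l // ler_pdivlMl // mulr1 gerDr.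
  by rewrite lt_geF.
suff p'0 : p' = 0 by rewrite pE p0 p'0 mul0r addr0.
apply: IHq => //; first by rewrite size_drop_poly leq_subLR add1n.
move=> s s0 s1; have := hp s s0 s1.
rewrite {1}pE p0 add0r hornerMX normrM (gtr0_norm s0) exprS mulrC -mulrA.
by rewrite ler_pM2l.
Qed.

(** The polynomial in [s] formed by [s ^+ q * f] minus the Taylor part of weight at most [q] is
    O(s^(q+1)), hence zero. Its coefficient of degree [q] is the claim. *)
Lemma holo_weighted_homog k (f : 'rV[C]_k -> C) a : holo_at f a ->
  exists c (rho : C), 0 < rho /\
  forall W q (u : 'I_k -> C), (forall i, 0 < W i)%N -> (forall i, `|u i| < rho) ->
   (forall s : C, 0 < s -> f (a + \row_i (s ^+ W i * u i)) = s ^+ q * f (a + \row_i u i)) ->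
   f (a + \row_i u i) =
     \sum_(al : {ffun 'I_k -> 'I_q.+1} | weight W (fun i => al i) == q)
       c [ffun i => al i : nat] * \prod_i u i ^+ al i.
Proof.
move=> /holo_approx [c [rho [M [rho0 M0 hf]]]]; exists c, rho; split=> //.
move=> W q u W0 hu hs; set fu := f (a + _) in hs *.
pose m (al : {ffun 'I_k -> 'I_q.+1}) := c [ffun i => al i : nat] * \prod_i u i ^+ al i.
pose p : {poly C} := fu *: 'X^q -
  \sum_(al : {ffun 'I_k -> 'I_q.+1} | (weight W (fun i => al i) < q.+1)%N)
    m al *: 'X^(weight W (fun i => al i)).
have sp : (size p <= q.+1)%N.
  rewrite (leq_trans (size_polyD _ _)) // geq_max size_polyN.
  rewrite (leq_trans (size_scale_leq _ _)) ?size_polyXn //=.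
  apply: (leq_trans (size_sum _ _ _)); apply/bigmax_leqP => al lq.
  by rewrite (leq_trans (size_scale_leq _ _)) ?size_polyXn.
have p0 : p = 0.
  apply: (small_poly_eq0 sp M0) => s s0 s1.
  have -> : p.[s] = s ^+ q * fu - weight_part c W q.+1 (fun i => s ^+ W i * u i).
    rewrite hornerD hornerN hornerZ hornerXn [fu * _]mulrC; congr (_ - _).
    rewrite horner_sum; apply: eq_bigr => al _.
    rewrite hornerZ hornerXn /m -mulrA; congr (_ * _).
    rewrite mulrC /weight expr_sum -big_split /=; apply: eq_bigr => i _.
    by rewrite exprMn -exprM.
  by rewrite -hs // -[in leRHS](gtr0_norm s0); apply: hf => //; rewrite gtr0_norm.
have := congr1 (fun p : {poly C} => p`_q) p0.
rewrite /p coefB coefZ coefXn eqxx mulr1 coef0 => /eqP; rewrite subr_eq0 => /eqP ->.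
rewrite coef_sum big_mkcond [RHS]big_mkcond; apply: eq_bigr => al _.
rewrite coefZ coefXn [q == _]eq_sym; case: eqVneq => [->|]; first by rewrite ltnSn mulr1.
by rewrite mulr0; case: ifP.
Qed.

End HoloApprox.

(** * Differentiability of holomorphic functions *)

Section QuadraticRemainder.
Local Open Scope classical_set_scope.

Lemma differentiable_quadratic (F : numFieldType) (V W : normedModType F)
    (g : V -> W) x (K e : F) :
  0 < e -> 0 <= K -> g x = 0 ->
  (forall h, `|h| < e -> `|g (x + h)| <= K * `|h| ^+ 2) -> differentiable g x.
Proof.
move=> e0 K0 gx hg.
have dg : g \o shift x = cst (g x) + (0 : V -> W) +o_ 0 id.
  apply/eqaddoP => eps eps0; have d0 : 0 < eps / (K + 1).
    by rewrite divr_gt0 // ltr_wpDl.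
  near=> h; rewrite !fctE gx /= addr0 subr0 addrC.
  have hd : `|h| < eps / (K + 1).
    by near: h; exact: nbhs0_lt.
  rewrite (le_trans (hg _ _)); last first.
    rewrite expr2 mulrA ler_wpM2r // (le_trans (ler_wpM2l K0 (ltW hd))) //.
    by rewrite mulrCA ger_pMr // ler_pdivrMr ?mul1r ?lerDl // ltr_wpDl.
  by near: h; exact: nbhs0_lt.
  by [].
have c0 : continuous (0 : V -> W) by move=> ?; exact: cvg_cst.
have E : 'd g x = (\0 : {linear V -> W}) :> (_ -> _).
  exact: (@diff_unique _ _ _ g \0).
by apply/diff_locallyP; rewrite E.
Unshelve. all: by end_near. Qed.

End QuadraticRemainder.

Section HoloCalculus.
Variables (R : realType).
Local Notation C := (cplx R).
Local Open Scope classical_set_scope.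

Lemma polydiscP k (a : 'rV[C]_k) (P : 'rV[C]_k -> Prop) :
  (\forall z \near a, P z) <->
  exists2 e : C, 0 < e & forall z : 'rV[C]_k, (forall i, `|z 0 i - a 0 i| < e) -> P z.
Proof.
split=> [/nbhs_ballP[e /= e0 he]|[e e0 he]].
  exists e => // z hz; apply: he; split=> // i j; rewrite ord1 -ball_normE /=.
  by rewrite distrC.
apply/nbhs_ballP; exists e => //= z [_ hz]; apply: he => i.
by have := hz 0 i; rewrite -ball_normE /= distrC.
Qed.

Lemma entry_le_norm k (h : 'rV[C]_k) i : `|h 0 i| <= `|h|.
Proof.
apply/ler_addgt0Pr => e e0; have : ball (0 : 'rV[C]_k) (`|h| + e) h.
  by rewrite -ball_normE /= sub0r normrN ltrDl.
by case=> _ /(_ 0 i); rewrite -ball_normE /= mxE sub0r normrN => /ltW.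
Qed.

Lemma holo_at_near k (f g : 'rV[C]_k -> C) a :
  (\forall z \near a, f z = g z) -> holo_at f a -> holo_at g a.
Proof.
move=> /polydiscP[e e0 efg] [c [rho [rho0 [M hM] hf]]].
have m0 : 0 < Num.min rho e by rewrite /Order.min; case: ifP.
(* The order of C is partial; positive elements are real, hence comparable, and only then does
   [Num.min] behave as a minimum. *)
have cmp : rho >=< e by apply: real_comparable; rewrite gtr0_real.
exists c, (Num.min rho e); split => //.
  exists M => N; apply: le_trans (hM N); apply: ler_sum => al _.
  apply: ler_wpM2l => //; rewrite lerXn2r ?nnegrE ?(ltW m0) ?(ltW rho0) //.
  by rewrite comparable_ge_min // lexx.
move=> z hz; rewrite -efg; first apply: hf => i; last move=> i.
  by apply: lt_le_trans (hz i) _; rewrite comparable_ge_min // lexx.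
by apply: lt_le_trans (hz i) _; rewrite comparable_ge_min // lexx orbT.
Qed.

Lemma differentiable_sumT (V W : normedModType C) (T : Type) (r : seq T) (P : pred T)
    (F : T -> V -> W) x :
  (forall i, P i -> differentiable (F i) x) ->
  differentiable (fun z => \sum_(i <- r | P i) F i z) x.
Proof.
move=> dF; elim: r => [|i r IHr].
  have -> : (fun z => \sum_(i <- [::] | P i) F i z) = cst 0.
    by apply/funext => z; rewrite big_nil.
  exact: differentiable_cst.
have [Pi|Pi] := boolP (P i).
  have -> : (fun z => \sum_(i <- i :: r | P i) F i z) =
      F i \+ (fun z => \sum_(i <- r | P i) F i z).
    by apply/funext => z; rewrite big_cons Pi.
  by apply: differentiableD => //; apply: dF.
suff -> : (fun z => \sum_(i <- i :: r | P i) F i z) =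
    (fun z => \sum_(i <- r | P i) F i z) by [].
by apply/funext => z; rewrite big_cons (negbTE Pi).
Qed.

Lemma differentiable_prodT (V : normedModType C) (T : Type) (r : seq T)
    (F : T -> V -> C) x :
  (forall i, differentiable (F i) x) ->
  differentiable (fun z => \prod_(i <- r) F i z) x.
Proof.
move=> dF; elim: r => [|i r IHr].
  have -> : (fun z => \prod_(i <- [::]) F i z) = cst 1.
    by apply/funext => z; rewrite big_nil.
  exact: differentiable_cst.
have -> : (fun z => \prod_(i <- i :: r) F i z) =
    F i \* (fun z => \prod_(i <- r) F i z).
  by apply/funext => z; rewrite big_cons.
exact: differentiableM.
Qed.

Lemma holo_differentiable k (f : 'rV[C]_k -> C) a : holo_at f a -> differentiable f a.
Proof.
move=> /holo_approx [c [rho [M [rho0 M0 hf]]]].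
(* The Taylor polynomial of degree at most one; the remainder [f \- l] will be quadratic. *)
pose l (z : 'rV[C]_k) := weight_part c (fun=> 1%N) 2 (fun i => z 0 i - a 0 i).
have dl : differentiable l a.
  apply: differentiable_sumT => al _.
  have := @differentiableZ _ _ _ (fun z : 'rV[C]_k => \prod_i (z 0 i - a 0 i) ^+ al i) (c [ffun i => al i : nat]) a.
  apply; apply: differentiable_prodT => i.
  have -> : (fun z : 'rV[C]_k => (z 0 i - a 0 i) ^+ al i) =
      (fun z => \prod_(j <- enum 'I_(al i)) (z 0 i - a 0 i)).
    by apply/funext => z; rewrite big_enum prodr_const card_ord.
  apply: differentiable_prodT => _.
  apply: (@differentiableB _ _ _ (fun z : 'rV[C]_k => z 0 i) (cst (a 0 i))).
    exact: differentiable_coord.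
  exact: differentiable_cst.
have -> : f = l \+ (f \- l) by apply/funext => z /=; rewrite addrC subrK.
apply: differentiableD => //.
have key (h : 'rV[C]_k) (s : C) : `|s| <= 1 -> s != 0 -> (forall i, `|h 0 i| < `|s| * rho) ->
    `|(f \- l) (a + h)| <= `|s| ^+ 2 * M.
  move=> s1 s0 hh; have := hf (fun=> 1%N) 2%N (fun i => s^-1 * h 0 i) s.
  have -> : \row_i (s ^+ 1 * (s^-1 * h 0 i)) = h.
    by apply/rowP => i; rewrite mxE expr1 mulVKf.
  have -> : (fun i => s ^+ 1 * (s^-1 * h 0 i)) = (fun i => (a + h) 0 i - a 0 i).
    by apply/funext => i; rewrite mxE addrAC subrr add0r expr1 mulVKf.
  apply => // i; rewrite normrM normfV ltr_pdivrMl ?normr_gt0 //.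
(* With zero displacement [key] bounds the remainder by [|s| ^+ 2 * M] for every small [s], whatever
   the direction. *)
have ga0 : (f \- l) a = 0.
  apply/eqP; rewrite -normr_le0; apply/ler_addgt0Pr => e e0; rewrite add0r.
  have d0 : 0 < e / (M + 1) by rewrite divr_gt0 // ltr_wpDl.
  have m0 : 0 < Num.min 1 (e / (M + 1)) by rewrite /Order.min; case: ifP.
  have cmp : 1 >=< (e / (M + 1)) by apply: real_comparable; rewrite gtr0_real.
  have := key 0 (Num.min 1 (e / (M + 1))); rewrite addr0 (gtr0_norm m0) => H.
  apply: le_trans (H _ _ _) _; rewrite ?(gt_eqF m0) //.
  - by rewrite comparable_ge_min // lexx.
  - by move=> i; rewrite mxE normr0 mulr_gt0.
  rewrite expr2 -mulrA -[leRHS]mul1r ler_pM //; rewrite ?mulr_ge0 ?(ltW m0) //.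
    by rewrite comparable_ge_min // lexx.
  apply: (@le_trans _ _ (e / (M + 1) * M)).
    by rewrite ler_wpM2r // comparable_ge_min // lexx orbT.
  by rewrite mulrAC ler_pdivrMr ?ltr_wpDl // ler_wpM2l ?lerDl // ltW.
(* The scale used below is s = 2 |h| / rho: the entries of h / s then stay strictly below [rho], and
   s <= 1 amounts to |h| <= rho / 2. *)
apply: (@differentiable_quadratic _ _ _ _ a (M * (2 / rho) ^+ 2) (rho / 2)) => //.
- by rewrite divr_gt0.
- by rewrite mulr_ge0 // exprn_ge0 // divr_ge0 // ltW.
move=> h hh; have [->|h0] := eqVneq h 0.
  by rewrite addr0 ga0 !normr0 expr0n mulr0.
have n0 : 0 < `|h| by rewrite normr_gt0.
have sE : `|2 / rho * `|h| | = 2 / rho * `|h| by rewrite gtr0_norm // mulr_gt0 // divr_gt0.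
apply: le_trans (key h (2 / rho * `|h|) _ _ _) _; rewrite ?sE.
- by rewrite mulrAC ler_pdivrMr // mul1r mulrC -ler_pdivlMr // ltW.
- by rewrite mulf_neq0 ?gt_eqF // divr_gt0.
- move=> i; apply: le_lt_trans (entry_le_norm h i) _.
  by rewrite mulrAC divfK ?gt_eqF // ltr_pMl // ltr1n.
by rewrite exprMn mulrC mulrA.
Qed.

End HoloCalculus.

(** * Jacobian matrices *)

Section Jacobian.
Variables (R : realType) (n : nat).
Local Notation C := (cplx R).
Local Open Scope classical_set_scope.

Lemma holo_vec_differentiable k l (f : 'rV[C]_k -> 'rV[C]_l) a :
  holo_vec_at f a -> differentiable f a.
Proof.
move=> hf; have -> : f = (fun z => \sum_i f z 0 i *: delta_mx 0 i).
  by apply/funext => z; rewrite -row_sum_delta.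
apply: differentiable_sumT => i _; apply: (@differentiableZl _ _ _ (fun z => f z 0 i)).
exact: holo_differentiable.
Qed.

Lemma jacobian_comp k l m (f : 'rV[C]_k -> 'rV[C]_l) (g : 'rV[C]_l -> 'rV[C]_m) a :
  differentiable f a -> differentiable g (f a) ->
  'J (g \o f) a = 'J f a *m 'J g (f a).
Proof.
move=> df dg; apply/row_matrixP => i; rewrite !rowE mulmxA /jacobian !mul_rV_lin1.
by rewrite (diff_comp df dg).
Qed.

Lemma row_jacobian k l (f : 'rV[C]_k -> 'rV[C]_l) a i :
  differentiable f a -> row i ('J f a) = 'D_(delta_mx 0 i) f a.
Proof. by move=> df; rewrite rowE deriveEjacobian. Qed.

Lemma jacobian_near k l (f g : 'rV[C]_k -> 'rV[C]_l) a :
  (\forall z \near a, f z = g z) -> differentiable f a -> differentiable g a ->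
  'J f a = 'J g a.
Proof.
move=> fg df dg; apply/row_matrixP => i; apply: etrans (row_jacobian i df) _.
by apply: etrans _ (esym (row_jacobian i dg)); apply: near_eq_derive.
Qed.

Lemma differentiable_mulmxr k l (A : 'M[C]_(k, l)) a :
  differentiable (fun z : 'rV[C]_k => z *m A) a.
Proof.
have -> : (fun z : 'rV[C]_k => z *m A) = (fun z => \sum_i z 0 i *: row i A).
  by apply/funext => z; rewrite mulmx_sum_row.
apply: differentiable_sumT => i _; apply: (@differentiableZl _ _ _ (fun z : 'rV[C]_k => z 0 i)).
exact: differentiable_coord.
Qed.

Lemma differentiable_affine k l (A : 'M[C]_(k, l)) a b c :
  differentiable (fun z : 'rV[C]_k => b + (z - a) *m A) c.
Proof.
have -> : (fun z : 'rV[C]_k => b + (z - a) *m A) = cst (b - a *m A) \+ (fun z => z *m A).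
  by apply/funext => z /=; rewrite mulmxBl addrAC -addrA.
by apply: differentiableD; [exact: differentiable_cst|exact: differentiable_mulmxr].
Qed.

Lemma jacobian_affine k l (A : 'M[C]_(k, l)) a b c :
  'J (fun z : 'rV[C]_k => b + (z - a) *m A) c = A.
Proof.
have df := differentiable_affine A a b c.
apply/row_matrixP => i; rewrite [RHS]rowE.
apply: etrans (row_jacobian i df) _; apply: lim_near_cst => //; near=> h.
have h0 : h != 0 by near: h; exact: nbhs_dnbhs_neq.
have -> : b + (h *: delta_mx 0 i + c - a) *m A - (b + (c - a) *m A) =
    h *: (delta_mx 0 i *m A).
  by rewrite opprD addrACA subrr add0r -mulmxBl opprB addrA subrK addrK scalemxAl.
by rewrite scalerA mulVf // scale1r.
Unshelve. all: by end_near. Qed.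

End Jacobian.

(** * Polynomials with prescribed derivatives at a point *)

Section HoloClosure.
Variables (R : realType) (k : nat).
Local Notation C := (cplx R).
Local Open Scope classical_set_scope.
Implicit Types (f g : 'rV[C]_k -> C) (a b z : 'rV[C]_k) (al be : 'I_k -> nat).

Lemma holo_atD f g a : holo_at f a -> holo_at g a -> holo_at (fun z => f z + g z) a.
Proof.
move=> [c [rho [rho0 [M hM] hf]]] [d [e [e0 [M' hM'] hg]]].
have m0 : 0 < Num.min rho e by rewrite /Order.min; case: ifP.
have cmp : rho >=< e by apply: real_comparable; rewrite gtr0_real.
have mrho : Num.min rho e <= rho by rewrite comparable_ge_min // lexx.
have me : Num.min rho e <= e by rewrite comparable_ge_min // lexx orbT.
exists (fun al : {ffun 'I_k -> nat} => c al + d al), (Num.min rho e); split => //.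
  exists (M + M') => N; apply: le_trans (lerD (hM N) (hM' N)).
  rewrite -big_split /=; apply: ler_sum => al _.
  apply: (@le_trans _ _ ((`|c [ffun i => al i : nat]| + `|d [ffun i => al i : nat]|) *
    Num.min rho e ^+ (\sum_i al i)%N)).
    by rewrite ler_wpM2r ?ler_normD // exprn_ge0 // ltW.
  rewrite mulrDl lerD // ler_wpM2l // lerXn2r // nnegrE ltW //.
move=> z hz.
under [X in X @ _]eq_fun => N do under eq_bigr do rewrite mulrDl.
under [X in X @ _]eq_fun => N do rewrite big_split.
apply: cvgD; [apply: hf|apply: hg] => i; exact: lt_le_trans (hz i) _.
Qed.

Lemma holo_atZ (x : C) f a : holo_at f a -> holo_at (fun z => x * f z) a.
Proof.
move=> [c [rho [rho0 [M hM] hf]]].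
exists (fun al : {ffun 'I_k -> nat} => x * c al), rho; split; [exact: rho0| |].
  exists (`|x| * M) => N; apply: le_trans (ler_wpM2l (normr_ge0 x) (hM N)).
  by rewrite mulr_sumr; apply: ler_sum => al _; rewrite normrM mulrA.
move=> z hz; under [X in X @ _]eq_fun => N do under eq_bigr do rewrite -mulrA.
under [X in X @ _]eq_fun => N do rewrite -mulr_sumr.
by apply: cvgMr; apply: hf.
Qed.

(** Divided by factorials, so that differentiation lowers exponents without a factor and these
    monomials are dual to the derivatives at [b]. *)
Definition dmono al b z : C := \prod_i ((z 0 i - b 0 i) ^+ al i / (al i)`!%:R).

Lemma dmono_holo al b a : holo_at (dmono al b) a.
Proof.
(* Binomial coefficients of the re-expansion about [a]. The series is finite, so any radius will
   do. *)
pose t i j : C := 'C(al i, j)%:R * (a 0 i - b 0 i) ^+ (al i - j) / (al i)`!%:R.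
have t0 i j : (al i < j)%N -> t i j = 0 by move=> ij; rewrite /t bin_small // !mul0r.
have bigt (u : 'I_k -> C) (D N : nat) i : (al i < N)%N ->
    \sum_(j < N) t i j * u i ^+ j = \sum_(j < (al i).+1) t i j * u i ^+ j.
  move=> iN; rewrite (big_ord_widen N (fun j => t i j * u i ^+ j) iN) [RHS]big_mkcond /=.
  by apply: eq_bigr => j _; case: ltnP => // ij; rewrite t0 ?mul0r.
exists (fun be : {ffun 'I_k -> nat} => \prod_i t i (be i)), 1; split=> //.
  exists (\prod_i \sum_(j < (al i).+1) `|t i j|) => N.
  rewrite (eq_bigr (fun be : {ffun 'I_k -> 'I_N} => \prod_i `|t i (be i)|)); last first.
    move=> be _; rewrite expr1n mulr1 normr_prod.
    by apply: eq_bigr => i _; rewrite ffunE.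
  rewrite -(bigA_distr_bigA (fun i (j : 'I_N) => `|t i j|)).
  apply: ler_prod => i _; rewrite sumr_ge0 //=.
  apply: (@le_trans _ _ (\sum_(j < (al i).+1 + N) `|t i j|)).
    by rewrite addnC big_split_ord /= lerDl sumr_ge0.
  rewrite big_split_ord /= gerDl big1 // => j _.
  by rewrite t0 ?normr0 // ltn_addr.
move=> z _.
have eqN N : (\sum_i al i < N)%N -> \sum_(be : {ffun 'I_k -> 'I_N})
    (\prod_i t i ([ffun i => be i : nat] i)) * \prod_i (z 0 i - a 0 i) ^+ be i = dmono al b z.
  move=> hN.
  rewrite (eq_bigr (fun be : {ffun 'I_k -> 'I_N} =>
    \prod_i (t i (be i) * (z 0 i - a 0 i) ^+ be i))); last first.
    by move=> be _; rewrite -big_split /=; apply: eq_bigr => i _; rewrite ffunE.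
  rewrite -(bigA_distr_bigA (fun i (j : 'I_N) => t i j * (z 0 i - a 0 i) ^+ j)).
  apply: eq_bigr => i _.
  rewrite (bigt (fun i => z 0 i - a 0 i)) //; last first.
    by apply: leq_ltn_trans hN; rewrite (bigD1 i) //= leq_addr.
  have -> : z 0 i - b 0 i = (a 0 i - b 0 i) + (z 0 i - a 0 i) by ring.
  rewrite exprDn mulr_suml; apply: eq_bigr => j _.
  by rewrite /t -mulr_natl; ring.
apply: cvg_near_cst; by exists (\sum_i al i).+1%N.
Qed.

Lemma holo_at0 a : holo_at (fun=> 0) a.
Proof.
apply: holo_at_near (holo_atZ 0 (dmono_holo (fun=> 0%N) a a)).
by apply/polydiscP; exists 1 => // z _; rewrite mul0r.
Qed.

Lemma holo_at_sum (T : Type) (r : seq T) (P : pred T) (F : T -> 'rV[C]_k -> C) a :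
  (forall i, P i -> holo_at (F i) a) -> holo_at (fun z => \sum_(i <- r | P i) F i z) a.
Proof.
move=> hF; elim: r => [|i r IHr].
  have -> : (fun z => \sum_(i <- [::] | P i) F i z) = (fun=> 0).
    by apply/funext => z; rewrite big_nil.
  exact: holo_at0.
have [Pi|Pi] := boolP (P i).
  have -> : (fun z => \sum_(i <- i :: r | P i) F i z) =
      (fun z => F i z + \sum_(i <- r | P i) F i z).
    by apply/funext => z; rewrite big_cons Pi.
  exact: (holo_atD (hF i Pi) IHr).
suff -> : (fun z => \sum_(i <- i :: r | P i) F i z) =
    (fun z => \sum_(i <- r | P i) F i z) by [].
by apply/funext => z; rewrite big_cons (negbTE Pi).
Qed.

End HoloClosure.

Section Partial.
Variables (R : realType) (k : nat).
Local Notation C := (cplx R).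
Local Open Scope classical_set_scope.
Implicit Types (f g : 'rV[C]_k -> C) (a b z : 'rV[C]_k) (al be : 'I_k -> nat).

Lemma holo_derivable f a v : holo_at f a -> derivable f a v.
Proof. by move=> /holo_differentiable; exact: diff_derivable. Qed.

Lemma partial_line f z j (c x : C) m :
  (forall h, f (h *: delta_mx 0 j + z) = c * (h + x) ^+ m) ->
  partial j f z = c * (m%:R * x ^+ m.-1).
Proof.
move=> fE; rewrite /partial.
have fz : f z = c * x ^+ m by rewrite -[x]add0r -fE scale0r add0r.
have d := @exprn_derivable C m x 1; have e := @exp_derive C m x 1.
rewrite /derivable in d; rewrite /derive in e.
apply: cvg_lim; first exact: norm_hausdorff.
have -> : (fun h : C => h^-1 *: ((f \o shift z) (h *: delta_mx 0 j) - f z)) =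
  (fun h : C => c * (h^-1 *: (((@GRing.exp C)^~ m \o shift x) (h *: 1) - x ^+ m))).
  apply/funext => h /=; rewrite fE fz -mulrBr [h *: 1]mulr1.
  by rewrite [LHS]mulrCA.
apply: cvgMr; by rewrite e [_%:A]mulr1 in d; exact: d.
Qed.

Definition decr j al : 'I_k -> nat := fun i => (al i - (i == j))%N.

Lemma partial_dmono al b j z : partial j (dmono al b) z =
  if al j == 0%N then 0 else dmono (decr j al) b z.
Proof.
pose P : C := \prod_(i | i != j) ((z 0 i - b 0 i) ^+ al i / (al i)`!%:R).
rewrite (@partial_line _ z j (P / (al j)`!%:R) (z 0 j - b 0 j) (al j)); last first.
  move=> h; rewrite /dmono (bigD1 j) //= mulrC mulrAC -mulrA.
  congr (_ * _); last by rewrite !mxE !eqxx mulr1 addrA.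
  by apply: eq_bigr => i /negbTE ij; rewrite !mxE eqxx ij mulr0 add0r.
case: (al j =P 0%N) => [->|alj]; first by rewrite mul0r mulr0.
rewrite /dmono [RHS](bigD1 j) //= /decr eqxx subn1 mulrC.
have -> : \prod_(i | i != j) ((z 0 i - b 0 i) ^+ (al i - (i == j)) / ((al i - (i == j))`!)%:R) = P.
  by apply: eq_bigr => i /negbTE ->; rewrite subn0.
case: (al j) alj => // m _; rewrite /= factS natrM.
have f0 : (m`!%:R : C) != 0 by rewrite pnatr_eq0 -lt0n fact_gt0.
have m0 : (m.+1%:R : C) != 0 by rewrite pnatr_eq0.
move: (m.+1%:R) m0 (m`!%:R) f0 => u u0 v v0.
by field; rewrite u0 v0.
Qed.

(* The derivative of order [be] of [dmono al b]. *)
Definition dmonoD al be b z : C :=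
  if [forall i, be i <= al i]%N then dmono (fun i => al i - be i)%N b z else 0.

Definition incr j al : 'I_k -> nat := fun i => (al i + (i == j))%N.

Lemma partial_dmonoD al be b j : partial j (dmonoD al be b) = dmonoD al (incr j be) b.
Proof.
apply/funext => z.
have [h|h] := boolP [forall i, be i <= al i]%N; last first.
  have -> : dmonoD al be b = cst 0 by apply/funext => y; rewrite /dmonoD (negbTE h).
  rewrite /partial derive_cst /dmonoD; case: ifP => // h'.
  case/negP: h; apply/forallP => i; apply: leq_trans (forallP h' i).
  by rewrite leq_addr.
have -> : dmonoD al be b = dmono (fun i => al i - be i)%N b.
  by apply/funext => y; rewrite /dmonoD h.
rewrite partial_dmono /dmonoD; have [alj|alj] := eqVneq (al j - be j)%N 0%N.
  case: ifP => // /forallP/(_ j); rewrite /incr eqxx addn1 ltnNge.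
  by move/eqP: alj; rewrite subn_eq0 => ->.
rewrite ifT; last first.
  apply/forallP => i; rewrite /incr; case: eqVneq => [->|_]; last first.
    by rewrite addn0 (forallP h).
  by rewrite addn1 ltnNge -subn_eq0.
by congr dmono; apply/funext => i; rewrite /decr /incr subnDA.
Qed.

Lemma dmonoD_holo al be b a : holo_at (dmonoD al be b) a.
Proof.
rewrite /dmonoD; case: [forall i, _]; [exact: dmono_holo|exact: holo_at0].
Qed.

Lemma dmonoD0 al b : dmonoD al (fun=> 0%N) b = dmono al b.
Proof.
apply/funext => z; rewrite /dmonoD ifT; last by apply/forallP => i; rewrite leq0n.
by congr dmono; apply/funext => i; rewrite subn0.
Qed.

Lemma dmonoD_center (al be : {ffun 'I_k -> nat}) b : dmonoD al be b b = (al == be)%:R.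
Proof.
rewrite /dmonoD; have [h|h] := boolP [forall i, be i <= al i]%N; last first.
  case: eqP => // e; case/negP: h; rewrite e; apply/forallP => i; exact: leqnn.
rewrite /dmono; case: eqP => [e|ne].
  by apply: big1 => i _; rewrite e subnn expr0 fact0 divr1.
apply/eqP/prodf_eq0; have /existsP[i] : [exists i, al i != be i].
  apply/negbNE/negP => /existsPn ae; case: ne; apply/ffunP => i.
  by apply/eqP/negbNE/ae.
move=> ai; exists i; first by [].
have lt_i : (be i < al i)%N by rewrite ltn_neqAle [be i == _]eq_sym ai (forallP h i).
by rewrite subrr expr0n subn_eq0 leqNgt lt_i mul0r.
Qed.

Section DPoly.
Variables (T : finType) (co : T -> C) (ex : T -> 'I_k -> nat) (b : 'rV[C]_k).

(** The parameter [al] is the order of the derivative already taken: the family is stable under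
    [partial], which only increments [al]. *)
Definition dpoly al z : C := \sum_t co t * dmonoD (ex t) al b z.

Lemma dpoly_holo al a : holo_at (dpoly al) a.
Proof. by apply: holo_at_sum => t _; apply: holo_atZ; exact: dmonoD_holo. Qed.

Lemma derive_sumT (S : Type) (r : seq S) (F : S -> 'rV[C]_k -> C) z v :
  (forall i, derivable (F i) z v) ->
  'D_v (fun y => \sum_(i <- r) F i y) z = \sum_(i <- r) 'D_v (F i) z /\
  derivable (fun y => \sum_(i <- r) F i y) z v.
Proof.
move=> dF; elim: r => [|i r [IH1 IH2]].
  have -> : (fun y => \sum_(i <- [::]) F i y) = cst 0.
    by apply/funext => y; rewrite big_nil.
  by rewrite derive_cst big_nil; split; [|exact: derivable_cst].
have -> : (fun y => \sum_(i <- i :: r) F i y) = F i \+ (fun y => \sum_(i <- r) F i y).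
  by apply/funext => y; rewrite big_cons.
split; last exact: (derivableD (dF i) IH2).
by rewrite big_cons -IH1; apply: (deriveD (dF i) IH2).
Qed.

Lemma partial_dpoly al j : partial j (dpoly al) = dpoly (incr j al).
Proof.
apply/funext => z; rewrite /partial.
have dF t : derivable (fun y => co t * dmonoD (ex t) al b y) z (delta_mx 0 j).
  by apply: holo_derivable; apply: holo_atZ; exact: dmonoD_holo.
have [-> _] := derive_sumT (index_enum T) dF.
apply: eq_bigr => t _; rewrite -partial_dmonoD /partial.
exact: (deriveZ (co t) (@holo_derivable _ _ (delta_mx 0 j) (dmonoD_holo (ex t) al b z))).
Qed.

Lemma iter_partial_dpoly j m al :
  iter m (partial j) (dpoly al) = dpoly (fun i => al i + m * (i == j))%N.
Proof.
elim: m => [|m IHm] /=.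
  by congr dpoly; apply/funext => i; rewrite mul0n addn0.
rewrite IHm partial_dpoly; congr dpoly; apply/funext => i.
by rewrite /incr mulSn addnAC addnA.
Qed.

Lemma multi_partial_dpoly al : multi_partial al (dpoly (fun=> 0%N)) = dpoly al.
Proof.
rewrite /multi_partial.
have -> (s : seq 'I_k) : foldr (fun j g => iter (al j) (partial j) g) (dpoly (fun=> 0%N)) s =
    dpoly (fun i => al i * count_mem i s)%N.
  elim: s => [|j s IHs] /=; first by congr dpoly; apply/funext => i; rewrite muln0.
  rewrite IHs iter_partial_dpoly; congr dpoly; apply/funext => i.
  rewrite mulnDr addnC eq_sym; congr (_ + _)%N.
  by case: eqVneq => [->|]; rewrite ?muln0.
congr dpoly; apply/funext => i; rewrite count_uniq_mem ?enum_uniq //.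
by rewrite mem_enum muln1.
Qed.

End DPoly.

Lemma partial_near f g a j : (\forall z \near a, f z = g z) ->
  \forall z \near a, partial j f z = partial j g z.
Proof.
move=> /near_join; apply: filterS => z; exact: near_eq_derive.
Qed.

(** Equality has to be kept on a neighbourhood at every stage, since equality at the point does not
    survive the next differentiation. *)
Lemma multi_partial_near f g a al : (\forall z \near a, f z = g z) ->
  multi_partial al f a = multi_partial al g a.
Proof.
move=> fg; suff : \forall z \near a, multi_partial al f z = multi_partial al g z.
  exact: nbhs_singleton.
rewrite /multi_partial; elim: (enum 'I_k) => //= j s IHs.
by elim: (al j) => //= m; apply: partial_near.
Qed.

End Partial.

(** * Charts and affine biholomorphisms *)

Section Charts.
Variables (R : realType) (n : nat) (X : cmanifold R n).
Local Notation C := (cplx R).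
Local Notation A := (extalg R n).
Local Open Scope classical_set_scope.
Implicit Types (x y : X) (c : chart R n X) (z : 'rV[C]_n).

Lemma chart_at_atlas x : atlas (chart_at x).
Proof. by rewrite /chart_at; case: cid => c []. Qed.

Lemma chart_at_dom x : cdom (chart_at x) x.
Proof. by rewrite /chart_at; case: cid => c []. Qed.

Hint Resolve chart_at_atlas chart_at_dom : core.

Lemma near_cdom c x : cdom c x -> \forall y \near x, cdom c y.
Proof. by move=> cx; apply: open_nbhs_nbhs; split=> //; exact: cdom_open. Qed.

Lemma near_cimg c x : cdom c x -> \forall z \near cmap c x, (cmap c @` cdom c) z.
Proof.
move=> cx; apply: open_nbhs_nbhs; split; first exact: cimg_open.
by exists x.
Qed.

Lemma near_cinv c x (Q : X -> Prop) : cdom c x -> (\forall y \near x, Q y) ->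
  \forall z \near cmap c x, Q (cinv c z).
Proof.
by move=> cx nQ; have := cinv_cont cx; apply; rewrite cmapK.
Qed.

Lemma cinvK c z : (cmap c @` cdom c) z -> cmap c (cinv c z) = z.
Proof. by case=> y cy <-; rewrite cmapK. Qed.

Lemma cinv_dom c z : (cmap c @` cdom c) z -> cdom c (cinv c z).
Proof. by case=> y cy <-; rewrite cmapK. Qed.

Definition transition c1 c2 := cmap c2 \o cinv c1.

Lemma transition_differentiable c1 c2 x : atlas c1 -> atlas c2 -> cdom c1 x ->
  cdom c2 x -> differentiable (transition c1 c2) (cmap c1 x).
Proof.
move=> a1 a2 d1 d2; apply: holo_vec_differentiable.
exact: atlas_compat.
Qed.

Lemma jacobian_id z : 'J (id : 'rV[C]_n -> 'rV[C]_n) z = 1%:M.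
Proof.
have -> : id = (fun y : 'rV[C]_n => 0 + (y - 0) *m 1%:M).
  by apply/funext => y; rewrite subr0 mulmx1 add0r.
exact: jacobian_affine.
Qed.

Lemma differentiable_id z : differentiable (id : 'rV[C]_n -> 'rV[C]_n) z.
Proof. exact: ex_diff. Qed.

Lemma jacobian_transition_self c x : atlas c -> cdom c x ->
  'J (transition c c) (cmap c x) = 1%:M.
Proof.
move=> ac cx; rewrite -(jacobian_id (cmap c x)); apply: jacobian_near.
- apply: filterS (near_cimg cx) => z zc; exact: cinvK.
- exact: transition_differentiable.
- exact: differentiable_id.
Qed.

Lemma jacobian_transitionK c1 c2 x : atlas c1 -> atlas c2 -> cdom c1 x -> cdom c2 x ->
  'J (transition c1 c2) (cmap c1 x) *m 'J (transition c2 c1) (cmap c2 x) = 1%:M.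
Proof.
move=> a1 a2 d1 d2.
have e : transition c1 c2 (cmap c1 x) = cmap c2 x by rewrite /transition /= cmapK.
have t1 := transition_differentiable a1 a2 d1 d2.
have t2 : differentiable (transition c2 c1) (transition c1 c2 (cmap c1 x)).
  by rewrite e; exact: transition_differentiable.
have := jacobian_comp t1 t2; rewrite {1}e => <-.
rewrite -(jacobian_id (cmap c1 x)); apply: jacobian_near.
- have nd := near_cinv d1 (near_cdom d2).
  apply: filterS2 (near_cimg d1) nd => z zc dz.
  by rewrite /transition /= cmapK // cinvK.
- exact: differentiable_comp t1 t2.
- exact: differentiable_id.
Qed.

Lemma covector_exprE c y a :
  covector_expr c y a = pull ('J (transition c (chart_at y)) (cmap c y)) a.
Proof. by []. Qed.

Lemma covector_expr_id x a : covector_expr (chart_at x) x a = a.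
Proof. by rewrite covector_exprE jacobian_transition_self // pull_id. Qed.

Lemma form_exprE c (w : X -> ext R n) y : cdom c y ->
  form_expr c w (cmap c y) = covector_expr c y (w y).
Proof. by move=> cy; rewrite /form_expr cmapK. Qed.

(** The form with expression [f] in the chart [c]. Its value at [y] has to be written in the
    preferred chart at [y], whence the Jacobian of the transition. *)
Definition chart_form c (f : 'rV[C]_n -> A) (y : X) : ext R n :=
  pull ('J (transition (chart_at y) c) (cmap (chart_at y) y)) (f (cmap c y)).

Lemma chart_formK c f z : atlas c -> (cmap c @` cdom c) z ->
  form_expr c (chart_form c f) z = f z.
Proof.
move=> ac [y cy <-]; rewrite form_exprE // covector_exprE /chart_form pull_comp.
by rewrite jacobian_transitionK // pull_id.
Qed.

Lemma chart_form_holo_near c f x p : c = chart_at x ->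
  (forall z, ext_homog p (f z)) ->
  (forall I z, holo_at (fun z => f z I) z) ->
  holo_form_near p (chart_form c f) x.
Proof.
move=> -> hp hf; apply: filterS (near_cdom (chart_at_dom x)) => y cy; split.
  exact: pull_homog.
move=> I; apply: holo_at_near (hf I _).
apply: filterS (near_cimg cy) => z zc.
by rewrite chart_formK.
Qed.

End Charts.

Section AffineMaps.
Variables (R : realType) (n : nat) (X : cmanifold R n).
Local Notation C := (cplx R).
Local Open Scope classical_set_scope.

Definition affine (b b' : 'rV[C]_n) (A : 'M[C]_n) (z : 'rV[C]_n) : 'rV[C]_n :=
  b' + (z - b) *m A.

Lemma affine_continuous b b' A : continuous (affine b b' A).
Proof. by move=> z; apply: differentiable_continuous; exact: differentiable_affine. Qed.

Lemma affine_holo b b' A z : holo_vec_at (affine b b' A) z.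
Proof.
move=> i; pose e j : 'I_n -> nat := fun k => nat_of_bool (k == j).
apply: (@holo_at_near _ _ (fun z => b' 0 i * dmono (fun=> 0%N) 0 z +
    \sum_j A j i * dmono (e j) b z)); last first.
  apply: holo_atD; first exact/holo_atZ/dmono_holo.
  by apply: holo_at_sum => j _; exact/holo_atZ/dmono_holo.
apply/polydiscP; exists 1 => // y _; rewrite !mxE; congr (_ + _).
  by rewrite /dmono big1 ?mulr1 // => k _; rewrite expr0 fact0 divr1.
apply: eq_bigr => j _; rewrite !mxE mulrC; congr (_ * _).
rewrite /dmono (bigD1 j) //= /e eqxx expr1 divr1 big1 ?mulr1 // => k /negbTE ->.
by rewrite expr0 fact0 divr1.
Qed.

Lemma affineK b b' A : A \in unitmx -> cancel (affine b b' A) (affine b' b (invmx A)).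
Proof. by move=> uA z; rewrite /affine addrAC subrr add0r mulmxK // addrC subrK. Qed.

Variables (c c' : chart R n X) (b b' : 'rV[C]_n) (A : 'M[C]_n).
Hypotheses (ac : atlas c) (ac' : atlas c').

Definition affine_map (y : X) : X := cinv c' (affine b b' A (cmap c y)).

Definition affine_dom : set X :=
  [set y | cdom c y /\ (cmap c' @` cdom c') (affine b b' A (cmap c y))].

Lemma affine_dom_open : open affine_dom.
Proof.
rewrite openE => y [cy iy].
suff ni : \forall u \near y, (cmap c' @` cdom c') (affine b b' A (cmap c u)).
  by apply: filterS2 (near_cdom cy) ni => u cu iu; split.
have cont : {for y, continuous (affine b b' A \o cmap c)}.
  by apply: continuous_comp; [exact: cmap_cont|exact: affine_continuous].
by apply: cont; apply: open_nbhs_nbhs; split => //; exact: cimg_open.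
Qed.

Lemma affine_map_holo y : affine_dom y -> holo_map_at affine_map y.
Proof.
move=> [cy iy]; have [u cu eu] := iy; split.
  apply: (@continuous_comp _ _ _ (affine b b' A \o cmap c) (cinv c')).
    by apply: continuous_comp; [exact: cmap_cont|exact: affine_continuous].
  by rewrite /= -eu; exact: cinv_cont.
exists c, c'; split=> //; first by rewrite /affine_map; exact: cinv_dom.
move=> i; apply: holo_at_near (@affine_holo b b' A (cmap c y) i).
suff ni : \forall z \near cmap c y, (cmap c' @` cdom c') (affine b b' A z).
  apply: filterS2 (near_cimg cy) ni => z zc zi.
  have e : cmap c' (affine_map (cinv c z)) = affine b b' A z.
    rewrite /affine_map; have e0 := cinvK zc.
    by rewrite [X in affine _ _ _ X]e0; exact: (cinvK zi).
  by rewrite -e.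
by apply: affine_continuous; apply: open_nbhs_nbhs; split => //; exact: cimg_open.
Qed.

End AffineMaps.

Section AffineBiholo.
Variables (R : realType) (n : nat) (X : cmanifold R n).
Local Notation C := (cplx R).
Local Open Scope classical_set_scope.
Variables (c c' : chart R n X) (b b' : 'rV[C]_n) (A : 'M[C]_n).
Hypotheses (ac : atlas c) (ac' : atlas c') (uA : A \in unitmx).

Lemma affine_dom_map (y : X) : affine_dom c c' b b' A y ->
  cdom c' (affine_map c c' b b' A y) /\
  cmap c' (affine_map c c' b b' A y) = affine b b' A (cmap c y).
Proof.
by move=> [cy iy]; split; [exact: cinv_dom|rewrite /affine_map cinvK].
Qed.

Lemma affine_mapK (y : X) : affine_dom c c' b b' A y ->
  affine_dom c' c b' b (invmx A) (affine_map c c' b b' A y) /\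
  affine_map c' c b' b (invmx A) (affine_map c c' b b' A y) = y.
Proof.
move=> dy; have [d e] := affine_dom_map dy; have [cy _] := dy; split.
  by split=> //; rewrite e affineK //; exists y.
by rewrite {1}/affine_map e affineK // cmapK.
Qed.

End AffineBiholo.

Section AffineBiholoRecord.
Variables (R : realType) (n : nat) (X : cmanifold R n).
Local Notation C := (cplx R).
Variables (c c' : chart R n X) (b b' : 'rV[C]_n) (A : 'M[C]_n).
Hypotheses (ac : atlas c) (ac' : atlas c') (uA : A \in unitmx).

Let uA' : invmx A \in unitmx. Proof. by rewrite unitmx_inv. Qed.

Let bihVK' (y : X) : affine_dom c' c b' b (invmx A) y ->
  affine_dom c c' b b' A (affine_map c' c b' b (invmx A) y) /\
  affine_map c c' b b' A (affine_map c' c b' b (invmx A) y) = y.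
Proof. by move=> dy; have := affine_mapK uA' dy; rewrite invmxK. Qed.

Definition affine_biholo : biholo X := @Biholo R n X
  (affine_dom c c' b b' A) (affine_dom c' c b' b (invmx A))
  (affine_map c c' b b' A) (affine_map c' c b' b (invmx A))
  (@affine_dom_open R n X c c' b b' A) (@affine_dom_open R n X c' c b' b (invmx A))
  (fun x dx => proj1 (affine_mapK uA dx)) (fun y dy => proj1 (bihVK' dy))
  (fun x dx => proj2 (affine_mapK uA dx)) (fun y dy => proj2 (bihVK' dy))
  (affine_map_holo ac ac') (affine_map_holo ac' ac).

Lemma map_jacobian_affine y : affine_dom c' c b' b (invmx A) y ->
  map_jacobian (bihV affine_biholo) y =
  'J (transition (chart_at y) c') (cmap (chart_at y) y) *m invmx A *m
  'J (transition c (chart_at (bihV affine_biholo y))) (cmap c (bihV affine_biholo y)).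
Proof.
move=> dy; have [cy' iy'] := dy.
have [dbV ebV] := affine_dom_map dy.
set y0 := bihV affine_biholo y.
set p := cmap (chart_at y) y.
have ep : transition (chart_at y) c' p = cmap c' y.
  by rewrite /transition /p /= cmapK //; exact: chart_at_dom.
have d1 : differentiable (transition (chart_at y) c') p.
  apply: transition_differentiable => //; [exact: chart_at_atlas|exact: chart_at_dom].
have d2 : differentiable (affine b' b (invmx A)) (transition (chart_at y) c' p).
  exact: differentiable_affine.
have d12 := differentiable_comp d1 d2.
have d3 : differentiable (transition c (chart_at y0))
    ((affine b' b (invmx A) \o transition (chart_at y) c') p).
  rewrite /= ep -ebV; apply: transition_differentiable => //.
    exact: chart_at_atlas.
  exact: chart_at_dom.
have j12 : 'J (affine b' b (invmx A) \o transition (chart_at y) c') p =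
    'J (transition (chart_at y) c') p *m invmx A.
  by rewrite (jacobian_comp d1 d2) jacobian_affine.
have := jacobian_comp d12 d3; rewrite {1}j12 /= ep -ebV.
exact.
Qed.

(** The chain rule passes through [c'], the inverse affine map and [c]; the last Jacobian cancels
    the one in [chart_form c], so only the constant matrix [invmx A] acts on the coefficients. *)
Lemma form_push_affine (f : 'rV[C]_n -> extalg R n) y :
  affine_dom c' c b' b (invmx A) y ->
  form_push affine_biholo (chart_form c f) y =
  chart_form c' (fun z => pull (invmx A) (f (affine b' b (invmx A) z))) y.
Proof.
move=> dy; have e : affine_biholo (bihV affine_biholo y) = y := proj2 (bihVK' dy).
rewrite /form_push /covector_push e ext_pullE.
rewrite map_jacobian_affine // /chart_form !pull_comp.
have [dbV ebV] := affine_dom_map dy.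
have eJ := @jacobian_transitionK R n X c (chart_at (bihV affine_biholo y))
  (bihV affine_biholo y) ac (chart_at_atlas _) dbV (chart_at_dom _).
apply: etrans (congr1 (fun z => pull _ (f z)) ebV).
apply: (congr1 (fun M => pull M _)); rewrite -3!mulmxA; apply: (congr1 (mulmx _)).
by rewrite eJ mulmx1.
Qed.

End AffineBiholoRecord.

(** * The operator as a function of Taylor coefficients *)

Section Jets.
Variables (R : realType) (n : nat) (X : cmanifold R n).
Variables (m : nat) (p : 'I_m -> nat) (r : nat).
Local Notation C := (cplx R).
Local Notation J := (jet_index n p r).
Local Open Scope classical_set_scope.

Definition jcomp (k : J) : 'I_m := (val k).1.1.
Definition jset (k : J) : {set 'I_n} := (val k).1.2.
Definition jexp (k : J) : {ffun 'I_n -> nat} := [ffun j => (val k).2 j : nat].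

Lemma jset_card k : #|jset k| = p (jcomp k).
Proof. by have /andP[/eqP ? _] := valP k. Qed.

Lemma jexp_sum k : (\sum_j jexp k j <= r)%N.
Proof.
by have /andP[_] := valP k; rewrite (eq_bigr (jexp k)) // => j _; rewrite ffunE.
Qed.

Lemma jet_index_inj k l : jcomp k = jcomp l -> jset k = jset l -> jexp k = jexp l -> k = l.
Proof.
move=> e1 e2 /ffunP e3; apply: val_inj.
have {}e3 : (val k).2 = (val l).2.
  by apply/ffunP => j; have := e3 j; rewrite !ffunE => /val_inj.
move: e1 e2 e3; rewrite /jcomp /jset.
by case: (val k) (val l) => [[i K] al] [[i' K'] al'] /= -> -> ->.
Qed.

Definition jet_poly (b : 'rV[C]_n) (a : J -> C) i (z : 'rV[C]_n) : extalg R n :=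
  [ffun K => dpoly (fun k : J => a k * ((jcomp k == i) && (jset k == K))%:R)
     (fun k => jexp k : 'I_n -> nat) b (fun=> 0%N) z].

Lemma jet_poly_homog b a i z : ext_homog (p i) (jet_poly b a i z).
Proof.
move=> K pK; rewrite ffunE /dpoly big1 // => k _.
case: eqP => [ki|]; last by rewrite mulr0 mul0r.
case: eqP => [kK|]; last by rewrite mulr0 mul0r.
by rewrite -kK jset_card ki eqxx in pK.
Qed.

Lemma jet_polyE b a i z : jet_poly b a i z =
  \sum_(k : J | jcomp k == i) (a k * dmono (jexp k) b z) *: dzs R (enum (jset k)).
Proof.
apply/ffunP => K; rewrite ffunE ext_sumE big_mkcond; apply: eq_bigr => k _.
rewrite dmonoD0; case: eqP => ki; last by rewrite mulr0 mul0r.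
by rewrite ext_scaleE dzs_enum ffunE eq_sym /= mulrAC.
Qed.

Lemma jet_section_subproof a (x : X) i : holo_form_near (p i)
  (chart_form (chart_at x) (jet_poly (cmap (chart_at x) x) a i)) x.
Proof.
apply: chart_form_holo_near => // [z|I z]; first exact: jet_poly_homog.
apply: holo_at_near (dpoly_holo (fun k : J => a k * ((jcomp k == i) && (jset k == I))%:R)
  (fun k => jexp k : 'I_n -> nat) (cmap (chart_at x) x) (fun=> 0%N) z).
by apply/polydiscP; exists 1 => // y _; rewrite ffunE.
Qed.

Definition jet_section a x : local_section p x :=
  LocalSection (jet_section_subproof a x).

Definition jet_coef (w : 'I_m -> X -> ext R n) (x : X) (k : J) : C :=
  multi_partial (jexp k) (fun z => form_expr (chart_at x) (w (jcomp k)) z (jset k))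
    (cmap (chart_at x) x).

Lemma jet_coordE w x : jet_coord p r (chart_at x) w x = \row_k jet_coef w x (enum_val k).
Proof.
apply/rowP => k; rewrite !mxE /jet_coef /jcomp /jset.
case e : (val (enum_val k)) => [[i K] al] /=.
by congr multi_partial; apply/funext => j; rewrite /jexp e ffunE.
Qed.

(** The divided monomials are dual to the derivatives at their centre, so every family of
    coefficients is the jet of a polynomial section. *)
Lemma jet_coef_section a x : jet_coef (jet_section a x) x = a.
Proof.
apply/funext => k; rewrite /jet_coef.
have e : \forall z \near cmap (chart_at x) x,
    form_expr (chart_at x) (jet_section a x (jcomp k)) z (jset k) =
    dpoly (fun l : J => a l * ((jcomp l == jcomp k) && (jset l == jset k))%:R)
     (fun l => jexp l : 'I_n -> nat) (cmap (chart_at x) x) (fun=> 0%N) z.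
  apply: filterS (near_cimg (chart_at_dom x)) => z zc.
  rewrite [jet_section a x _]/(chart_form _ _) chart_formK //; first by rewrite ffunE.
  exact: chart_at_atlas.
rewrite (multi_partial_near _ e) multi_partial_dpoly /dpoly (bigD1 k) //=.
rewrite !eqxx mulr1 dmonoD_center eqxx mulr1 big1 ?addr0 // => l lk.
rewrite dmonoD_center; case: (eqVneq (jexp l) (jexp k)) => e3; last by rewrite mulr0.
case: (eqVneq (jcomp l) (jcomp k)) => e1; last by rewrite mulr0 mul0r.
case: (eqVneq (jset l) (jset k)) => e2; last by rewrite mulr0 mul0r.
by rewrite (jet_index_inj e1 e2 e3) eqxx in lk.
Qed.

Lemma jet_of_eq x (s t : local_section p x) :
  jet_coef s x = jet_coef t x -> jet_of r s = jet_of r t.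
Proof.
move=> st; have e : same_jet r s = same_jet r t.
  apply/predeqP => u; rewrite /same_jet !jet_coordE st; split=> ->//.
rewrite /jet_of; move: (ex_intro _ s _) (ex_intro _ t _).
by rewrite e => h h'; congr Jet; exact: Prop_irrelevance.
Qed.

Variables (q : nat) (P : natural_operator X p r q).

Definition jet_op x (a : J -> C) : extalg R n := P x (jet_of r (jet_section a x)).

Lemma jet_opE x (w : local_section p x) : P x (jet_of r w) = jet_op x (jet_coef w x).
Proof. by congr (P _ _); apply: jet_of_eq; rewrite jet_coef_section. Qed.

Lemma jet_op_homog x a : ext_homog q (jet_op x a).
Proof. exact: nat_op_deg. Qed.

Lemma jet_op_holo x (I : {set 'I_n}) :
  exists2 g : 'rV[C]_(n + #|{: J}|) -> C, holo_at g (row_mx (cmap (chart_at x) x) 0) &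
   forall a, jet_op x a I = g (row_mx (cmap (chart_at x) x) (\row_k a (enum_val k))).
Proof.
have [G hG GE] := nat_op_holo P (chart_at_atlas x).
exists (fun z => G z I); first exact: (hG _ _ (chart_at_dom x)).
move=> a; have := GE x (jet_section a x) (chart_at_dom x).
by rewrite covector_expr_id jet_coordE jet_coef_section => <-.
Qed.

(** The biholomorphism goes from the preferred chart at [x] to the one at [x'] with linear part
    [invmx B]: forms are transported by pull-back along the inverse, whose linear part is [B].
    Checking polynomial sections is enough, as these represent all jets. *)
Lemma jet_op_natural x x' (B : 'M[C]_n) a a' : B \in unitmx ->
  (forall i z, pull B (jet_poly (cmap (chart_at x) x) a i
      (affine (cmap (chart_at x') x') (cmap (chart_at x) x) B z)) =
    jet_poly (cmap (chart_at x') x') a' i z) ->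
  jet_op x' a' = pull B (jet_op x a).
Proof.
move=> uB hB; have uA : invmx B \in unitmx by rewrite unitmx_inv.
set b := cmap (chart_at x) x in hB *; set b' := cmap (chart_at x') x' in hB *.
pose tau := affine_biholo b b' (chart_at_atlas x) (chart_at_atlas x') uA.
have taux : tau x = x'.
  by rewrite /= /affine_map /affine /b subrr mul0mx addr0 cmapK //; exact: chart_at_dom.
have dx : bdom tau x.
  split; first exact: chart_at_dom.
  by exists x'; [exact: chart_at_dom|rewrite /affine subrr mul0mx addr0].
have nt := @nat_op_natural _ _ _ _ _ _ _ P tau x dx (jet_section a x).
have dcod : bcod tau x' by rewrite -taux; exact: bih_cod.
have ncod : \forall y \near x', bcod tau y.
  by apply: open_nbhs_nbhs; split=> //; exact: bcod_open.
have push : covector_push tau x = pull B.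
  apply/funext => v; rewrite /covector_push taux ext_pullE map_jacobian_affine //.
  have e : bihV tau x' = x by rewrite -taux bihK.
  by rewrite e !jacobian_transition_self ?mul1mx ?mulmx1 ?invmxK //;
    (exact: chart_at_atlas || exact: chart_at_dom).
rewrite push taux in nt; apply: nt => i.
apply: filterS ncod => y ycod.
rewrite [jet_section a x _]/(chart_form _ _) form_push_affine // invmxK.
by rewrite [LHS]/(chart_form _ _ _) /chart_form hB.
Qed.

End Jets.

Section DzsSign.
Variables (R : realType) (n : nat).
Local Notation C := (cplx R).
Local Notation A := (extalg R n).
Implicit Types (s : seq 'I_n).

Lemma dzs_uniqE s : uniq s -> exists e : bool,
  dzs R s = (-1) ^+ e *: dzs R (enum [set i in s]%SET).
Proof.
elim: s => [_|j s IHs /= /andP[js us]].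
  exists false; rewrite expr0 scale1r; congr dzs; apply/esym/eqP.
  by rewrite -size_eq0 -cardE; apply/eqP/eq_card0 => i; rewrite inE.
have [e es] := IHs us.
have jK : j \notin [set i in s]%SET by rewrite inE.
have [s1 [s2 [e1 e2]]] := enum_setU1 jK.
exists (odd (size s1) (+) e); rewrite dzs_cons es -scalerAr e2.
rewrite [X in _ *: X](lprod_insert (@dz_homog R n)) -e1 -set_cons scalerA.
by rewrite -[in X in _ * X]signr_odd -signr_addb addbC.
Qed.

Lemma dzs_coef s (I : {set 'I_n}) : dzs R s I != 0 -> I = [set i in s]%SET.
Proof.
have [us|us] := boolP (uniq s); last by rewrite dzs_notuniq // ffunE eqxx.
have [e ->] := dzs_uniqE us; rewrite ext_scaleE dzs_enum ffunE.
by case: (I =P [set i in s]%SET) => // _; rewrite mulr0 eqxx.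
Qed.

Lemma ext_dzs_scale s (a : A) : uniq s ->
  (forall I : {set 'I_n}, I != [set i in s]%SET -> a I = 0) ->
  exists c : C, a = c *: dzs R s.
Proof.
move=> us ha; have [e es] := dzs_uniqE us.
exists ((-1) ^+ e * a [set i in s]%SET); rewrite es scalerA mulrAC -expr2 sqrr_sign mul1r.
apply/ffunP => I; rewrite ext_scaleE dzs_enum ffunE.
by case: (eqVneq I [set i in s]%SET) => [->|/ha ->]; rewrite ?mulr1 ?mulr0.
Qed.

Lemma dzs_swap u v s : dzs R (u :: v :: s) = - dzs R (v :: u :: s).
Proof.
rewrite !dzs_cons !mulrA (ext_mulC (@dz_homog R n u) (@dz_homog R n v)).
by rewrite muln1 expr1 scaleN1r mulNr.
Qed.

Definition perm_pull (s : 'S_n) : 'M[C]_n := \matrix_(j, i) (j == s i)%:R.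

Lemma perm_pull_unit (s : 'S_n) : perm_pull s \in unitmx.
Proof.
have -> : perm_pull s = perm_mx (s^-1)%g.
  by apply/matrixP => j i; rewrite !mxE -[in RHS](inj_eq (@perm_inj _ s)) permKV.
exact: unitmx_perm.
Qed.

Lemma perm_pull_dzs (s : 'S_n) (t : seq 'I_n) :
  pull (perm_pull s) (dzs R t) = dzs R (map s t).
Proof.
rewrite pull_dzs /dzs big_map; apply: eq_bigr => i _.
rewrite /pull1 (bigD1 (s i)) //= mxE eqxx scale1r big1 ?addr0 // => j /negbTE js.
by rewrite mxE js scale0r.
Qed.

Lemma diag_pull_dzs (t : 'rV[C]_n) (s : seq 'I_n) :
  pull (diag_mx t) (dzs R s) = (\prod_(i <- s) t 0 i) *: dzs R s.
Proof.
rewrite pull_dzs; elim: s => [|j s IHs]; first by rewrite /dzs !big_nil scale1r.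
rewrite !big_cons dzs_cons IHs /pull1 (bigD1 j) //= mxE eqxx mulr1n big1 ?addr0.
  by rewrite -scalerAl -scalerAr scalerA.
by move=> i /negbTE ij; rewrite mxE ij mulr0n scale0r.
Qed.

Lemma pull_diag_coef (t : 'rV[C]_n) (a : A) I :
  pull (diag_mx t) a I = (\prod_(i in I) t 0 i) * a I.
Proof.
rewrite {1}[a]ext_expand linear_sum ext_sumE (bigD1 I) //= linearZ /=.
rewrite ext_scaleE diag_pull_dzs ext_scaleE dzs_enum ffunE eqxx mulr1 mulrC.
rewrite big_enum [X in _ + X]big1 ?addr0 // => K KI.
rewrite linearZ /= ext_scaleE diag_pull_dzs ext_scaleE dzs_enum ffunE.
by rewrite eq_sym (negbTE KI) !mulr0.
Qed.

(* The complement of [t] is matched with that of [t'] to extend [t -> t'] to a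
   permutation. *)
Lemma perm_extend (T : finType) (t t' : seq T) : uniq t -> uniq t' ->
  size t = size t' -> exists s : {perm T}, map s t = t'.
Proof.
move=> ut ut' st.
pose u := t ++ [seq x <- enum T | x \notin t].
pose u' := t' ++ [seq x <- enum T | x \notin t'].
have uniqu (w : seq T) : uniq w -> uniq (w ++ [seq x <- enum T | x \notin w]).
  move=> uw; rewrite cat_uniq uw filter_uniq ?enum_uniq //= andbT.
  by apply/hasPn => x; rewrite mem_filter => /andP[].
have memu (w : seq T) x : x \in w ++ [seq x <- enum T | x \notin w].
  by rewrite mem_cat mem_filter mem_enum andbT orbN.
have sizeu (w : seq T) : uniq w -> size (w ++ [seq x <- enum T | x \notin w]) = #|T|.
  move=> uw; rewrite -(card_uniqP (uniqu w uw)).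
  by apply: eq_card => x; rewrite memu.
pose f x := nth x u' (index x u).
have f_inj : injective f.
  move=> x y; rewrite /f (set_nth_default x y); last first.
    by rewrite /u' sizeu // -(sizeu t ut) index_mem memu.
  move/eqP; rewrite nth_uniq ?uniqu // /u' ?sizeu // -?(sizeu t ut) ?index_mem ?memu //.
  by move/eqP/(congr1 (nth x u)); rewrite !nth_index ?memu.
exists (perm f_inj); case: t t' ut ut' st @u @u' @f f_inj {uniqu memu sizeu} => [|x0 t].
  by case.
move=> t' ut ut' st u u' f f_inj; apply: (@eq_from_nth _ x0); first by rewrite size_map.
move=> i; rewrite size_map => it; rewrite (nth_map x0) // permE /f /u index_cat.
rewrite mem_nth // index_uniq // /u' nth_cat -st it.
by apply: set_nth_default; rewrite -st.
Qed.

End DzsSign.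

(** * Covariance under diagonal and permutation matrices *)

Section Equivariance.
Variables (R : realType) (n : nat) (X : cmanifold R n).
Variables (m : nat) (p : 'I_m -> nat) (r q : nat) (P : natural_operator X p r q).
Local Notation C := (cplx R).
Local Notation J := (jet_index n p r).
Implicit Types (x : X) (k : J) (a : J -> C) (I : {set 'I_n}).

(** The multiplicity of [j] in the multiset K + alpha, which is the exponent with which scaling the
    j-th coordinate acts on the coefficient. *)
Definition jweight k (j : 'I_n) : nat := ((j \in jset k) + jexp k j)%N.

Lemma jet_op_torus x (t : 'rV[C]_n) a I : (forall j, t 0 j != 0) ->
  jet_op P x (fun k => (\prod_j t 0 j ^+ jweight k j) * a k) I =
  (\prod_(i in I) t 0 i) * jet_op P x a I.
Proof.
move=> t0; rewrite -pull_diag_coef.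
suff -> : jet_op P x (fun k => (\prod_j t 0 j ^+ jweight k j) * a k) =
  pull (diag_mx t) (jet_op P x a) by [].
apply: jet_op_natural => [|i z].
  rewrite unitmxE det_diag unitfE; apply/prodf_neq0 => j _; exact: t0.
rewrite !jet_polyE linear_sum; apply: eq_bigr => k _.
rewrite linearZ /= diag_pull_dzs scalerA; congr (_ *: _).
have -> : \prod_j t 0 j ^+ jweight k j =
    (\prod_j t 0 j ^+ jexp k j) * \prod_(j <- enum (jset k)) t 0 j.
  rewrite big_enum [X in _ * X]big_mkcond -big_split /=; apply: eq_bigr => j _.
  by rewrite /jweight addnC exprD; case: (j \in jset k); rewrite ?expr1 ?expr0.
suff -> : dmono (jexp k) (cmap (chart_at x) x)
     (affine (cmap (chart_at x) x) (cmap (chart_at x) x) (diag_mx t) z) =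
   (\prod_j t 0 j ^+ jexp k j) * dmono (jexp k) (cmap (chart_at x) x) z by ring.
rewrite /dmono -big_split /=; apply: eq_bigr => j _; rewrite mulrA; congr (_ / _).
rewrite -exprMn; congr (_ ^+ _); rewrite /affine mul_mx_diag !mxE.
by rewrite addrAC subrr add0r mulrC.
Qed.

(** The jet that is the sum of the unit vectors of a word, with multiplicities, so that it makes
    sense for words with repetitions. *)
Definition jcount l (ks : 'I_l -> J) k : C := \sum_j (ks j == k)%:R.

(** The enumerations are matched in order, so that [s] carries dz_K to dz_K' without a sign. *)
Definition jperm (s : 'S_n) k k' : Prop := [/\ jcomp k' = jcomp k,
  enum (jset k') = map s (enum (jset k)) & forall j, jexp k' (s j) = jexp k j].

Lemma jet_poly_count b l (ks : 'I_l -> J) i z : jet_poly b (jcount ks) i z =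
  \sum_(j | jcomp (ks j) == i) dmono (jexp (ks j)) b z *: dzs R (enum (jset (ks j))).
Proof.
rewrite jet_polyE /jcount.
under eq_bigr do rewrite mulr_suml scaler_suml.
rewrite exchange_big [RHS]big_mkcond /=; apply: eq_bigr => j _.
rewrite big_mkcond (bigD1 (ks j)) //= eqxx mul1r big1 ?addr0 // => k kj.
by rewrite [ks j == k]eq_sym (negbTE kj) mul0r scale0r; case: ifP.
Qed.

(** The points [x] and [x'] may differ; this is the source of constants independent of the point. *)
Lemma jet_op_perm x x' (s : 'S_n) l (ks ks' : 'I_l -> J) :
  (forall j, jperm s (ks j) (ks' j)) ->
  jet_op P x' (jcount ks') = pull (perm_pull R s) (jet_op P x (jcount ks)).
Proof.
move=> hs; apply: jet_op_natural => [|i z]; first exact: perm_pull_unit.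
rewrite !jet_poly_count linear_sum; apply: eq_big => [j|j _].
  by have [-> _ _] := hs j.
have [_ eset eexp] := hs j.
rewrite linearZ /= perm_pull_dzs eset; congr (_ *: _).
rewrite /dmono [RHS](reindex_inj (@perm_inj _ s)); apply: eq_bigr => u _.
rewrite eexp; congr (_ ^+ _ / _); rewrite /affine !mxE addrAC subrr add0r.
rewrite (bigD1 (s u)) //= !mxE eqxx mulr1 big1 ?addr0 // => v /negbTE vu.
by rewrite !mxE vu mulr0.
Qed.

End Equivariance.

(** * Polynomial dependence on the jet *)

Section Expansion.
Variables (R : realType) (n : nat) (X : cmanifold R n).
Variables (m : nat) (p : 'I_m -> nat) (r q : nat) (P : natural_operator X p r q).
Hypothesis p_gt0 : forall i, (0 < p i)%N.
Local Notation C := (cplx R).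
Local Notation J := (jet_index n p r).
Implicit Types (x : X) (k : J) (a : J -> C) (I : {set 'I_n}).

Definition jdeg k : nat := (#|jset k| + \sum_j jexp k j)%N.

Lemma jdegE k : jdeg k = (\sum_j jweight k j)%N.
Proof.
rewrite /jdeg -sum1_card big_mkcond -big_split; apply: eq_bigr => j _.
by rewrite /jweight; case: (j \in jset k).
Qed.

Lemma jdeg_gt0 k : (0 < jdeg k)%N.
Proof. by rewrite /jdeg jset_card ltn_addr. Qed.

Lemma jet_op_dilation x a I (s : C) : s != 0 -> #|I| = q ->
  jet_op P x (fun k => s ^+ jdeg k * a k) I = s ^+ q * jet_op P x a I.
Proof.
move=> s0 Iq.
have -> : (fun k => s ^+ jdeg k * a k) =
    (fun k => (\prod_j (const_mx s : 'rV[C]_n) 0 j ^+ jweight k j) * a k).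
  apply: functional_extensionality_dep => k; rewrite jdegE expr_sum; congr (_ * _).
  by apply: eq_bigr => j _; rewrite mxE.
rewrite jet_op_torus => [|j]; last by rewrite mxE.
rewrite -[X in s ^+ X]Iq -prodr_const; congr (_ * _).
by apply: eq_bigr => j _; rewrite mxE.
Qed.

Lemma jet_op_polynomial x I : #|I| = q ->
  exists (T : finType) (c : T -> C) (e : T -> J -> nat),
    forall a, jet_op P x a I = \sum_t c t * \prod_k a k ^+ e t k.
Proof.
move=> Iq; have [g hg gE] := jet_op_holo P x I.
set b := cmap (chart_at x) x in hg gE.
have [c [rho [rho0 hc]]] := holo_weighted_homog hg.
(* The base coordinates get a dummy weight 1, to keep all weights positive, and displacement 0 in
   [u], so that scaling never moves the base point. *)
pose W (i : 'I_(n + #|{: J}|)) : nat :=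
  match fintype.split i with inl _ => 1%N | inr k => jdeg (enum_val k) end.
pose u a (i : 'I_(n + #|{: J}|)) : C :=
  match fintype.split i with inl _ => 0 | inr k => a (enum_val k) end.
have W0 i : (0 < W i)%N by rewrite /W; case: fintype.split => // k; exact: jdeg_gt0.
have uE a (s : C) : row_mx b 0 + \row_i (s ^+ W i * u a i) =
    row_mx b (\row_k (s ^+ jdeg (enum_val k) * a (enum_val k))).
  apply/rowP => i; rewrite !mxE /W /u; case: splitP => j _; rewrite ?mxE ?add0r //.
  by rewrite mulr0 addr0.
have uE1 a : row_mx b 0 + \row_i u a i = row_mx b (\row_k a (enum_val k)).
  have := uE a 1; rewrite (_ : \row_i (1 ^+ W i * u a i) = \row_i u a i); last first.
    by apply/rowP => i; rewrite !mxE expr1n mul1r.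
  move=> ->; congr row_mx; apply/rowP => i; by rewrite !mxE expr1n mul1r.
have gs a s : s != 0 -> g (row_mx b 0 + \row_i (s ^+ W i * u a i)) =
    s ^+ q * g (row_mx b 0 + \row_i u a i).
  move=> s0; rewrite uE uE1 -gE.
  have := jet_op_dilation x a s0 Iq; rewrite !gE => <-.
  by congr (g (row_mx _ _)); apply/rowP => i; rewrite !mxE.
have small a : (forall k, `|a k| < rho) -> jet_op P x a I =
    \sum_(al : {ffun 'I_(n + #|{: J}|) -> 'I_q.+1} | weight W (fun i => al i) == q)
       c [ffun i => al i : nat] * \prod_i u a i ^+ al i.
  move=> ha; rewrite gE -uE1; apply: hc => // [i|s s0].
    by rewrite /u; case: fintype.split => // _; rewrite normr0.
  by apply: gs; rewrite gt_eqF.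
have all a : jet_op P x a I =
    \sum_(al : {ffun 'I_(n + #|{: J}|) -> 'I_q.+1} | weight W (fun i => al i) == q)
       c [ffun i => al i : nat] * \prod_i u a i ^+ al i.
  (* The polynomial formula is known only in the polydisc of radius [rho]. The dilation by [s]
     brings [a] into it: s <= 1 gives s ^+ jdeg k <= s, and s * N < rho. Both sides are homogeneous
     of weight [q], so the factor [s ^+ q] cancels. *)
  pose N := \sum_k `|a k|; have N0 : 0 <= N by apply: sumr_ge0.
  have d0 : 0 < rho + (1 + N) by rewrite addr_gt0 // ltr_wpDr.
  pose s := rho / (rho + (1 + N)).
  have s0 : 0 < s by rewrite divr_gt0.
  have s1 : s <= 1 by rewrite ler_pdivrMr // mul1r lerDl addr_ge0.
  have sa k : `|s ^+ jdeg k * a k| < rho.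
    have ak : `|a k| <= N by rewrite /N (bigD1 k) //= lerDl sumr_ge0.
    rewrite normrM normrX (gtr0_norm s0); apply: (@le_lt_trans _ _ (s * N)).
      rewrite ler_pM ?exprn_ge0 ?(ltW s0) //.
      by rewrite -(prednK (jdeg_gt0 k)) exprS -[leRHS]mulr1 ler_wpM2l ?(ltW s0) // exprn_ile1 // ltW.
    rewrite /s mulrAC ltr_pdivrMr // ltr_pM2l //.
    by rewrite addrCA addrA addrC ltrDl addr_gt0.
  have := small _ sa; rewrite jet_op_dilation ?gt_eqF // => E.
  apply: (@mulfI _ (s ^+ q)); first by rewrite expf_neq0 // gt_eqF.
  rewrite E mulr_sumr; apply: eq_bigr => al /eqP wal.
  rewrite mulrCA; congr (_ * _); rewrite -[X in s ^+ X]wal /weight expr_sum -big_split /=.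
  apply: eq_bigr => i _; rewrite exprM -exprMn; congr (_ ^+ _).
  by rewrite /W /u; case: fintype.split => //= _; rewrite mulr0.
exists {ffun 'I_(n + #|{: J}|) -> 'I_q.+1}.
(* The factor [0 ^+ al (lshift _ i)] keeps exactly the monomials free of base coordinates, as 0 ^+ 0
   = 1. *)
exists (fun al : {ffun 'I_(n + #|{: J}|) -> 'I_q.+1} =>
  if weight W (fun i => al i) == q then
   c [ffun i => al i : nat] * \prod_(i < n) 0 ^+ al (lshift _ i) else 0).
exists (fun (al : {ffun 'I_(n + #|{: J}|) -> 'I_q.+1}) k =>
  al (rshift n (enum_rank k)) : nat).
move=> a; rewrite all big_mkcond; apply: eq_bigr => al _.
case: ifP => _; last by rewrite mul0r.
have uL i : u a (lshift #|{: J}| i) = 0.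
  by rewrite /u -[lshift _ i]/(unsplit (inl i)) unsplitK.
have uR k : u a (rshift n (enum_rank k)) = a k.
  by rewrite /u -[rshift n _]/(unsplit (inr (enum_rank k))) unsplitK enum_rankK.
rewrite -mulrA; congr (_ * _); rewrite big_split_ord /=; congr (_ * _).
  by apply: eq_bigr => i _; rewrite uL.
rewrite (reindex (@enum_rank J)) /=; last first.
  by exists enum_val => ? _; rewrite ?enum_rankK ?enum_valK.
by apply: eq_bigr => k _; rewrite uR.
Qed.

End Expansion.

(** * Expansion into square-free monomials *)

Lemma poly_punctured_eq0 (F : numFieldType) (p : {poly F}) :
  (forall s, s != 0 -> p.[s] = 0) -> p = 0.
Proof.
move=> hp; apply: (@roots_geq_poly_eq0 _ _ [seq i.+1%:R | i <- iota 0 (size p)]).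
- by apply/allP => _ /mapP[i _ ->]; apply/rootP/hp; rewrite pnatr_eq0.
- rewrite map_inj_uniq ?iota_uniq // => i j /eqP.
  by rewrite eqr_nat eqSS => /eqP.
- by rewrite size_map size_iota.
Qed.

Section SetExpansion.
Variables (R : realType) (n : nat) (X : cmanifold R n).
Variables (m : nat) (p : 'I_m -> nat) (r q : nat) (P : natural_operator X p r q).
Hypothesis p_gt0 : forall i, (0 < p i)%N.
Local Notation C := (cplx R).
Local Notation J := (jet_index n p r).
Implicit Types (x : X) (k : J) (a : J -> C) (I : {set 'I_n}) (S : {set J}).

(** Scaling the single coordinate [j] by [s] gives an identity between polynomials in [s]; comparing
    the coefficients of degree [j \in I] discards all monomials of another degree in [j]. *)
Lemma jet_op_refine x I (T : finType) (c : T -> C) (e : T -> J -> nat) (Q : pred T) j :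
  (forall a, jet_op P x a I = \sum_(t | Q t) c t * \prod_k a k ^+ e t k) ->
  forall a, jet_op P x a I =
    \sum_(t | Q t && (\sum_k jweight k j * e t k == (j \in I))%N)
      c t * \prod_k a k ^+ e t k.
Proof.
move=> hF a.
pose w t := (\sum_k jweight k j * e t k)%N.
pose f : {poly C} := \sum_(t | Q t) (c t * \prod_k a k ^+ e t k) *: 'X^(w t) -
  jet_op P x a I *: 'X^(j \in I).
have f0 : f = 0.
  apply: poly_punctured_eq0 => s s0.
  rewrite hornerD hornerN horner_sum hornerZ hornerXn.
  pose v : 'rV[C]_n := \row_i (if i == j then s else 1).
  have v0 i : v 0 i != 0 by rewrite mxE; case: ifP => // _; rewrite oner_eq0.
  have := jet_op_torus P x a I v0.
  have -> : \prod_(i in I) v 0 i = s ^+ (j \in I).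
    rewrite big_mkcond (bigD1 j) //= mxE eqxx big1 ?mulr1 => [|i /negbTE ij].
      by case: (j \in I).
    by rewrite mxE ij; case: ifP.
  have vk k : \prod_i v 0 i ^+ jweight k i = s ^+ jweight k j.
    rewrite (bigD1 j) //= mxE eqxx big1 ?mulr1 // => i /negbTE ij.
    by rewrite mxE ij expr1n.
  rewrite hF mulrC => <-; apply/eqP; rewrite subr_eq0; apply/eqP.
  apply: eq_bigr => t _; rewrite hornerZ hornerXn -mulrA; congr (_ * _).
  rewrite /w expr_sum -big_split /=; apply: eq_bigr => k _.
  by rewrite vk exprMn exprM mulrC.
have := congr1 (fun f : {poly C} => f`_(j \in I)) f0.
rewrite coefB coef0 coef_sum coefZ coefXn eqxx mulr1 => /eqP.
rewrite subr_eq0 => /eqP <-; rewrite [RHS]big_mkcondr; apply: eq_bigr => t _.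
rewrite coefZ coefXn eq_sym /w; case: eqP => _; first by rewrite mulr1.
by rewrite mulr0.
Qed.

(* The multisets of indices K + alpha of the elements of [S] partition [I]. *)
Definition tiles S I := [forall j, (\sum_(k in S) jweight k j == (j \in I))%N].

Definition jind S k : C := (k \in S)%:R.

Lemma jweight_gt0 k : exists j, (0 < jweight k j)%N.
Proof.
have /card_gt0P[j jk] : (0 < #|jset k|)%N by rewrite jset_card.
by exists j; rewrite /jweight jk.
Qed.

(** Every jet index has positive weight at some [j], so removing one from a tiling leaves part of
    [I] uncovered. *)
Lemma tiles_sub S S' I : tiles S I -> tiles S' I -> S' \subset S -> S' = S.
Proof.
move=> /forallP tS /forallP tS' sS; apply/eqP; rewrite finset.eqEsubset sS /=.
apply/fintype.subsetP => k kS; apply: contraT => kS'.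
have [j] := jweight_gt0 k; have := tS j; rewrite -(eqP (tS' j)).
rewrite (bigID (mem S')) /= (eq_bigl (mem S')) => [|i]; last first.
  by apply: andb_idl => /(fintype.subsetP sS).
rewrite -[X in _ == X]addn0 eqn_add2l (bigD1 k) ?kS //=.
by rewrite addn_eq0 => /andP[/eqP ->].
Qed.

(** Refining over all coordinates leaves square-free monomials supported on tilings of [I]. Distinct
    tilings are incomparable, so the indicator of [S] kills every monomial but its own and the
    coefficient is the value of the operator there. *)
Lemma jet_op_set_expansion x a I : #|I| = q ->
  jet_op P x a I = \sum_(S | tiles S I) jet_op P x (jind S) I * \prod_(k in S) a k.
Proof.
move=> Iq; have [T [c [e hF]]] := jet_op_polynomial P p_gt0 x Iq.
pose Q (s : seq 'I_n) t := all (fun j => \sum_k jweight k j * e t k == (j \in I))%N s.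
have hQ s b : jet_op P x b I = \sum_(t | Q s t) c t * \prod_k b k ^+ e t k.
  elim: s b => [|j s IHs] b; first exact: hF.
  rewrite (jet_op_refine j IHs); apply: eq_bigl => t.
  by rewrite /Q /= andbC.
pose supp t := [set k | e t k != 0%N].
have hQT t : Q (enum 'I_n) t -> (forall k, (e t k <= 1)%N) /\ tiles (supp t) I.
  move=> /allP Qt; have wt j : (\sum_k jweight k j * e t k == (j \in I))%N.
    by apply: Qt; rewrite mem_enum.
  have e1 k : (e t k <= 1)%N.
    have [j kj] := jweight_gt0 k.
    (* At an index [j] occurring in [k], the exponent of [k] is bounded by the total weight, which
       is 0 or 1. *)
    apply: (@leq_trans (\sum_k jweight k j * e t k)); last by rewrite (eqP (wt j)) leq_b1.
    by rewrite (bigD1 k) //= (leq_trans (leq_pmull _ kj)) ?leq_addr.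
  split=> //; apply/forallP => j; rewrite -(eqP (wt j)) big_mkcond.
  apply/eqP; apply: eq_bigr => k _; rewrite inE.
  by case: (e t k) (e1 k) => [|[|]] //; rewrite ?muln0 ?muln1.
pose d S := \sum_(t | Q (enum 'I_n) t && (supp t == S)) c t.
have hd b : jet_op P x b I = \sum_(S | tiles S I) d S * \prod_(k in S) b k.
  rewrite (hQ (enum 'I_n)) (partition_big supp (tiles ^~ I)) => [|t /hQT[]//].
  apply: eq_bigr => S _; rewrite mulr_suml; apply: eq_bigr => t /andP[Qt /eqP <-].
  congr (_ * _); rewrite [RHS]big_mkcond; apply: eq_bigr => k _; rewrite inE.
  by have [/(_ k) + _] := hQT t Qt; case: (e t k) => [|[|]].
rewrite hd; apply: eq_bigr => S tS; congr (_ * _); rewrite hd (bigD1 S) //=.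
rewrite /jind big1 ?mulr1 => [|k ->//]; rewrite big1 ?addr0 // => S' /andP[tS' nS].
have /fintype.subsetPn[k kS' kS] : ~~ (S' \subset S).
  by apply: contra nS => /(tiles_sub tS tS') ->.
by rewrite (bigD1 k) //= (negbTE kS) mul0r mulr0.
Qed.

Lemma jet_op_support x S I : jet_op P x (jind S) I != 0 ->
  #|I| = q /\ exists2 S', tiles S' I & S' \subset S.
Proof.
move=> nz; have Iq : #|I| = q.
  by apply/eqP; apply: contraNT nz => /(@jet_op_homog _ _ _ _ _ _ _ P x (jind S)) ->.
split=> //; apply: contrapT => H; move/eqP: nz; apply.
rewrite jet_op_set_expansion // big1 // => S' tS'.
have /fintype.subsetPn[k kS' kS] : ~~ (S' \subset S).
  by apply/negP => sS; apply: H; exists S'.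
by rewrite (bigD1 k kS') /= /jind (negbTE kS) mul0r mulr0.
Qed.

End SetExpansion.

(** * Words of jet indices and their coefficients *)

Section Words.
Variables (R : realType) (n : nat) (X : cmanifold R n).
Variables (m : nat) (p : 'I_m -> nat) (r q : nat) (P : natural_operator X p r q).
Hypothesis p_gt0 : forall i, (0 < p i)%N.
Local Notation C := (cplx R).
Local Notation A := (extalg R n).
Local Notation J := (jet_index n p r).
Local Notation V := ('I_m * 'I_2)%type.
Implicit Types (x : X) (k : J) (a : J -> C) (I : {set 'I_n}) (S : {set J}).

Definition jlist k : seq 'I_n := flatten [seq nseq (jexp k j) j | j <- enum 'I_n].
(** The derivative indices come first, as in the term dz_j /\ dz_K of the exterior derivative. *)
Definition jblock k := jlist k ++ enum (jset k).

Lemma count_jlist k j : count_mem j (jlist k) = jexp k j.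
Proof.
rewrite count_flatten -map_comp sumnE big_map big_enum (bigD1 j) //=.
rewrite count_nseq /= eqxx mul1n big1 ?addn0 // => i ij.
by rewrite count_nseq /= (negbTE ij).
Qed.

Lemma size_jlist k : size (jlist k) = (\sum_j jexp k j)%N.
Proof.
rewrite size_flatten /shape -map_comp sumnE big_map big_enum.
by apply: eq_bigr => j _; rewrite /= size_nseq.
Qed.

Lemma count_jblock k j : count_mem j (jblock k) = jweight k j.
Proof.
by rewrite count_cat count_jlist addnC count_uniq_mem ?enum_uniq // mem_enum.
Qed.

Lemma size_jblock k : size (jblock k) = jdeg k.
Proof. by rewrite size_cat size_jlist -cardE addnC. Qed.

Definition jflat l (ks : 'I_l -> J) : seq 'I_n :=
  flatten [seq jblock (ks i) | i <- index_enum 'I_l].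

Lemma count_jflat l (ks : 'I_l -> J) j :
  count_mem j (jflat ks) = (\sum_i jweight (ks i) j)%N.
Proof.
rewrite count_flatten -map_comp sumnE big_map.
by apply: eq_bigr => i _; rewrite /= count_jblock.
Qed.

Lemma size_jflat l (ks : 'I_l -> J) : size (jflat ks) = (\sum_i jdeg (ks i))%N.
Proof.
rewrite size_flatten /shape -map_comp sumnE big_map.
by apply: eq_bigr => i _; rewrite /= size_jblock.
Qed.

Lemma jflat_inj l (ks : 'I_l -> J) : uniq (jflat ks) -> injective ks.
Proof.
move=> u i i' e; apply: contraTeq u => ii'.
have [j kj] := jweight_gt0 p_gt0 (ks i); apply/negP => u.
have := count_uniq_mem j u; rewrite count_jflat (bigD1 i) //= (bigD1 i') 1?eq_sym //= -e.
by case: (jweight (ks i) j) kj => // w _; case: (j \in _); rewrite ?addSn ?addnS.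
Qed.

Lemma jcount_inj l (ks : 'I_l -> J) : injective ks ->
  jcount R ks = jind R (ks @: 'I_l)%SET.
Proof.
move=> ki; apply: functional_extensionality_dep => k; rewrite /jcount /jind.
case: imsetP => [[i _ ->]|nk].
  by rewrite (bigD1 i) //= eqxx big1 ?addr0 // => j ji; rewrite (inj_eq ki) (negbTE ji).
by rewrite big1 // => i _; case: eqP => // e; case: nk; exists i.
Qed.

(** The number of occurrences of [j] in the flattened word is its total weight, so tiling means that
    each letter occurs once and the letters form [I]. *)
Lemma tiles_jflat l (ks : 'I_l -> J) I : injective ks ->
  tiles (ks @: 'I_l)%SET I = uniq (jflat ks) && (I == [set j in jflat ks]%SET).
Proof.
move=> ki; have cE j : (\sum_(k in (ks @: 'I_l)%SET) jweight k j)%N = count_mem j (jflat ks).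
  by rewrite count_jflat big_imset //= => i i' _ _; exact: ki.
apply/forallP/andP => [H|[u /eqP ->] j]; last by rewrite cE count_uniq_mem // inE.
have H' j : count_mem j (jflat ks) = (j \in I) by rewrite -cE; apply/eqP.
have mI j : (j \in jflat ks) = (j \in I).
  by rewrite -has_pred1 has_count H'; case: (j \in I).
split; last by apply/eqP/setP => j; rewrite inE mI.
by apply: count_mem_uniq => j; rewrite H' mI.
Qed.

(** A nonzero coefficient at [I] requires a tiling of [I] by some members of the word. Thus [I]
    consists of letters of the word, and #|I| = q, the length of the word, leaves only the set of
    all letters. *)
Lemma jet_op_dzs x l (ks : 'I_l -> J) : uniq (jflat ks) -> size (jflat ks) = q ->
  exists c : C, jet_op P x (jcount R ks) = c *: dzs R (jflat ks).
Proof.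
move=> u sq; have ki := jflat_inj u; apply: ext_dzs_scale => // I nI.
rewrite jcount_inj //; apply/eqP; apply: contraNT nI => /(jet_op_support p_gt0) [Iq [S /forallP tS sS]].
have : tiles (ks @: 'I_l)%SET [set j in jflat ks]%SET by rewrite tiles_jflat // u eqxx.
move=> /forallP tks; rewrite finset.eqEcard; apply/andP; split; last first.
  by rewrite Iq -sq cardsE; exact: card_size.
apply/fintype.subsetP => j jI; have := tks j; have := tS j; rewrite jI => /eqP e.
rewrite (big_setID S) /= (finset.setIidPr sS) e.
by case: (j \in _).
Qed.

Definition low k := (\sum_j jexp k j <= 1)%N.

(* The variable u_i or v_i to which [k] contributes, if [low k]. *)
Definition jtype k : V := (jcomp k, if (\sum_j jexp k j == 0)%N then ord0 else ord_max).

Lemma jtype_sum k k' : low k -> low k' -> jtype k = jtype k' ->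
  jcomp k = jcomp k' /\ (\sum_j jexp k j = \sum_j jexp k' j)%N.
Proof.
rewrite /low /jtype => lk lk' [-> e]; split=> //; move: lk lk' e.
by case: (\sum_j jexp k j)%N => [|[|]] //; case: (\sum_j jexp k' j)%N => [|[|]].
Qed.

Lemma jdeg_type k : low k -> jdeg k = uv_deg p (jtype k).
Proof.
rewrite /low /jdeg /uv_deg /= jset_card => lk; congr (_ + _)%N; move: lk.
by case: (\sum_j jexp k j)%N => [|[|]].
Qed.

Lemma jblock_perm (s : 'S_n) k k' : jcomp k = jcomp k' ->
  (\sum_j jexp k j = \sum_j jexp k' j)%N -> map s (jblock k) = jblock k' -> jperm s k k'.
Proof.
move=> ec es /eqP; rewrite map_cat eqseq_cat; last by rewrite size_map !size_jlist.
case/andP => /eqP el /eqP ei; split=> // j.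
rewrite -count_jlist -el count_map -count_jlist; apply: eq_count => i /=.
exact: (inj_eq (@perm_inj _ s)).
Qed.

(** Repetition-free words of equal length are matched by a permutation letter by letter. Equal types
    give blocks of equal lengths, so the matching is also block by block. *)
Lemma jflat_perm l (ks ks' : 'I_l -> J) : uniq (jflat ks) -> uniq (jflat ks') ->
  (forall i, low (ks i)) -> (forall i, low (ks' i)) ->
  (forall i, jtype (ks i) = jtype (ks' i)) ->
  exists s : 'S_n, map s (jflat ks) = jflat ks' /\ forall i, jperm s (ks i) (ks' i).
Proof.
move=> u u' lk lk' ty.
have e i := jtype_sum (lk i) (lk' i) (ty i).
have de i : jdeg (ks i) = jdeg (ks' i).
  by have [e1 e2] := e i; rewrite /jdeg !jset_card e1 e2.
have [|s es] := perm_extend u u'.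
  by rewrite !size_jflat; apply: eq_bigr => i _.
exists s; split=> // i; have [e1 e2] := e i; apply: jblock_perm => //.
move: es; rewrite map_flatten -map_comp => /eq_from_flatten_shape H.
have : [seq (map s \o (fun i => jblock (ks i))) i | i <- index_enum 'I_l] =
   [seq jblock (ks' i) | i <- index_enum 'I_l].
  apply: H; rewrite /shape -!map_comp; apply: eq_map => j /=.
  by rewrite size_map !size_jblock.
by move/eq_in_map => /(_ i (mem_index_enum i)).
Qed.

(** The constant is read off from one word at one point; [jflat_perm] and [jet_op_perm] carry it to
    every other word of the same types, at any point. *)
Lemma word_coef_exists l (y : 'I_l -> V) : exists c : C, forall x (ks : 'I_l -> J),
  (forall i, low (ks i)) -> (forall i, jtype (ks i) = y i) -> uniq (jflat ks) ->
  size (jflat ks) = q -> jet_op P x (jcount R ks) = c *: dzs R (jflat ks).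
Proof.
have [[x0 [ks0 [l0 t0 u0 s0]]]|H] := pselect (exists x (ks : 'I_l -> J),
  [/\ forall i, low (ks i), forall i, jtype (ks i) = y i, uniq (jflat ks) &
  size (jflat ks) = q]); last first.
  by exists 0 => x ks lk tk uk sk; case: H; exists x, ks.
have [c hc] := jet_op_dzs x0 u0 s0; exists c => x ks lk tk uk sk.
have [|s [es js]] := jflat_perm u0 uk l0 lk; first by move=> i; rewrite t0 tk.
by rewrite (jet_op_perm P x0 x js) hc linearZ /= perm_pull_dzs es.
Qed.

(* Arbitrary if no word of type [y] has disjoint blocks. *)
Definition word_coef l (y : 'I_l -> V) : C := projT1 (cid (word_coef_exists y)).

Lemma word_coefE x l (ks : 'I_l -> J) : (forall i, low (ks i)) ->
  uniq (jflat ks) -> size (jflat ks) = q ->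
  jet_op P x (jcount R ks) = word_coef (jtype \o ks) *: dzs R (jflat ks).
Proof.
move=> lk uk sk; rewrite /word_coef; case: cid => c /= H; exact: H.
Qed.

(* A transposition of two indices of the same derivative fixes the jet but
   reverses the sign of the form. *)
Lemma jet_op_high x l (ks : 'I_l -> J) i0 : ~~ low (ks i0) ->
  uniq (jflat ks) -> size (jflat ks) = q -> jet_op P x (jcount R ks) = 0.
Proof.
move=> hi u sq; have [c hc] := jet_op_dzs x u sq.
have usub i : subseq (jblock (ks i)) (jflat ks).
  rewrite /jflat; elim: (index_enum 'I_l) (mem_index_enum i) => //= j s IHs.
  rewrite inE => /orP[/eqP <-|/IHs]; first exact: prefix_subseq.
  by move/subseq_trans; apply; exact: suffix_subseq.
have [v [w [t ev]]] : exists v w t, jlist (ks i0) = v :: w :: t.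
  by move: hi; rewrite /low -size_jlist; case: (jlist _) => [|v [|w t]] // _; exists v, w, t.
have ub := subseq_uniq (usub i0) u.
have vw : v != w by move: ub; rewrite /jblock ev /= inE negb_or => /andP[/andP[]].
have c1 i j : (jweight (ks i) j <= 1)%N.
  by rewrite -count_jblock count_uniq_mem ?(subseq_uniq (usub i)) // leq_b1.
have cv : (jexp (ks i0) v = 1 /\ jexp (ks i0) w = 1)%N.
  have := c1 i0 v; have := c1 i0 w; rewrite /jweight -!count_jlist ev /= !eqxx.
  rewrite [w == v]eq_sym (negbTE vw) add0n add1n => h1 h2.
  by split; lia.
have fl j : (\sum_i jweight (ks i) j <= 1)%N.
  by rewrite -count_jflat count_uniq_mem // leq_b1.
(* Block [i0] uses up [v] and [w], and uses them as derivative indices. All other blocks and all the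
   sets K avoid them, so the transposition fixes every member of the word. *)
have w0 i j : i != i0 -> j = v \/ j = w -> jweight (ks i) j = 0%N.
  move=> ii jvw; have := fl j; rewrite (bigD1 i0) //= (bigD1 i) //=.
  have : (0 < jweight (ks i0) j)%N by case: cv => e1 e2; case: jvw => ->; rewrite /jweight ?e1 ?e2 addn1.
  lia.
have inset i j : j = v \/ j = w -> j \notin jset (ks i).
  move=> jvw; case: (eqVneq i i0) => [->|ii]; last first.
    by have := w0 i j ii jvw; rewrite /jweight; case: (j \in _).
  have := c1 i0 j; case: cv => e1 e2; case: jvw => ->; rewrite /jweight ?e1 ?e2 addn1;
  by case: (_ \in _).
have eq_exp i : jexp (ks i) v = jexp (ks i) w.
  case: (eqVneq i i0) => [->|ii]; first by case: cv => -> ->.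
  have := w0 i v ii (or_introl erefl); have := w0 i w ii (or_intror erefl).
  rewrite /jweight; lia.
have jp i : jperm (tperm v w) (ks i) (ks i).
  split=> // [|j].
    rewrite -[LHS]map_id; apply/eq_in_map => j; rewrite mem_enum => jk.
    rewrite /= tpermD //; apply: contraTneq jk => <-; apply: inset; by [left|right].
  by case: tpermP => [->|->|//]; rewrite eq_exp.
have := jet_op_perm P x x jp; rewrite hc linearZ /= perm_pull_dzs.
have vf : v \in jflat ks by rewrite (mem_subseq (usub i0)) // mem_cat ev inE eqxx.
have wf : w \in jflat ks by rewrite (mem_subseq (usub i0)) // mem_cat ev !inE eqxx orbT.
suff -> : dzs R (map (tperm v w) (jflat ks)) = - dzs R (jflat ks).
  by rewrite scalerN => /ext_self_opp_eq0.
(* Moving [v] and [w] to the front changes the product by a sign only, and there the transposition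
   is a swap of adjacent factors. *)
pose s := [seq j <- jflat ks | (j != v) && (j != w)].
have pk : perm_eq (jflat ks) (v :: w :: s).
  apply: uniq_perm => //.
    by rewrite /= !inE !mem_filter !eqxx /= andbF (negbTE vw) /= filter_uniq.
  move=> j; rewrite !inE mem_filter; case: eqP => [->|_] //=; case: eqP => [->|_] //=.
have [e es] : exists e : bool, dzs R (jflat ks) = (-1) ^+ e *: dzs R (v :: w :: s).
  have us : uniq (v :: w :: s) by rewrite -(perm_uniq pk).
  have [e1 h1] := dzs_uniqE R u; have [e2 h2] := dzs_uniqE R us.
  exists (e1 (+) e2); rewrite h1 h2 signr_addb -scalerA; congr (_ *: _).
  rewrite scalerA -expr2 sqrr_sign scale1r.
  suff -> : [set j in jflat ks]%SET = [set j in v :: w :: s]%SET by [].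
  by apply/setP => j; rewrite !inE (perm_mem pk) !inE.
rewrite -perm_pull_dzs es linearZ /= perm_pull_dzs /= tpermL tpermR -scalerN.
congr (_ *: _); rewrite dzs_swap; congr (- dzs R (_ :: _ :: _)).
rewrite -[RHS]map_id; apply/eq_in_map => j; rewrite mem_filter => /andP[/andP[jv jw] _].
by rewrite /= tpermD // eq_sym.
Qed.

(** The form dz_alpha /\ dz_K. The value 0 beyond first order lets sums run over all jet indices. *)
Definition theta k : A := if low k then dzs R (jblock k) else 0.

Lemma prod_theta l (ks : 'I_l -> J) : (forall i, low (ks i)) ->
  \prod_i theta (ks i) = dzs R (jflat ks).
Proof.
move=> lk; rewrite /jflat; elim: (index_enum 'I_l) => [|i s IHs].
  by rewrite big_nil /dzs big_nil.
by rewrite big_cons IHs /= dzs_cat /theta lk.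
Qed.

Lemma prod_theta_high l (ks : 'I_l -> J) i : ~~ low (ks i) ->
  \prod_i theta (ks i) = 0 :> A.
Proof.
by move=> hi; apply: prod_mem_eq0 (mem_index_enum i) _; rewrite /theta (negbTE hi).
Qed.

End Words.

(** A set with [l] elements is the image of exactly l! injections from ['I_l]. *)
Lemma sum_inj_ffuns (T : finType) (V : zmodType) (h : {set T} -> V) l :
  \sum_(f : {ffun 'I_l -> T} | injectiveb f) h (f @: 'I_l)%SET =
  (\sum_(S : {set T} | #|S| == l) h S) *+ l`!.
Proof.
rewrite (partition_big (fun f : {ffun 'I_l -> T} => (f @: 'I_l)%SET) (fun S => #|S| == l)) /=.
  rewrite -sumrMnl; apply: eq_bigr => S /eqP Sl.
  rewrite (eq_bigr (fun=> h S)) => [|f /andP[_ /eqP->]//].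
  rewrite sumr_const; congr (_ *+ _).
  have := @card_inj_ffuns_on 'I_l T (mem S); rewrite Sl card_ord ffactnn => <-.
  apply: eq_card => f; rewrite !inE [RHS]andbC; apply: andb_id2l => /injectiveP fi.
  apply/eqP/ffun_onP => [<- i|fS]; first exact: imset_f.
  apply/eqP; rewrite finset.eqEcard card_imset // card_ord Sl leqnn andbT.
  by apply/fintype.subsetP => _ /imsetP[i _ ->].
by move=> f /injectiveP fi; rewrite card_imset // card_ord.
Qed.

Section WordExpansion.
Variables (R : realType) (n : nat) (X : cmanifold R n).
Variables (m : nat) (p : 'I_m -> nat) (r q : nat) (P : natural_operator X p r q).
Hypothesis p_gt0 : forall i, (0 < p i)%N.
Local Notation C := (cplx R).
Local Notation A := (extalg R n).
Local Notation J := (jet_index n p r).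
Local Notation V := ('I_m * 'I_2)%type.
Implicit Types (x : X) (k : J) (a : J -> C) (I : {set 'I_n}) (S : {set J}).

Lemma tiles_card S I : tiles S I -> (#|S| <= #|I|)%N.
Proof.
move=> /forallP tS; rewrite -!sum1_card [leqRHS]big_mkcond.
rewrite (eq_bigr (fun j => \sum_(k in S) jweight k j)%N); last first.
  by move=> j _; rewrite (eqP (tS j)); case: (j \in I).
rewrite exchange_big /=; apply: leq_sum => k _.
by rewrite -jdegE jdeg_gt0.
Qed.

(** Each tiling is counted once for each of its l! orderings. Its members have positive weight, so
    there are at most [q] of them, which bounds [l]. *)
Lemma jet_op_words x a : jet_op P x a = \sum_(l < q.+1) (l`!%:R)^-1 *:
  \sum_(ks : {ffun 'I_l -> J} | uniq (jflat ks) && (size (jflat ks) == q))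
    (\prod_i a (ks i)) *: jet_op P x (jcount R ks).
Proof.
apply/ffunP => I; rewrite ext_sumE.
have [Iq|Iq] := eqVneq #|I| q; last first.
  rewrite (@jet_op_homog _ _ _ _ _ _ _ P) // big1 // => l _.
  rewrite ext_scaleE ext_sumE big1 ?mulr0 // => ks _.
  by rewrite ext_scaleE (@jet_op_homog _ _ _ _ _ _ _ P) // mulr0.
pose h S := if tiles S I then jet_op P x (jind R S) I * \prod_(k in S) a k else 0.
rewrite (jet_op_set_expansion P p_gt0) // big_mkcond -/h.
have hl (l : 'I_q.+1) : (l`!%:R^-1 *: \sum_(ks : {ffun 'I_l -> J} | uniq (jflat ks) && (size (jflat ks) == q))
    (\prod_i a (ks i)) *: jet_op P x (jcount R ks)) I = \sum_(S : {set J} | #|S| == l) h S.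
  rewrite ext_scaleE; apply: (@mulfI _ (l`!%:R)).
    by rewrite pnatr_eq0 -lt0n fact_gt0.
  rewrite mulVKf ?pnatr_eq0 -?lt0n ?fact_gt0 // mulr_natl -sum_inj_ffuns ext_sumE.
  rewrite big_mkcond [RHS]big_mkcond; apply: eq_bigr => ks _.
  have [/injectiveP ki|ki] := boolP (injectiveb ks); last first.
    case: ifP => // /andP[u _]; case/negP: ki; apply/injectiveP.
    exact: (jflat_inj p_gt0 u).
  have hks : jcount R ks = jind R (ks @: 'I_l)%SET by exact: jcount_inj.
  rewrite /h tiles_jflat //; have [u|] := boolP (uniq (jflat ks)); rewrite //=.
  have [eI|nI] := eqVneq I [set j in jflat ks]%SET.
    have -> : size (jflat ks) == q by apply/eqP; apply: etrans _ Iq; rewrite eI cardsE (card_uniqP u).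
    rewrite ext_scaleE mulrC hks; congr (_ * _).
    by rewrite big_imset //= => i j _ _; exact: ki.
  (* A word whose letters do not form [I] contributes nothing at [I]. *)
  case: eqP => // sq; have [c ->] := jet_op_dzs P p_gt0 x u sq.
  rewrite !ext_scaleE; have [->|/dzs_coef eI] := eqVneq (dzs R (jflat ks) I) 0.
    by rewrite !mulr0.
  by rewrite eI eqxx in nI.
rewrite (eq_bigr _ (fun l _ => hl l)) (bigID (fun S => #|S| <= q)%N) /=.
rewrite [X in _ + X]big1 ?addr0 => [|S]; last first.
  rewrite /h -ltnNge; case: ifP => // /tiles_card; rewrite Iq.
  by rewrite leqNgt => /negbTE ->.
rewrite (partition_big (fun S : {set J} => inord #|S| : 'I_q.+1) predT) //=.
apply: eq_bigr => l _; apply: eq_bigl => S; rewrite -val_eqE /=.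
apply/andP/eqP => [[Sq /eqP <-]|->]; first by rewrite inordK.
by rewrite -ltnS ltn_ord inord_val.
Qed.

(** The form to be substituted for the variable [v], in terms of jet coefficients. For r = 0 and a
    variable v_i the sum is empty. *)
Definition tvar a (v : V) : A := \sum_(k | jtype k == v) a k *: theta R k.

(** The coefficient of a word depends on the types of its members only, so the sum over the words of
    given types is a product of sums, one for each letter. *)
Lemma jet_op_word_polynomial x a : jet_op P x a = \sum_(l < q.+1)
  \sum_(y : {ffun 'I_l -> V} | (\sum_i uv_deg p (y i) == q)%N)
    (word_coef P p_gt0 y / l`!%:R) *: \prod_i tvar a (y i).
Proof.
rewrite jet_op_words; apply: eq_bigr => l _; rewrite scaler_sumr.
pose ty (ks : {ffun 'I_l -> J}) : {ffun 'I_l -> V} := [ffun i => jtype (ks i)].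
pose G (ks : {ffun 'I_l -> J}) : A := (word_coef P p_gt0 (ty ks) / l`!%:R) *:
   \prod_i (a (ks i) *: theta R (ks i)).
(* The condition on the letters becomes a condition on the types alone: words with a repeated letter
   have product 0, and words with a member of higher order vanish on both sides. *)
transitivity (\sum_(ks : {ffun 'I_l -> J} | (\sum_i uv_deg p (ty ks i) == q)%N) G ks).
  rewrite big_mkcond [RHS]big_mkcond; apply: eq_bigr => ks _.
  rewrite /G scaler_prod; have [/forallP lk|] := boolP [forall i, low (ks i)]; last first.
    move=> /forallPn[i hi]; rewrite (prod_theta_high R hi) !scaler0.
    case: ifP => [/andP[u /eqP sq]|_]; last by case: ifP.
    by rewrite (jet_op_high P p_gt0 x hi u sq) !scaler0; case: ifP.
  have -> : size (jflat ks) = (\sum_i uv_deg p (ty ks i))%N.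
    by rewrite size_jflat; apply: eq_bigr => i _; rewrite ffunE jdeg_type.
  rewrite prod_theta //.
  have [u|nu] := boolP (uniq (jflat ks)); last first.
    by rewrite dzs_notuniq // !scaler0; case: ifP.
  case: eqP => //= sq; rewrite (word_coefE P p_gt0 x lk u); last first.
    by rewrite size_jflat; apply: etrans _ sq; apply: eq_bigr => i _; rewrite ffunE jdeg_type.
  have -> : @jtype n m p r \o ks = ty ks by apply: functional_extensionality_dep => i; rewrite ffunE.
  rewrite !scalerA. by congr (_ *: _); move: (_^-1) (word_coef _ _ _) => u1 u2; ring.
rewrite (partition_big ty (fun y : {ffun 'I_l -> V} => (\sum_i uv_deg p (y i) == q)%N)) //=.
apply: eq_bigr => y yq; rewrite /tvar bigA_distr_big_dep scaler_sumr.
apply: eq_big => [ks|ks].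
  apply/andP/familyP => [[_ /eqP e] i|H].
    by rewrite unfold_in /= -e ffunE.
  have e : ty ks = y by apply/ffunP => i; rewrite ffunE; apply/eqP; exact: H.
  by rewrite e.
by move=> /andP[_ /eqP <-].
Qed.

End WordExpansion.

(** * The anti-commutative algebra *)

Section AntiCommutativeRing.
Variables (R : realType) (V : finType) (d : V -> nat).
Local Notation C := (cplx R).
Local Notation T := (ac_alg R d).
Local Notation ac_eq := (@ac_eq R V d).
Implicit Types (s t u : ac_term R V) (Q : T).

HB.instance Definition _ := gen_eqMixin T.
HB.instance Definition _ := gen_choiceMixin T.

Lemma ac_ofP s t : ac_of d s = ac_of d t <-> ac_eq s t.
Proof.
split=> [[e]|e].
  by rewrite (congr1 (fun f : _ -> Prop => f t) e); exact: ac_refl.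
have ee : ac_eq s = ac_eq t.
  apply/funext => w; apply/propext; split; apply: ac_trans => //.
  exact: ac_sym.
rewrite /ac_of; move: (ex_intro _ s _) (ex_intro _ t _).
by rewrite ee => h h'; congr ACAlg; exact: Prop_irrelevance.
Qed.

(** The same choice of representative as in [ac_eval], so that [ac_eval_of] reduces to invariance of
    [ac_eval_term]. *)
Definition ac_repr Q : ac_term R V := projT1 (cid (ac_classP Q)).

Lemma ac_reprK Q : ac_of d (ac_repr Q) = Q.
Proof.
rewrite /ac_repr; case: cid => t /= et; case: Q et => cl [t' et'] /= et.
rewrite /ac_of; move: (ex_intro _ t _) (ex_intro _ t' _); rewrite et => h h'.
by congr ACAlg; exact: Prop_irrelevance.
Qed.

Lemma ac_repr_eq t : ac_eq (ac_repr (ac_of d t)) t.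
Proof. by apply/ac_ofP; rewrite ac_reprK. Qed.

Definition ac_add Q1 Q2 : T := ac_of d (ACadd (ac_repr Q1) (ac_repr Q2)).
Definition ac_mul Q1 Q2 : T := ac_of d (ACmul (ac_repr Q1) (ac_repr Q2)).
Definition ac_const (c : C) : T := ac_of d (ACconst V c).
Definition ac_opp Q : T := ac_mul (ac_const (-1)) Q.
Definition ac_var (i : V) : T := ac_of d (ACvar R i).

Lemma ac_of_add s t : ac_of d (ACadd s t) = ac_add (ac_of d s) (ac_of d t).
Proof. by apply/ac_ofP/ac_congD; apply: ac_sym; exact: ac_repr_eq. Qed.

Lemma ac_of_mul s t : ac_of d (ACmul s t) = ac_mul (ac_of d s) (ac_of d t).
Proof. by apply/ac_ofP/ac_congM; apply: ac_sym; exact: ac_repr_eq. Qed.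

Lemma ac_ind (K : T -> Prop) : (forall t, K (ac_of d t)) -> forall Q, K Q.
Proof. by move=> h Q; rewrite -(ac_reprK Q). Qed.

Fact ac_alg_addA : associative ac_add.
Proof.
elim/ac_ind => s; elim/ac_ind => t; elim/ac_ind => u.
rewrite -(ac_of_add t u) -(ac_of_add s t) -(ac_of_add s) -(ac_of_add _ u).
exact/ac_ofP/ac_addA.
Qed.

Fact ac_alg_addC : commutative ac_add.
Proof.
elim/ac_ind => s; elim/ac_ind => t.
by rewrite -!ac_of_add; apply/ac_ofP/ac_addC.
Qed.

Fact ac_alg_add0 : left_id (ac_const 0) ac_add.
Proof. by elim/ac_ind => s; rewrite -!ac_of_add; apply/ac_ofP/ac_add0. Qed.

Fact ac_alg_mulDl : left_distributive ac_mul ac_add.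
Proof.
elim/ac_ind => s; elim/ac_ind => t; elim/ac_ind => u.
rewrite -(ac_of_add s t) -(ac_of_mul s u) -(ac_of_mul t u) -ac_of_mul -ac_of_add.
exact/ac_ofP/ac_mulDl.
Qed.

Fact ac_alg_mulDr : right_distributive ac_mul ac_add.
Proof.
elim/ac_ind => s; elim/ac_ind => t; elim/ac_ind => u.
rewrite -(ac_of_add t u) -(ac_of_mul s t) -(ac_of_mul s u) -ac_of_mul -ac_of_add.
exact/ac_ofP/ac_mulDr.
Qed.

Fact ac_alg_mulA : associative ac_mul.
Proof.
elim/ac_ind => s; elim/ac_ind => t; elim/ac_ind => u.
rewrite -(ac_of_mul t u) -(ac_of_mul s t) -(ac_of_mul s) -(ac_of_mul _ u).
exact/ac_ofP/ac_mulA.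
Qed.

Fact ac_alg_mul1l : left_id (ac_const 1) ac_mul.
Proof. by elim/ac_ind => s; rewrite -!ac_of_mul; apply/ac_ofP/ac_mul1l. Qed.

Fact ac_alg_mul1r : right_id (ac_const 1) ac_mul.
Proof. by elim/ac_ind => s; rewrite -!ac_of_mul; apply/ac_ofP/ac_mul1r. Qed.

Fact ac_alg_constD x y : ac_add (ac_const x) (ac_const y) = ac_const (x + y).
Proof. by rewrite -ac_of_add; apply/ac_ofP/ac_constD. Qed.

Fact ac_alg_addN : left_inverse (ac_const 0) ac_opp ac_add.
Proof.
elim/ac_ind => s; rewrite /ac_opp -{2}(ac_alg_mul1l (ac_of d s)) -ac_alg_mulDl ac_alg_constD.
by rewrite addNr -ac_of_mul; apply/ac_ofP/ac_mul0l.
Qed.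

HB.instance Definition _ := GRing.isZmodule.Build T
  ac_alg_addA ac_alg_addC ac_alg_add0 ac_alg_addN.
HB.instance Definition _ := GRing.Zmodule_isPzRing.Build T
  ac_alg_mulA ac_alg_mul1l ac_alg_mul1r ac_alg_mulDl ac_alg_mulDr.

Lemma ac_constDE x y : ac_const (x + y) = ac_const x + ac_const y.
Proof. by rewrite -ac_alg_constD. Qed.

Lemma ac_constME x y : ac_const (x * y) = ac_const x * ac_const y.
Proof. by apply/esym; rewrite -[LHS]ac_of_mul; apply/ac_ofP/ac_constM. Qed.

Lemma ac_const0E : ac_const 0 = 0. Proof. by []. Qed.
Lemma ac_const1E : ac_const 1 = 1. Proof. by []. Qed.

Lemma ac_constNE x : ac_const (- x) = - ac_const x.
Proof. by apply: (addrI (ac_const x)); rewrite -ac_constDE !subrr. Qed.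

Lemma ac_constCE x Q : ac_const x * Q = Q * ac_const x.
Proof.
elim/ac_ind: Q => s; rewrite -[LHS]ac_of_mul -[RHS]ac_of_mul.
exact/ac_ofP/ac_constC.
Qed.

Lemma ac_var_anti i j :
  ac_var i * ac_var j = ac_const ((-1) ^+ (d i * d j)) * (ac_var j * ac_var i).
Proof.
rewrite -[LHS]ac_of_mul -[ac_var j * _]ac_of_mul -[RHS]ac_of_mul.
exact/ac_ofP/ac_anti.
Qed.

Lemma ac_of_addE s t : ac_of d (ACadd s t) = ac_of d s + ac_of d t.
Proof. exact: ac_of_add. Qed.

Lemma ac_of_mulE s t : ac_of d (ACmul s t) = ac_of d s * ac_of d t.
Proof. exact: ac_of_mul. Qed.

Lemma ac_of_monomial (a : {ffun V -> nat}) :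
  ac_of d (ac_monomial R a) = \prod_(i <- enum V) ac_var i ^+ a i.
Proof.
rewrite /ac_monomial; elim: (enum V) => [|i s IHs]; first by rewrite !big_nil.
rewrite !big_cons ac_of_mulE IHs; congr (_ * _).
by elim: (a i) => [|m IHm] //=; rewrite ac_of_mulE IHm exprS.
Qed.

Definition ac_mono (a : V -> nat) : T := \prod_(i <- enum V) ac_var i ^+ a i.

Lemma ac_of_sum (l : seq (C * {ffun V -> nat})) :
  ac_of d (\big[@ACadd R V/ACconst V 0]_(ca <- l)
                 ACmul (ACconst V ca.1) (ac_monomial R ca.2)) =
  \sum_(ca <- l) ac_const ca.1 * ac_mono ca.2.
Proof.
elim: l => [|ca l IHl]; first by rewrite !big_nil.
by rewrite !big_cons ac_of_addE IHl ac_of_mulE ac_of_monomial.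
Qed.

Lemma ac_homogP q Q : ac_homog q Q <-> exists l : seq (C * {ffun V -> nat}),
    all (fun ca : C * {ffun V -> nat} => \sum_i ca.2 i * d i == q)%N l /\
    Q = \sum_(ca <- l) ac_const ca.1 * ac_mono ca.2.
Proof.
by split=> -[l [hl ->]]; exists l; split=> //; rewrite ac_of_sum.
Qed.

Lemma ac_homogD q Q1 Q2 : ac_homog q Q1 -> ac_homog q Q2 -> ac_homog q (Q1 + Q2).
Proof.
move=> /ac_homogP[l1 [h1 ->]] /ac_homogP[l2 [h2 ->]]; apply/ac_homogP.
by exists (l1 ++ l2); rewrite all_cat h1 h2 big_cat.
Qed.

Lemma ac_homog_scale q x Q : ac_homog q Q -> ac_homog q (ac_const x * Q).
Proof.
move=> /ac_homogP[l [h ->]]; apply/ac_homogP.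
exists [seq (x * ca.1, ca.2) | ca <- l]; rewrite all_map; split; first exact: h.
by rewrite big_map mulr_sumr; apply: eq_bigr => ca _; rewrite ac_constME mulrA.
Qed.

Lemma ac_homog0 q : ac_homog q (0 : T).
Proof. by apply/ac_homogP; exists [::]; rewrite big_nil. Qed.

Lemma ac_homog_sum q (I : Type) (r : seq I) (S : pred I) (F : I -> T) :
  (forall i, S i -> ac_homog q (F i)) -> ac_homog q (\sum_(i <- r | S i) F i).
Proof.
by move=> hF; elim/big_ind: _ => //; [exact: ac_homog0|exact: ac_homogD].
Qed.

Lemma ac_var_swap i j m : exists x : C,
  ac_var i * ac_var j ^+ m = ac_const x * (ac_var j ^+ m * ac_var i).
Proof.
elim: m => [|m [x IHm]]; first by exists 1; rewrite expr0 mulr1 mul1r ac_const1E mul1r.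
exists (x * (-1) ^+ (d i * d j)); rewrite exprSr mulrA IHm -!mulrA ac_var_anti.
by rewrite ac_constME !mulrA; congr (_ * _ * _); rewrite -!mulrA; congr (_ * _); rewrite ac_constCE.
Qed.

Lemma ac_var_mono i a : exists x : C,
  ac_var i * ac_mono a = ac_const x * ac_mono (fun j => a j + (i == j))%N.
Proof.
rewrite /ac_mono; have := mem_enum V i; have := enum_uniq V; rewrite inE.
elim: (enum V) => //= j s IHs /andP[js us]; rewrite inE !big_cons => /orP[/eqP ij|iS].
  exists 1; rewrite ac_const1E mul1r -ij eqxx addn1 mulrA -exprS; congr (_ * _).
  by apply: eq_big_seq => k ks; case: eqVneq => [ik|_]; [rewrite -ij ik ks in js|rewrite addn0].
have ij : (i == j) = false by apply: contraNF js => /eqP <-.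
have [x ex] := ac_var_swap i j (a j); have [y ey] := IHs us iS.
exists (x * y); rewrite mulrA ex -!mulrA ey ij addn0 ac_constME.
by rewrite -!mulrA; congr (_ * _); rewrite !mulrA; congr (_ * _); rewrite ac_constCE.
Qed.

(** Sorting the word produces a sign. It stays existential, since homogeneity does not depend on
    it. *)
Lemma ac_word_mono (s : seq V) : exists x : C,
  \prod_(i <- s) ac_var i = ac_const x * ac_mono (fun j => count_mem j s).
Proof.
elim: s => [|i s [x IHs]].
  exists 1; rewrite big_nil /ac_mono big1 ?ac_const1E ?mulr1 //.
have [y ey] := ac_var_mono i (fun j => count_mem j s).
exists (x * y); rewrite big_cons IHs mulrA -ac_constCE -mulrA ey mulrA -ac_constME.
by congr (_ * ac_mono _); apply: functional_extensionality_dep => j; rewrite addnC.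
Qed.

Lemma ac_word_homog q (s : seq V) : (\sum_(i <- s) d i)%N = q ->
  ac_homog q (\prod_(i <- s) ac_var i).
Proof.
move=> sq; have [x ->] := ac_word_mono s; apply: ac_homog_scale; apply/ac_homogP.
exists [:: (1, [ffun j => count_mem j s])]; rewrite big_seq1 mul1r; split; last first.
  by rewrite /ac_mono; apply: eq_bigr => j _; rewrite ffunE.
rewrite /= andbT -sq; apply/eqP.
transitivity (\sum_i \sum_(j <- s | j == i) d j)%N.
  apply: eq_bigr => i _; rewrite ffunE -sum1_count big_distrl /=.
  by apply: eq_bigr => j /eqP ->; rewrite mul1n.
rewrite (exchange_big_dep predT) //=; apply: eq_bigr => j _.
by rewrite (big_pred1 j) // => i; rewrite eq_sym.
Qed.

(** The relation of an odd variable with itself says that its square is its own opposite, and 2 is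
    invertible among the constants. *)
Lemma ac_mono_odd_eq0 (a : V -> nat) i : odd (d i) -> (1 < a i)%N -> ac_mono a = 0.
Proof.
move=> oi ai; have x0 : ac_var i * ac_var i = 0.
  have := ac_var_anti i i; rewrite -signr_odd oddM oi expr1.
  move: (ac_var i * ac_var i) => y; rewrite ac_constNE mulN1r => e.
  have yy : ac_const 2%:R * y = 0.
    by rewrite -[2%:R]/(1 + 1) ac_constDE mulrDl ac_const1E mul1r {2}e subrr.
  have : ac_const (2%:R^-1 * 2%:R) * y = 0 by rewrite ac_constME -mulrA yy mulr0.
  by rewrite mulVf ?pnatr_eq0 // mul1r.
apply: (@prod_mem_eq0 _ _ _ _ i); first by rewrite mem_enum.
by case: (a i) ai => [|[|b]] // _; rewrite 2!exprS mulrA x0 mul0r.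
Qed.

Section Eval.
Variables (n : nat) (e : V -> ext R n).
Hypothesis he : forall i, ext_homog (d i) (e i).
Local Notation A := (extalg R n).

(** The degrees of the forms [e i] enter only in the last case, the graded commutation. *)
Lemma ac_eval_term_eq s t : ac_eq s t -> ac_eval_term e s = ac_eval_term e t.
Proof.
elim=> //=.
- by move=> u v w _ -> _ ->.
- by move=> s1 s2 t1 t2 _ -> _ ->.
- by move=> s1 s2 t1 t2 _ -> _ ->.
- by move=> *; rewrite addrA.
- by move=> *; rewrite addrC.
- by move=> u; apply/ffunP => I; rewrite !ffunE mul0r add0r.
- by move=> u v w; exact: (@mulrA A).
- by move=> u; rewrite [ext_scale _ _](@scale1r _ A); exact: (@mul1r A).
- by move=> u; rewrite [ext_scale _ _](@scale1r _ A); exact: (@mulr1 A).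
- move=> u; rewrite [ext_scale _ _](@scale0r _ A); exact: (@mul0r A).
- by move=> u v w; exact: (@mulrDl A).
- by move=> u v w; exact: (@mulrDr A).
- by move=> x y; apply/esym; exact: (@scalerDl _ A).
- move=> x y; apply: etrans (esym (@scalerAl _ A x 1 _)) _.
  by rewrite mul1r; exact: (@scalerA _ A x y 1).
- move=> x u; apply: etrans (esym (@scalerAl _ A x 1 _)) _.
  apply: etrans _ (@scalerAr _ A x (ac_eval_term e u) 1).
  by congr (_ *: _); rewrite mul1r mulr1.
- move=> i j; transitivity ((-1) ^+ (d i * d j) *: ((e j : A) * e i)).
    exact: ext_mulC.
  apply: etrans _ (@scalerAl _ A ((-1) ^+ (d i * d j)) 1 ((e j : A) * e i)).
  by rewrite mul1r.
Qed.

Lemma ac_eval_of t : ac_eval e (ac_of d t) = ac_eval_term e t.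
Proof. exact/ac_eval_term_eq/ac_repr_eq. Qed.

Lemma ac_evalD Q1 Q2 : ac_eval e (Q1 + Q2) = (ac_eval e Q1 : A) + ac_eval e Q2.
Proof.
by elim/ac_ind: Q1 => s; elim/ac_ind: Q2 => t; rewrite -ac_of_addE !ac_eval_of.
Qed.

Lemma ac_evalM Q1 Q2 : ac_eval e (Q1 * Q2) = (ac_eval e Q1 : A) * ac_eval e Q2.
Proof.
by elim/ac_ind: Q1 => s; elim/ac_ind: Q2 => t; rewrite -ac_of_mulE !ac_eval_of.
Qed.

Lemma ac_eval_const x : ac_eval e (ac_const x) = x *: (1 : A).
Proof. exact: ac_eval_of. Qed.

Lemma ac_eval_scale x Q : ac_eval e (ac_const x * Q) = x *: (ac_eval e Q : A).
Proof. by rewrite ac_evalM ac_eval_const -scalerAl mul1r. Qed.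

Lemma ac_eval_var i : ac_eval e (ac_var i) = e i.
Proof. exact: ac_eval_of. Qed.

Lemma ac_eval1 : ac_eval e 1 = 1 :> A.
Proof. by rewrite -ac_const1E ac_eval_const scale1r. Qed.

Lemma ac_eval0 : ac_eval e 0 = 0 :> A.
Proof. by rewrite -ac_const0E ac_eval_const scale0r. Qed.

Lemma ac_evalN Q : ac_eval e (- Q) = - (ac_eval e Q : A).
Proof.
by apply: (@addrI A (ac_eval e Q)); rewrite -ac_evalD !subrr ac_eval0.
Qed.

Lemma ac_eval_sum (I : Type) (r : seq I) (S : pred I) (F : I -> T) :
  ac_eval e (\sum_(i <- r | S i) F i) = \sum_(i <- r | S i) (ac_eval e (F i) : A).
Proof. by apply: (big_morph (ac_eval e)) => //; [exact: ac_evalD|exact: ac_eval0]. Qed.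

Lemma ac_eval_prod (I : Type) (r : seq I) (S : pred I) (F : I -> T) :
  ac_eval e (\prod_(i <- r | S i) F i) = \prod_(i <- r | S i) (ac_eval e (F i) : A).
Proof. by apply: (big_morph (ac_eval e)) => //; [exact: ac_evalM|exact: ac_eval1]. Qed.

Lemma ac_eval_mono (a : V -> nat) :
  ac_eval e (ac_mono a) = \prod_(i <- enum V) (e i : A) ^+ a i.
Proof.
rewrite ac_eval_prod; apply: eq_bigr => i _.
elim: (a i) => [|m IHm]; first exact: ac_eval1.
by rewrite !exprS ac_evalM IHm ac_eval_var.
Qed.

End Eval.

End AntiCommutativeRing.

(** * Separation of homogeneous polynomials by their values *)

Section Separation.
Variables (R : realType) (V : finType) (d : V -> nat) (n : nat).
Hypothesis d_gt0 : forall i, (0 < d i)%N.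
Local Notation C := (cplx R).
Local Notation A := (extalg R n).

(* [e] is the sum of the exterior products of [a] consecutive blocks of [s]. *)
Lemma block_power k a (s : seq 'I_n) : (0 < k)%N -> (odd k -> (a <= 1)%N) ->
  size s = (a * k)%N ->
  exists e : A, [/\ ext_homog k e, (e ^+ a = a`!%:R *: dzs R s)%R &
    forall b, (a < b)%N -> (e ^+ b = 0)%R].
Proof.
move=> k0; elim: a s => [|a IHa] s ok ss.
  exists 0; split; first exact: ext_homog0.
    by rewrite expr0 fact0 scale1r (size0nil ss) /dzs big_nil.
  by move=> [|b] // _; rewrite expr0n.
have hk : (k <= size s)%N by rewrite ss mulSn leq_addr.
have st : size (take k s) = k by rewrite size_takel.
have [|e [he ea eb]] := IHa (drop k s) (fun o => ltnW (ok o)).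
  by rewrite size_drop ss mulSn addnC addnK.
pose x := dzs R (take k s); have hx : ext_homog k x by rewrite -[k]st; exact: dzs_homog.
have xx : x * x = 0.
  rewrite /x -dzs_cat dzs_notuniq // cat_uniq negb_and; apply/orP; right.
  rewrite negb_and negbK; apply/orP; left.
  have : (0 < size (take k s))%N by rewrite st.
  by case: (take k s) => // u t _; apply/hasP; exists u; rewrite inE eqxx.
(* Forms of even degree commute; for odd [k] there is a single block and [e] is 0. *)
have xe : GRing.comm x e.
  have [oddk|evenk] := boolP (odd k).
    have a0 : a = 0%N by have := ok oddk; rewrite ltnS leqn0 => /eqP.
    by move: (eb 1%N); rewrite a0 expr1 => /(_ isT) ->; rewrite /GRing.comm mulr0 mul0r.
  by rewrite /GRing.comm (ext_mulC hx he) -signr_odd oddM (negbTE evenk) scale1r.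
(* The binomial formula, of which only two terms survive because [x * x = 0]. *)
have pow b : (x + e) ^+ b.+1 = e ^+ b.+1 + (x * e ^+ b) *+ b.+1.
  elim: b => [|b IHb]; first by rewrite !expr1 expr0 mulr1 addrC.
  have ee : e * (x * e ^+ b) = x * e ^+ b.+1 by rewrite mulrA -xe -mulrA -exprS.
  rewrite exprS IHb mulrDl !mulrDr !mulrnAr ee [x * (x * _)]mulrA xx mul0r mul0rn.
  by rewrite addr0 -exprS addrCA -mulrS.
exists (x + e); split; first exact: ext_homogD.
  rewrite pow eb // add0r ea -scalerAr -dzs_cat cat_take_drop -scaler_nat scalerA.
  by rewrite factS natrM.
move=> [|b] //; rewrite ltnS => ab.
by rewrite pow !eb ?mulr0 ?mul0rn ?addr0 // (ltn_trans ab).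
Qed.

(** Cut [s] into consecutive segments of lengths [a i * d i] and apply [block_power] to each. The
    factorials make up the nonzero constant. *)
Lemma blocks_product (vs : seq V) (a : V -> nat) (s : seq 'I_n) : uniq vs ->
  (forall i, odd (d i) -> (a i <= 1)%N) -> size s = (\sum_(i <- vs) a i * d i)%N ->
  exists (e : V -> A) (c : C), [/\ forall i, ext_homog (d i) (e i), c != 0,
    (\prod_(i <- vs) e i ^+ a i = c *: dzs R s)%R &
    forall i b, i \in vs -> (a i < b)%N -> (e i ^+ b = 0)%R].
Proof.
move=> + oa; elim: vs s => [|v vs IHv] s /=.
  move=> _; rewrite big_nil => /size0nil s0; rewrite s0.
  exists (fun=> 0), 1; split=> // [i|]; first exact: ext_homog0.
  by rewrite scale1r /dzs !big_nil.
move=> /andP[vvs uvs]; rewrite big_cons => ss.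
have [|e [c [he c0 ce eb]]] := IHv (drop (a v * d v)%N s) uvs.
  by rewrite size_drop ss addnC addnK.
have [|ev [hev eva evb]] := block_power (s := take (a v * d v)%N s) (d_gt0 v) (oa v).
  by rewrite size_takel // ss leq_addr.
exists (fun i => if i == v then ev else e i), ((a v)`!%:R * c); split.
- by move=> i; case: eqP => [->|].
- by rewrite mulf_neq0 // pnatr_eq0 -lt0n fact_gt0.
- rewrite big_cons eqxx eva (eq_big_seq (fun i => e i ^+ a i)) => [|i ivs].
    by rewrite ce -scalerAl -scalerAr scalerA -dzs_cat cat_take_drop.
  by case: eqP => // iv; rewrite -iv ivs in vvs.
- move=> i b; rewrite inE; case: eqP => [->|_] /= ivs ab; first exact: evb.
  exact: eb.
Qed.

(** To detect the coefficient of [b0], take the forms of [blocks_product] for the exponents [b0]: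
    any other exponent of the same degree exceeds [b0] somewhere, and that power vanishes. *)
Lemma ac_homog_separated q (Q1 Q2 : ac_alg R d) : (q <= n)%N ->
  ac_homog q Q1 -> ac_homog q Q2 ->
  (forall e : V -> ext R n, (forall i, ext_homog (d i) (e i)) ->
    ac_eval e Q1 = ac_eval e Q2) -> Q1 = Q2.
Proof.
move=> qn h1 h2 h12; apply/eqP; rewrite -subr_eq0; apply/eqP.
have : ac_homog q (Q1 - Q2).
  by apply: ac_homogD => //; rewrite -mulN1r -(ac_const1E R d) -ac_constNE; exact: ac_homog_scale.
have {h12} : forall e : V -> ext R n, (forall i, ext_homog (d i) (e i)) ->
    ac_eval e (Q1 - Q2) = 0.
  by move=> e he; rewrite ac_evalD // ac_evalN // (h12 e he) subrr.
move: (Q1 - Q2) => Q hQ /ac_homogP[l [hl QE]].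
pose B := undup (unzip2 l).
(* The list [l] may repeat an exponent; collecting equal monomials makes the coefficients well
   defined. *)
pose c b : C := \sum_(ca <- l | ca.2 == b) ca.1.
have QB : Q = \sum_(b <- B) ac_const d (c b) * ac_mono R d b.
  rewrite QE; transitivity (\sum_(b <- B) \sum_(ca <- l | ca.2 == b) ac_const d ca.1 * ac_mono R d ca.2).
    rewrite (exchange_big_dep predT) //= big_seq [RHS]big_seq; apply: eq_bigr => ca cal.
    rewrite -big_filter (_ : [seq b <- B | ca.2 == b] = [:: ca.2]) ?big_seq1 //.
    rewrite (eq_filter (a2 := pred1 ca.2)); last by move=> b /=; rewrite eq_sym.
    by apply: filter_pred1_uniq; rewrite ?undup_uniq // mem_undup; apply: map_f.
  apply: eq_bigr => b _; rewrite /c (big_morph _ (@ac_constDE R V d) (ac_const0E R d)).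
  by rewrite mulr_suml; apply: eq_bigr => ca /eqP ->.
have wB b : b \in B -> (\sum_i b i * d i)%N = q.
  by rewrite mem_undup => /mapP[ca /(allP hl) /eqP h ->].
rewrite QB big1_seq // => b0 /= b0B.
(* A monomial with the square of an odd variable is zero in the algebra, so its coefficient need not
   be. *)
have [/forallP red|] := boolP [forall i, odd (d i) ==> (b0 i <= 1)%N]; last first.
  move=> /forallPn[i]; rewrite negb_imply -ltnNge => /andP[oi bi].
  by rewrite (ac_mono_odd_eq0 _ oi bi) mulr0.
suff -> : c b0 = 0 by rewrite ac_const0E mul0r.
(* The bound q <= n provides [q] distinct coordinates. *)
pose s := take q (enum 'I_n).
have ss : size s = q by rewrite size_takel // size_enum_ord.
have us : uniq s by rewrite take_uniq // enum_uniq.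
have [|e [x [he x0 ex ez]]] := @blocks_product (enum V) b0 s (enum_uniq V) (fun i => implyP (red i)).
  by rewrite ss big_enum /= wB.
have := hQ e he; rewrite QB ac_eval_sum // (bigD1_seq b0) ?undup_uniq //= big1_seq.
  rewrite addr0 ac_eval_scale // ac_eval_mono // ex => /eqP.
  rewrite !scaler_eq0 (negbTE x0) /=; case/orP => [/eqP //|].
  have [y ey] := dzs_uniqE R us; rewrite ey scaler_eq0 signr_eq0 /= => /eqP.
  move=> /ffunP/(_ [set i in s]%SET)/eqP.
  by rewrite dzs_enum !ffunE eqxx oner_eq0.
move=> b /andP[bb0 bB]; rewrite ac_eval_scale // ac_eval_mono //.
(* If [b] were at most [b0] everywhere, equality of the weighted sums with positive degrees would
   force [b = b0]. *)
have [i bi] : exists i, (b0 i < b i)%N.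
  apply/existsP; apply: contraNT bb0 => /existsPn H.
  have lb i : (b i * d i <= b0 i * d i)%N by rewrite leq_mul2r leqNgt H orbT.
  have := eq_leq (etrans (wB _ b0B) (esym (wB _ bB))).
  have := leqif_sum (fun i (_ : true) => leqif_eq (lb i)).
  rewrite !wB // => -[_ /esym]; rewrite eqxx => /forallP E _.
  apply/eqP/ffunP => i; have := E i; rewrite /= eqn_pmul2r ?d_gt0 // => /eqP.
  by [].
suff -> : \prod_(i <- enum V) (e i : A) ^+ b i = 0 by rewrite scaler0.
by apply: (@prod_mem_eq0 _ _ _ _ i); [|apply: ez]; rewrite ?mem_enum.
Qed.

End Separation.

(** * Forms in terms of jets *)

Section JetValues.
Variables (R : realType) (n : nat) (X : cmanifold R n).
Variables (m : nat) (p : 'I_m -> nat) (r : nat).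
Local Notation C := (cplx R).
Local Notation A := (extalg R n).
Local Notation J := (jet_index n p r).
Local Notation V := ('I_m * 'I_2)%type.
Implicit Types (x : X) (k : J) (a : J -> C) (K : {set 'I_n}) (o : option 'I_n) (v : V).

(** The multi-indices of length at most one: [None] is no derivative, [Some j] is the derivative
    along [j]. *)
Definition deltao o : {ffun 'I_n -> nat} := [ffun u => nat_of_bool (Some u == o)].

Lemma deltao_sum o : (\sum_u deltao o u)%N = isSome o.
Proof.
under eq_bigr do rewrite ffunE; case: o => [j|]; last by rewrite big1.
rewrite (bigD1 j) //= eqxx big1 // => u /negbTE uj.
by rewrite (inj_eq (@Some_inj _)) uj.
Qed.

Lemma deltao_inj : injective deltao.
Proof.
move=> [j|] [j'|] // /ffunP.
- by move=> /(_ j); rewrite !ffunE eqxx; case: eqP.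
- by move=> /(_ j); rewrite !ffunE eqxx.
- by move=> /(_ j'); rewrite !ffunE eqxx.
Qed.

Lemma jet_index_exists (i : 'I_m) K o : #|K| = p i -> (isSome o <= r)%N ->
  exists k, [/\ jcomp k = i, jset k = K & jexp k = deltao o].
Proof.
move=> Kp or; pose al : {ffun 'I_n -> 'I_r.+1} := [ffun u => inord (deltao o u)].
have alE u : al u = deltao o u :> nat.
  rewrite ffunE inordK // ltnS; apply: leq_trans or; rewrite -deltao_sum.
  by rewrite (bigD1 u) //= leq_addr.
have H : (#|K| == p i) && (\sum_j al j <= r)%N.
  by rewrite Kp eqxx /= (eq_bigr (deltao o)) => [|u _]; rewrite ?deltao_sum // alE.
exists (exist _ (i, K, al) H); split=> //.
by apply/ffunP => u; rewrite ffunE -alE.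
Qed.

Lemma low_deltao k : low k -> exists o, jexp k = deltao o.
Proof.
rewrite /low; have [/eqP|s0] := eqVneq (\sum_j jexp k j)%N 0%N.
  rewrite sum_nat_eq0 => /forallP H _; exists None; apply/ffunP => u.
  by rewrite [RHS]ffunE; apply/eqP; exact: H.
have /exists_inP[j _ j0] : [exists j in 'I_n, jexp k j != 0%N].
  apply: contraNT s0 => /exists_inPn H; rewrite sum_nat_eq0; apply/forallP => j.
  by apply/implyP => _; have := H j isT; rewrite negbK.
rewrite (bigD1 j) //=; case jk : (jexp k j) j0 => [|s] // _.
rewrite addSn ltnS leqn0 addn_eq0 => /andP[/eqP s00]; rewrite sum_nat_eq0 => /forallP H.
exists (Some j); apply/ffunP => u; rewrite [RHS]ffunE (inj_eq (@Some_inj _)).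
have := H u; case: (eqVneq u j) => [->|_ /= /eqP->//].
by rewrite jk s00.
Qed.

Definition listo o : seq 'I_n := if o is Some j then [:: j] else [::].

Lemma jlist_deltao k o : jexp k = deltao o -> jlist k = listo o.
Proof.
move=> e; have := size_jlist k; rewrite e deltao_sum; case: o e => [j|] e /=; last first.
  by move/size0nil.
case el : (jlist k) => [|u [|]] //= _; have := count_jlist k j.
by rewrite el e ffunE eqxx /= addn0; case: eqP => // ->.
Qed.

Lemma theta_deltao k o : jexp k = deltao o -> theta R k = dzs R (listo o ++ enum (jset k)).
Proof.
move=> e; rewrite /theta /low e deltao_sum /jblock (jlist_deltao e).
by case: o e.
Qed.

Lemma jtype_deltao k o v : jexp k = deltao o ->
  (jtype k == v) = (jcomp k == v.1) && (isSome o == v.2 :> nat).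
Proof.
move=> e; rewrite /jtype e deltao_sum; case: v => [i t]; rewrite xpair_eqE /=.
congr (_ && _); rewrite -val_eqE /=; case: o e => [j|] _ /=;
by case: t => [[|[|]]].
Qed.

(** A jet index of order at most one is a component, an optional derivative and a set. Since [jtype]
    also sends all higher orders to [ord_max], [g] is required to vanish on them. *)
Lemma sum_jtype (g : J -> A) (h : option 'I_n -> {set 'I_n} -> A) v : (v.2 <= r)%N ->
  (forall k, ~~ low k -> g k = 0) ->
  (forall k o, jcomp k = v.1 -> jexp k = deltao o -> g k = h o (jset k)) ->
  \sum_(k | jtype k == v) g k =
  \sum_(o | isSome o == v.2 :> nat) \sum_(K : {set 'I_n} | #|K| == p v.1) h o K.
Proof.
move=> vr g0 gh; rewrite pair_big_dep /=.
pose Z (z : option 'I_n * {set 'I_n}) := (isSome z.1 == v.2 :> nat) && (#|z.2| == p v.1).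
pose cond k (z : option 'I_n * {set 'I_n}) :=
  [&& jcomp k == v.1, jset k == z.2 & jexp k == deltao z.1].
transitivity (\sum_(z | Z z) \sum_(k | cond k z) g k); last first.
  apply: eq_bigr => -[ o K] /andP[/= /eqP ov /eqP Kp].
  have [|k0 [c0 s0 e0]] := jet_index_exists Kp (o := o); first by rewrite ov.
  rewrite (big_pred1 k0) => [|k]; first by rewrite (gh _ _ c0 e0) s0.
  apply/and3P/eqP => [[/eqP c1 /eqP s1 /eqP e1]|->]; last by rewrite c0 s0 e0.
  by apply: jet_index_inj; rewrite ?c0 ?s0 ?e0.
rewrite (exchange_big_dep predT) //= big_mkcond; apply: eq_bigr => k _.
have [lk|hk] := boolP (low k); last first.
  by rewrite g0 // big1 //; case: ifP.
have [ o eo] := low_deltao lk; rewrite (jtype_deltao v eo).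
have condE z : Z z && cond k z =
    ((jcomp k == v.1) && (isSome o == v.2 :> nat)) && (z == (o, jset k)).
  case: z => t K; rewrite /Z /cond /= eo (inj_eq deltao_inj) xpair_eqE.
  rewrite [K == _]eq_sym [t == _]eq_sym.
  case: (eqVneq o t) => [->|_]; last by rewrite !andbF.
  case: (eqVneq (jset k) K) => [<-|_]; last by rewrite !andbF.
  rewrite !andbT jset_card; case: (eqVneq (jcomp k) v.1) => [->|_]; last by rewrite !andbF.
  by rewrite eqxx !andbT.
rewrite (eq_bigl _ _ condE); case: ifP => _; last by rewrite big_pred0.
by rewrite big_pred1_eq.
Qed.

Lemma multi_partial_None (f : 'rV[C]_n -> C) : multi_partial (deltao None) f = f.
Proof.
rewrite /multi_partial; elim: (enum 'I_n) => //= j s ->.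
by rewrite ffunE.
Qed.

Lemma multi_partial_Some j (f : 'rV[C]_n -> C) :
  multi_partial (deltao (Some j)) f = partial j f.
Proof.
rewrite /multi_partial; have := enum_uniq 'I_n; have := mem_enum 'I_n j; rewrite inE.
have notin s : j \notin s ->
    foldr (fun i g => iter (deltao (Some j) i) (partial i) g) f s = f.
  elim: s => //= i s IHs; rewrite inE negb_or => /andP[ij js].
  by rewrite IHs // ffunE (inj_eq (@Some_inj _)) eq_sym (negbTE ij).
elim: (enum 'I_n) => //= i s IHs; rewrite inE => jis /andP[is_ us].
move: jis; case: (eqVneq j i) => [ji _|ij /= js].
  by rewrite notin ji // ffunE eqxx.
by rewrite IHs // ffunE (inj_eq (@Some_inj _)) eq_sym (negbTE ij).
Qed.

Lemma ext_expand_homog d (a : A) : ext_homog d a ->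
  a = \sum_(K : {set 'I_n} | #|K| == d) a K *: dzs R (enum K).
Proof.
move=> ha; rewrite {1}[a]ext_expand [RHS]big_mkcond; apply: eq_bigr => K _.
by case: eqP => // /eqP Kd; rewrite ha // scale0r.
Qed.

Lemma form_expr_homog x (w : local_section p x) i :
  \forall z \near cmap (chart_at x) x,
    ext_homog (p i) (form_expr (chart_at x) (w i) z).
Proof.
have nw : \forall y \near x, ext_homog (p i) (w i y).
  by apply: filterS (section_holo w i) => y [].
apply: filterS (near_cinv (chart_at_dom x) nw) => z hz.
by rewrite /form_expr covector_exprE; exact: pull_homog.
Qed.

(** Both [form_deriv] and the jet coefficients are taken in the preferred chart, so the comparison
    is term by term in dz_K and dz_j /\ dz_K. *)
Lemma uv_value_tvar x (w : local_section p x) v : (v.2 <= r)%N ->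
  uv_value w x v = tvar (jet_coef w x : J -> C) v.
Proof.
move=> vr; set c := chart_at x.
pose F K z := form_expr c (w v.1) z K.
rewrite /tvar (sum_jtype (g := fun k => jet_coef w x k *: theta R k)
  (h := fun o K => multi_partial (deltao o) (F K) (cmap c x) *: dzs R (listo o ++ enum K))) //.
- have F0 := nbhs_singleton (form_expr_homog w v.1).
  have cw : form_expr c (w v.1) (cmap c x) = w v.1 x.
    by rewrite form_exprE ?covector_expr_id //; exact: chart_at_dom.
  rewrite /uv_value; case: eqP => [v0|v0].
    rewrite (big_pred1 None) => [|o]; last by rewrite v0; case: o.
    under eq_bigr do rewrite multi_partial_None.
    rewrite -cw; exact: ext_expand_homog.
  have v1 : v.2 = 1%N :> nat.
    by case: (v.2) v0 => [[|[|]]] //= ? ne; case: ne; apply: val_inj.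
  rewrite (reindex_omap Some id); last by move=> [j|] //=; rewrite v1.
  rewrite /form_deriv /ext_deriv; apply: eq_big => [j|j _]; first by rewrite v1 eqxx.
  rewrite -/c; set G : A := [ffun I => _].
  (* Coefficients in other degrees vanish near the point and not merely at it, hence so do their
     derivatives. *)
  have hG : ext_homog (p v.1) G.
    move=> I pI; rewrite ffunE /partial (near_eq_derive (g := cst 0)) ?derive_cst //.
    by apply: filterS (form_expr_homog w v.1) => z; apply.
  rewrite -[ext_mul _ _]/((dz R j : A) * G) [in LHS](ext_expand_homog hG) mulr_sumr.
  apply: eq_bigr => K _; rewrite -scalerAr multi_partial_Some ffunE.
  by rewrite -dzs_cons.
- by move=> k hk; rewrite /theta (negbTE hk) scaler0.
- by move=> k o ck ek; rewrite (theta_deltao ek) /jet_coef ek /F ck.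
Qed.

Lemma theta_homog k : ext_homog (uv_deg p (jtype k)) (theta R k).
Proof.
rewrite /theta; case: ifP => lk; last exact: ext_homog0.
by rewrite -jdeg_type // -size_jblock; exact: dzs_homog.
Qed.

Lemma tvar_homog a v : ext_homog (uv_deg p v) (tvar a v).
Proof.
by apply: ext_homog_sum => k /eqP <-; apply: ext_homogZ; exact: theta_homog.
Qed.

End JetValues.

(** * Realization of arbitrary values by 1-jets *)

Section Realization.
Variables (R : realType) (n : nat) (m : nat) (p : 'I_m -> nat).
Local Notation C := (cplx R).
Local Notation A := (extalg R n).
Local Notation J := (jet_index n p 1).
Local Notation V := ('I_m * 'I_2)%type.

(** For a variable v_i, any element [j] of [L] can serve as the derivative index, with [L :\ j] as
    the set K; moving [j] to its place costs a sign. *)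
Lemma theta_basis (v : V) (L : {set 'I_n}) : #|L| = uv_deg p v ->
  exists (k : J) (b : bool), jtype k = v /\ theta R k = (-1) ^+ b *: dzs R (enum L).
Proof.
rewrite /uv_deg => Lv.
have [t2|t2] := ltnP 0 v.2.
  have v1 : v.2 = 1%N :> nat by apply/eqP; rewrite eqn_leq t2 -ltnS ltn_ord.
  have /card_gt0P[j jL] : (0 < #|L|)%N by rewrite Lv v1 addn1.
  have [||k [ck sk ek]] := @jet_index_exists n m p 1 v.1 (L :\ j)%SET (Some j) => //.
    by have := Lv; rewrite (cardsD1 j L) jL v1 addn1 add1n => -[].
  have u : uniq (j :: enum (L :\ j)%SET) by rewrite /= mem_enum !inE eqxx enum_uniq.
  have [b eb] := dzs_uniqE R u; exists k, b; split.
    by apply/eqP; rewrite (jtype_deltao _ ek) ck eqxx v1.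
  rewrite (theta_deltao R ek) sk /= eb.
  suff -> : [set i in j :: enum (L :\ j)]%SET = L by [].
  by apply/setP => i; rewrite !inE mem_enum !inE; case: eqP => [->|].
have v0 : v.2 = 0%N :> nat by apply/eqP; rewrite -leqn0.
have [||k [ck sk ek]] := @jet_index_exists n m p 1 v.1 L None => //.
  by rewrite Lv v0 addn0.
exists k, false; split; first by apply/eqP; rewrite (jtype_deltao _ ek) ck eqxx v0.
by rewrite (theta_deltao R ek) sk expr0 scale1r.
Qed.

Lemma tvar_surjective (e : V -> ext R n) : (forall v, ext_homog (uv_deg p v) (e v)) ->
  exists a : J -> C, forall v, tvar a v = e v.
Proof.
move=> he.
have H (z : V * {set 'I_n}) : exists kb : option J * bool,
    #|z.2| = uv_deg p z.1 -> exists k, [/\ kb.1 = Some k, jtype k = z.1 &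
      theta R k = (-1) ^+ kb.2 *: dzs R (enum z.2)].
  have [zd|] := eqVneq #|z.2| (uv_deg p z.1); last by move=> /eqP ?; exists (None, false).
  have [k [b [tk ek]]] := theta_basis zd.
  by exists (Some k, b) => _; exists k.
have [kb hkb] := choice H.
(* Each basis coefficient of each prescribed form is assigned to its chosen jet index. Adding up all
   those that share an index makes injectivity of the choice irrelevant. *)
pose a (k : J) : C := \sum_(z : V * {set 'I_n} | (#|z.2| == uv_deg p z.1) && ((kb z).1 == Some k))
  (-1) ^+ (kb z).2 * e z.1 z.2.
exists a => v; rewrite /tvar /a.
under eq_bigr do rewrite scaler_suml.
rewrite (exchange_big_dep (fun z : V * {set 'I_n} => #|z.2| == uv_deg p z.1)) /=; last first.
  by move=> k z _ /andP[].
transitivity (\sum_(z : V * {set 'I_n} | (z.1 == v) && (#|z.2| == uv_deg p z.1))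
   e z.1 z.2 *: dzs R (enum z.2)); last first.
  rewrite [RHS](ext_expand_homog (he v)).
  rewrite -(pair_big_dep (pred1 v) (fun v (L : {set 'I_n}) => #|L| == uv_deg p v)
    (fun v L => e v L *: dzs R (enum L))) /=.
  by rewrite big_pred1_eq.
rewrite big_mkcond [RHS]big_mkcond; apply: eq_bigr => z _.
case: eqP => zd; last by rewrite andbF.
have [k [ek tk ok]] := hkb z zd; rewrite andbT ek.
case: eqP => [zv|zv]; last first.
  rewrite big_pred0 // => k'; rewrite /= (inj_eq (@Some_inj _)).
  by apply: contra_notF zv => /andP[/eqP <- /eqP <-].
rewrite (big_pred1 k) => [|k']; last first.
  rewrite /= (inj_eq (@Some_inj _)) [k == k']eq_sym.
  by case: (k' =P k) => [->|]; rewrite ?andbF // tk zv eqxx.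
by rewrite ok scalerA mulrAC -expr2 sqrr_sign mul1r.
Qed.

End Realization.

Lemma uv_value_homog (R : realType) (n : nat) (X : cmanifold R n)
    (m : nat) (p : 'I_m -> nat) (x : X) (w : local_section p x) v :
  ext_homog (uv_deg p v) (uv_value w x v).
Proof.
rewrite (@uv_value_tvar R n X m p 1 x w v); first exact: tvar_homog.
by rewrite -ltnS.
Qed.

Local Open Scope classical_set_scope.

Theorem theorem2p10 (R : realType) (n : nat) (X : cmanifold R n)
    (X_nonempty : [set: X] !=set0)
    (m : nat) (p : 'I_m -> nat) (p_gt0 : forall i, (0 < p i)%N)
    (r q : nat) (q_le_n : (q <= n)%N)
    (P : natural_operator X p r q) :
  exists! Q : ac_alg R (uv_deg p),
    ac_homog q Q /\
    forall (x : X) (w : local_section p x),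
      P x (jet_of r w) = ac_eval (uv_value w x) Q.
Proof.
pose V := ('I_m * 'I_2)%type.
pose word l (y : {ffun 'I_l -> V}) : ac_alg R (uv_deg p) :=
  ac_const _ (word_coef P p_gt0 y / l`!%:R) * \prod_(i < l) ac_var R _ (y i).
(* The condition [(y i).2 <= r] excludes the variables v_i when r = 0; for r > 0 it always holds. *)
pose Q := \sum_(l < q.+1) \sum_(y : {ffun 'I_l -> V} |
  (\sum_i uv_deg p (y i) == q)%N && [forall i, ((y i).2 <= r)%N]) word l y.
have hQ : ac_homog q Q.
  apply: ac_homog_sum => l _; apply: ac_homog_sum => y /andP[/eqP yq _].
  apply: ac_homog_scale; rewrite -(big_map y predT (@ac_var R V (uv_deg p))).
  by apply: ac_word_homog; rewrite big_map.
have evQ x (w : local_section p x) : P x (jet_of r w) = ac_eval (uv_value w x) Q.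
  rewrite jet_opE (jet_op_word_polynomial P p_gt0) ac_eval_sum; last exact: uv_value_homog.
  apply: eq_bigr => l _; rewrite ac_eval_sum; last exact: uv_value_homog.
  rewrite big_mkcond [RHS]big_mkcond; apply: eq_bigr => y _.
  case: (_ == q); rewrite //= /word.
  case: ifPn => [/forallP yr|/forallPn[i yi]].
    rewrite ac_eval_scale; last exact: uv_value_homog.
    rewrite ac_eval_prod; last exact: uv_value_homog.
    congr (_ *: _); apply: eq_bigr => i _.
    by rewrite ac_eval_var ?(uv_value_tvar w (yr i)) //; exact: uv_value_homog.
  (* For an excluded word some letter has an empty [tvar], so the word contributed nothing to the
     operator. *)
  rewrite (prod_mem_eq0 (mem_index_enum i)) ?scaler0 // /tvar big_pred0 // => k.
  apply: contraNF yi => /eqP <- /=; have := jexp_sum k.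
  by case: (_ =P _) => // /eqP; rewrite -lt0n => s0; exact: leq_trans.
exists Q; split=> // Q' [hQ' evQ'].
apply: (ac_homog_separated _ q_le_n) => // [v|e he].
  by rewrite /uv_deg addn_gt0 p_gt0.
(* The coefficients are those of a 1-jet even when r = 0, because the values of d omega_i must be
   prescribed too. Nonemptiness of [X] supplies the point that carries the section. *)
have [a ae] := tvar_surjective he; have [x _] := X_nonempty.
pose w := jet_section a x.
have we : e = uv_value w x.
  apply: functional_extensionality_dep => v.
  rewrite (@uv_value_tvar R n X m p 1 x w v); last by rewrite -ltnS.
  by rewrite /w jet_coef_section ae.
by rewrite we -evQ evQ'.
Qed.
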